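(* Let $n\ge1$, $l=\frac{n(n+1)}{2}$, let $\phi_1,\dots,\phi_l$ denote the distinct monomials of degree $2$ in $x=(x_1,\dots,x_n)\in\mathbb{R}^n$, and let $$S=\{(x,x_{n+1},\dots,x_{n+l})\in\mathbb{R}^{n+l}:\ x_{n+1}=\phi_1(x),\dots,x_{n+l}=\phi_l(x)\}.$$ Then the $L^p\to L^2$ restriction estimate for $S$ holds with $p$ equal to the sharp exponent $p_0=\frac{2(n+2)}{2n+3}$.
   Context: Restriction estimate: for $f$ in the Schwartz class $\mathcal{S}(\mathbb{R}^{n+l})$ put $\mathcal{R}f(\eta)=\int_{\mathbb{R}^{n+l}}e^{-i\langle y,\eta\rangle}f(y)\,dy$ for $\eta\in S$. Let $d\sigma$ be a compactly supported smooth measure on $S$, i.e. the measure $\psi(x)\,dx$ in the graph coordinates $x\in\mathbb{R}^n$, with $\psi\ge 0$ smooth and compactly supported. The $L^p\to L^2$ restriction estimate for $S$ with exponent $p$ is: for each such $d\sigma$ there is a constant $C_p$ with $\|\mathcal{R}f\|_{L^2(S,d\sigma)}\le C_p\|f\|_{L^p(\mathbb{R}^{n+l})}$ for all $f\in\mathcal{S}(\mathbb{R}^{n+l})$. Calling $p_0$ the sharp exponent means that, when the density $\psi$ is strictly positive near the origin, the estimate can hold only if $p\le p_0$. *)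

(* Defs.v *)
From HB Require Import structures.
From mathcomp Require Import all_boot all_order all_algebra.
From mathcomp Require Import complex.
From mathcomp Require Import all_classical all_reals all_analysis.

Set Implicit Arguments.
Unset Strict Implicit.
Unset Printing Implicit Defensive.

Import Order.TTheory GRing.Theory Num.Theory.
Import numFieldNormedType.Exports.
Import ComplexField.Normc.

Local Open Scope classical_set_scope.
Local Open Scope ring_scope.

(* 'rV[T]_n carries the sigma-algebra generated by the coordinates; for T = R
   this is the Borel sigma-algebra of R^n. *)
Definition measure_rV_display : measure_display -> measure_display.
Proof. exact. Qed.

Section measurable_rV.
Context {d} {T : measurableType d}.
Variable n : nat.

Definition rV_coord (i : 'I_n) (x : 'rV[T]_n) : T := x ord0 i.

Let rV_set0 : g_sigma_preimage rV_coord set0.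
Proof. exact: sigma_algebra0. Qed.

Let rV_setC A : g_sigma_preimage rV_coord A -> g_sigma_preimage rV_coord (~` A).
Proof. exact: sigma_algebraC. Qed.

Let rV_bigcup (F : _^nat) : (forall i, g_sigma_preimage rV_coord (F i)) ->
  g_sigma_preimage rV_coord (\bigcup_i (F i)).
Proof. exact: sigma_algebra_bigcup. Qed.

HB.instance Definition _ := @isMeasurable.Build (measure_rV_display d)
  'rV[T]_n (g_sigma_preimage rV_coord) rV_set0 rV_setC rV_bigcup.

End measurable_rV.

Section measurable_rV_lemmas.
Context d1 d2 (T1 : measurableType d1) (T2 : measurableType d2).

Lemma measurable_rV_coord n (i : 'I_n) :
  measurable_fun [set: 'rV[T2]_n] (rV_coord i).
Proof.
move=> _ Y mY; rewrite setTI; apply: sub_sigma_algebra => /=.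
rewrite -bigcup_seq/=; exists i => /=; first by rewrite mem_index_enum.
by exists Y => //; rewrite setTI.
Qed.

Lemma measurable_fun_rVP n (f : T1 -> 'rV[T2]_n) :
  measurable_fun [set: T1] f <->
  forall i, measurable_fun [set: T1] (fun x => f x ord0 i).
Proof.
split=> [mf i|mf].
  exact: (measurableT_comp (measurable_rV_coord i) mf).
move=> _ A mA; rewrite setTI.
have : g_sigma_preimage (fun i => rV_coord i \o f) (f @^-1` A).
  by rewrite g_sigma_preimage_comp; exists A => //; rewrite setTI.
suff : g_sigma_preimage (fun i => rV_coord i \o f) `<=` measurable by exact.
apply: smallest_sub; first exact: sigma_algebra_measurable.
rewrite -bigcup_seq => B [i _ [C mC <-]].
exact: mf.
Qed.

End measurable_rV_lemmas.

Lemma product_sigma_finite d1 d2 (T1 : measurableType d1)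
    (T2 : measurableType d2) (R : realType)
    (m1 : {sigma_finite_measure set T1 -> \bar R})
    (m2 : {sigma_finite_measure set T2 -> \bar R}) :
  sigma_finite setT (m1 \x m2)%E.
Proof.
have /sigma_finiteP[F [TF ndF Foo]] := sigma_finiteT m1.
have /sigma_finiteP[G [TG ndG Goo]] := sigma_finiteT m2.
exists (fun n => F n `*` G n).
  rewrite -setXTT TF TG predeqE => -[x y]; split.
    move=> [/= [n _ Fnx] [k _ Gky]]; exists (maxn n k) => //; split.
    - by move: x Fnx; exact/subsetPset/ndF/leq_maxl.
    - by move: y Gky; exact/subsetPset/ndG/leq_maxr.
  by move=> [n _ []/= ? ?]; split; exists n.
move=> k; have [? ?] := Foo k; have [? ?] := Goo k.
split; first exact: measurableX.
by rewrite product_measure1E// lte_mul_pinfty// ge0_fin_numE.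
Qed.

Lemma pushforward_sigma_finite d1 d2 (T1 : measurableType d1)
    (T2 : measurableType d2) (R : realType)
    (m : {measure set T1 -> \bar R}) (f : T1 -> T2) (g : T2 -> T1) :
    sigma_finite setT m -> measurable_fun setT f -> measurable_fun setT g -> cancel f g ->
  exists nu : {sigma_finite_measure set T2 -> \bar R},
    (nu : set T2 -> \bar R) = pushforward m f.
Proof.
move=> [F FT mF] mf mg fK; set nu := pushforward m f.
have mfI A : measurable A -> measurable (f @^-1` A).
  by move=> mA; rewrite -[X in measurable X]setTI; exact: mf.
have m0 : nu set0 = 0%E by rewrite /nu /pushforward preimage_set0 measure0.
have mge0 A : (0 <= nu A)%E by exact: measure_ge0.
have madd : semi_sigma_additive nu.
  move=> G mG tG mUG; rewrite /nu /pushforward preimage_bigcup.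
  apply: measure_semi_sigma_additive => [k||]; first exact: mfI.
    apply/trivIsetP => /= i j _ _ ij; rewrite -preimage_setI.
    by move/trivIsetP : tG => /(_ _ _ _ _ ij) ->//; rewrite preimage_set0.
  by rewrite -preimage_bigcup; exact: mfI.
have msf : sigma_finite setT nu.
  exists (fun k => g @^-1` F k); first by rewrite -preimage_bigcup -FT.
  move=> k; have [mFk Fkoo] := mF k; split.
    by rewrite -[X in measurable X]setTI; exact: mg.
  rewrite /nu /pushforward -comp_preimage (_ : g \o f = id) ?preimage_id//.
  exact/funext/fK.
clearbody nu.
pose isM := isMeasure.Build _ _ _ nu m0 mge0 madd.
pose nuM : {measure set T2 -> \bar R} := HB.pack nu isM.
pose isS := Measure_isSigmaFinite.Build _ _ _ nuM msf.
pose nuS : {sigma_finite_measure set T2 -> \bar R} := HB.pack nu isM isS.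
by exists nuS.
Qed.

Section lebesgue_rV.
Context {R : realType}.

Definition cons_rV n (p : R * 'rV[R]_n) : 'rV[R]_n.+1 := row_mx (p.1)%:M p.2.

(* Lebesgue measure on R^n as an iterated product; see [lebesgue_rV_box]. *)
Fixpoint lebesgue_rV n : set 'rV[R]_n -> \bar R :=
  match n with
  | 0 => dirac (0 : 'rV[R]_0)
  | m.+1 => pushforward (lebesgue_measure \x @lebesgue_rV m)%E (@cons_rV m)
  end.
Arguments lebesgue_rV n : clear implicits.

Lemma measurable_cons_rV n : measurable_fun setT (@cons_rV n).
Proof.
apply/measurable_fun_rVP => i; rewrite /cons_rV.
case: (splitP (i : 'I_(1 + n))) => [j ij|j ij].
  rewrite (_ : (fun _ => _) = fst); first exact: measurable_fst.
  apply/funext => p /=; rewrite (_ : i = lshift n j); last exact/val_inj.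
  by rewrite (row_mxEl (p.1)%:M) !ord1 mxE eqxx.
rewrite (_ : (fun _ => _) = rV_coord j \o snd).
  exact: (measurableT_comp (measurable_rV_coord j) measurable_snd).
apply/funext => p /=; rewrite (_ : i = rshift 1 j); last exact/val_inj.
by rewrite (row_mxEr (p.1)%:M).
Qed.

Lemma measurable_behead_rV n :
  measurable_fun setT (fun x : 'rV[R]_n.+1 => rsubmx (x : 'rV_(1 + n))).
Proof.
apply/measurable_fun_rVP => i.
rewrite (_ : (fun _ => _) = rV_coord (rshift 1 i)).
  exact: measurable_rV_coord.
by apply/funext => x; rewrite /= mxE.
Qed.

Lemma lebesgue_rV_sigma_finite n :
  exists mu : {sigma_finite_measure set 'rV[R]_n -> \bar R},
    (mu : set 'rV[R]_n -> \bar R) = lebesgue_rV n.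
Proof.
elim: n => [|n [mu muE]] /=; first by exists (dirac (0 : 'rV[R]_0)).
rewrite -muE.
pose uncons (x : 'rV[R]_n.+1) := (rV_coord ord0 x, rsubmx (x : 'rV_(1 + n))).
apply: (@pushforward_sigma_finite _ _ _ _ R
  [the {measure set _ -> \bar R} of (lebesgue_measure \x mu)%E] _ uncons).
- exact: product_sigma_finite.
- exact: measurable_cons_rV.
- apply: measurable_fun_pair; last exact: measurable_behead_rV.
  by move=> mT Y mY; exact: (measurable_rV_coord _ mT mY).
- move=> [t x]; rewrite /uncons /cons_rV /= row_mxKr; congr pair.
  rewrite /rV_coord (_ : ord0 = lshift n (ord0 : 'I_1)); last exact/val_inj.
  by rewrite (row_mxEl t%:M) mxE eqxx.
Qed.

Let lebesgue_rV0 n : lebesgue_rV n set0 = 0%E.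
Proof. by have [mu <-] := lebesgue_rV_sigma_finite n; rewrite measure0. Qed.

Let lebesgue_rV_ge0 n A : (0 <= lebesgue_rV n A)%E.
Proof. by have [mu <-] := lebesgue_rV_sigma_finite n; exact: measure_ge0. Qed.

Let lebesgue_rV_semi_sigma_additive n : semi_sigma_additive (lebesgue_rV n).
Proof.
have [mu <-] := lebesgue_rV_sigma_finite n.
exact: measure_semi_sigma_additive.
Qed.

HB.instance Definition _ n := isMeasure.Build _ _ _ (lebesgue_rV n)
  (@lebesgue_rV0 n) (@lebesgue_rV_ge0 n) (@lebesgue_rV_semi_sigma_additive n).

Let sigma_finite_lebesgue_rV n : sigma_finite setT (lebesgue_rV n).
Proof.
have [mu <-] := lebesgue_rV_sigma_finite n.
exact: (sigma_finiteT mu).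
Qed.

HB.instance Definition _ n := Measure_isSigmaFinite.Build _ _ _
  (lebesgue_rV n) (@sigma_finite_lebesgue_rV n).

Lemma measurable_box n (A : 'I_n -> set R) : (forall i, measurable (A i)) ->
  measurable [set x : 'rV[R]_n | forall i, A i (x ord0 i)].
Proof.
move=> mA.
rewrite (_ : mkset _ = \big[setI/setT]_(i < n) (rV_coord i @^-1` A i)).
  apply: bigsetI_measurable => i _; rewrite -[X in measurable X]setTI.
  exact: measurable_rV_coord.
rewrite -bigcap_seq; apply/seteqP; split=> x /= Ax i; first by move=> _; exact: Ax.
by apply: Ax; rewrite /= mem_index_enum.
Qed.

Lemma lebesgue_rV_box n (A : 'I_n -> set R) : (forall i, measurable (A i)) ->
  lebesgue_rV n [set x : 'rV[R]_n | forall i, A i (x ord0 i)] =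
  (\prod_(i < n) lebesgue_measure (A i))%E.
Proof.
elim: n A => [A _|n IHn A mA].
  by rewrite big_ord0 /= diracE mem_set//= => -[].
rewrite big_ord_recl -IHn//.
have mA' := measurable_box (fun i => mA (lift ord0 i)).
have <- := @product_measure1E _ _ _ _ R lebesgue_measure (lebesgue_rV n)
  _ _ (mA ord0) mA'.
rewrite /= /pushforward; congr (_ _).
have c0 (p : R * 'rV[R]_n) : cons_rV p ord0 ord0 = p.1.
  rewrite /cons_rV (_ : ord0 = lshift n (ord0 : 'I_1)); last exact/val_inj.
  by rewrite (row_mxEl (p.1)%:M) mxE eqxx.
have cl (p : R * 'rV[R]_n) i : cons_rV p ord0 (lift ord0 i) = p.2 ord0 i.
  rewrite /cons_rV (_ : lift ord0 i = rshift 1 i); last exact/val_inj.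
  by rewrite (row_mxEr (p.1)%:M).
apply/seteqP; split=> p /=.
  by move=> Ap; split=> [|i]; [rewrite -c0|rewrite -cl]; exact: Ap.
move=> [A0 A1] i; case: (unliftP ord0 i) => [j ->|->].
  by rewrite cl; exact: A1.
by rewrite c0.
Qed.

End lebesgue_rV.
Arguments lebesgue_rV {R} n.

Section schwartz.
Context {R : realType}.

Definition partial n (i : 'I_n) (f : 'rV[R]_n -> R) : 'rV[R]_n -> R :=
  fun x => 'D_(delta_mx ord0 i) f x.

Definition iter_partial n (s : seq 'I_n) (f : 'rV[R]_n -> R) : 'rV[R]_n -> R :=
  foldr (@partial n) f s.

Definition smooth n (f : 'rV[R]_n -> R) : Prop :=
  forall s : seq 'I_n, continuous (iter_partial s f) /\
    forall i x, derivable (iter_partial s f) x (delta_mx ord0 i).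

Definition compactly_supported n (f : 'rV[R]_n -> R) : Prop :=
  compact (closure [set x | f x != 0]).

Definition monomial n (a : {ffun 'I_n -> nat}) (x : 'rV[R]_n) : R :=
  \prod_(i < n) x ord0 i ^+ a i.

Definition schwartz_real n (f : 'rV[R]_n -> R) : Prop :=
  smooth f /\
  forall (a : {ffun 'I_n -> nat}) (s : seq 'I_n), exists M : R,
    forall x, `|monomial a x * iter_partial s f x| <= M.

(* A complex-valued function is smooth (resp. rapidly decreasing) iff its real
   and imaginary parts are. *)
Definition schwartz n (f : 'rV[R]_n -> R[i]) : Prop :=
  schwartz_real (fun x => complex.Re (f x)) /\
  schwartz_real (fun x => complex.Im (f x)).

Definition expi (t : R) : R[i] := Complex (cos t) (sin t).

Definition inner n (x y : 'rV[R]_n) : R := \sum_(i < n) x ord0 i * y ord0 i.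

Definition integral_rV n (f : 'rV[R]_n -> R[i]) : R[i] :=
  Complex (\int[lebesgue_rV n]_x complex.Re (f x))
          (\int[lebesgue_rV n]_x complex.Im (f x)).

Definition Lp_norm n (p : \bar R) (f : 'rV[R]_n -> R[i]) : \bar R :=
  Lnorm (lebesgue_rV n) p (fun y => (normc (f y))%:E).

End schwartz.

(* phi_j = monomial (a j) where a lists each multi-index of weight 2 exactly
   once; the order of the list is immaterial. *)
Definition enumerates_degree2 n l (a : 'I_l -> {ffun 'I_n -> nat}) : Prop :=
  injective a /\
  forall m : {ffun 'I_n -> nat},
    (\sum_(i < n) m i = 2)%N <-> exists j, a j = m.

Section restriction.
Context {R : realType}.
Variables (n l : nat) (a : 'I_l -> {ffun 'I_n -> nat}).

Definition surface : set 'rV[R]_(n + l) :=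
  [set eta : 'rV[R]_(n + l) | forall j : 'I_l,
     eta ord0 (rshift n j) = monomial (a j) (lsubmx eta)].

Definition graph_map (x : 'rV[R]_n) : 'rV[R]_(n + l) :=
  row_mx x (\row_j monomial (a j) x).

Lemma graph_surface x : graph_map x \in surface.
Proof. by rewrite inE => j; rewrite row_mxEr mxE row_mxKl. Qed.

Definition chart (x : 'rV[R]_n) : surface := SigSub (graph_surface x).

(* The Fourier integral of f with kernel exp(-i<y, eta>), for eta on S. *)
Definition restriction (f : 'rV[R]_(n + l) -> R[i]) (eta : surface) : R[i] :=
  integral_rV (fun y => expi (- inner y (val eta)) * f y).

(* The norm of L^2(S, dsigma), dsigma being psi(x) dx in the coordinates
   [chart] on S. *)
Definition surface_L2_norm (psi : 'rV[R]_n -> R) (g : surface -> R[i]) : \bar R :=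
  ((\int[lebesgue_rV n]_x (normc (g (chart x)) ^+ 2 * psi x)%:E) `^ 2^-1)%E.

Definition smooth_density (psi : 'rV[R]_n -> R) : Prop :=
  [/\ smooth psi, compactly_supported psi & forall x, 0 <= psi x].

Definition restriction_bound (psi : 'rV[R]_n -> R) (p : \bar R) : Prop :=
  exists C : R, forall f : 'rV[R]_(n + l) -> R[i], schwartz f ->
    (surface_L2_norm psi (restriction f) <= C%:E * Lp_norm p f)%E.

Definition restriction_estimate (p : \bar R) : Prop :=
  forall psi, smooth_density psi -> restriction_bound psi p.

Definition sharp_exponent (p0 : \bar R) : Prop :=
  forall psi, smooth_density psi ->
  (\forall x \near (0 : 'rV[R]_n), 0 < psi x) ->
  forall p : \bar R, (1 <= p)%E -> restriction_bound psi p -> (p <= p0)%E.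

End restriction.

(* Main.v *)
(* Let q = 2(n+2) be the exponent dual to p0 and let E g be the Fourier
   transform of g(x) dx carried by S.  Then (E g)^(n+2) is the extension of the
   tensor power of g, a function of the n x (n+2) matrices X, with a phase
   linear in the entries of X X^T and in the row sums of X.  By Wishart's
   computation the pair (X X^T, row sums) pushes Lebesgue measure forward to
   one of bounded density: rotating a row to a coordinate axis costs the power
   |row|^-(number of remaining rows), which polar coordinates compensate
   exactly.  So Plancherel gives |E g|_q <= C |g|_2, whence the estimate by
   duality.  Sharpness follows by testing it on Gaussians adapted to the
   delta x delta^2 caps of S at the origin and letting delta tend to 0. *)

Require Import Defs.
From HB Require Import structures.
From mathcomp Require Import all_boot all_order all_fingroup all_algebra complex.
From mathcomp Require Import all_classical all_reals all_analysis measurable_realfun.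
From mathcomp Require Import ring lra zify.

Set Implicit Arguments.
Unset Strict Implicit.
Unset Printing Implicit Defensive.

Import Order.TTheory GRing.Theory Num.Theory.
Import numFieldNormedType.Exports.
Import ComplexField.Normc.

Local Open Scope classical_set_scope.
Local Open Scope ring_scope.

Implicit Types (R : realType) (d : measure_display).

(** * Lebesgue measure on row vectors *)

(** Neither the pushforward density nor Fourier inversion is ever formed. Boundedness of the density
    is expressed by duality: the integral of a product of one-variable weights in the entries is at
    most a constant, uniformly over nonnegative weights of bounded L^1 norm. Plancherel becomes a
    Schur test: |E g|^2 is integrated against compactly supported windows whose Fourier transforms
    are dominated by such weights, with an L^1 bound that does not depend on the size of the window,
    so the window can grow to the whole space. The number n + 2 of factors is forced. For n rows and
    m columns the density of X X^T is proportional to det^((m - n - 1)/2), which is bounded exactly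
    for m = n + 1; prescribing the row sums fixes the component of each row along (1,...,1) and so
    uses up one further column. That all monomials of degree 2 occur matters because the entries of
    X X^T on and above the diagonal are then exactly the last l coordinates of S, summed over the
    factors. *)

Lemma eqW (disp : Order.disp_t) (T : porderType disp) (x y : T) : x = y -> (x <= y)%O.
Proof. by move=> ->. Qed.

Definition box R N (A : 'I_N -> set R) : set 'rV[R]_N :=
  [set x | forall i, A i (x ord0 i)].

Definition boxes R N : set (set 'rV[R]_N) :=
  [set B | exists2 A : 'I_N -> set R, (forall i, measurable (A i)) & B = box A].

Lemma measurable_boxes R N :
  @measurable _ 'rV[R]_N = <<s @boxes R N >>.
Proof.
apply/seteqP; split; last first.
  apply: smallest_sub; first exact: sigma_algebra_measurable.
  by move=> _ [A mA ->]; exact: measurable_box.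
apply: smallest_sub; first exact: smallest_sigma_algebra.
rewrite -bigcup_seq => B [i _ [C mC <-]]; apply: sub_sigma_algebra.
exists (fun j => if j == i then C else setT).
  by move=> j; case: ifP.
rewrite setTI; apply/seteqP; split=> x /=.
  by move=> Cx j; case: eqP => // ->.
by move/(_ i); rewrite eqxx.
Qed.

Lemma lebesgue_rV_boxE R N (A : 'I_N -> set R) :
  (forall i, measurable (A i)) ->
  lebesgue_rV N (box A) = (\prod_(i < N) lebesgue_measure (A i))%E.
Proof. exact: lebesgue_rV_box. Qed.

Lemma rV_bounded R N (y : 'rV[R]_N) :
  exists m : nat, forall i, `|y ord0 i| <= m%:R.
Proof.
exists (\max_i Num.bound `|y ord0 i|) => i.
apply: (@le_trans _ _ (Num.bound `|y ord0 i|)%:R).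
  by apply: ltW; apply: archi_boundP.
by rewrite ler_nat; exact: (leq_bigmax_cond (F := fun i => Num.bound `|y ord0 i|)).
Qed.

(** Boxes are stable under intersection and generate the sigma-algebra, and the cubes of half-side k
    exhaust the space with finite measure. Reindexings, translations and matrix splittings are shown
    to preserve [lebesgue_rV] through this check on boxes. *)
Lemma lebesgue_rV_unique R N (mu : {measure set 'rV[R]_N -> \bar R}) :
  (forall A : 'I_N -> set R, (forall i, measurable (A i)) ->
    mu (box A) = (\prod_(i < N) lebesgue_measure (A i))%E) ->
  forall B, measurable B -> mu B = lebesgue_rV N B.
Proof.
move=> muE B mB; apply/esym.
apply: (@measure_unique _ R _ (@boxes R N) (fun k => box (fun=> `[- k%:R, k%:R]%classic))
  _ _ _ _ [the measure _ _ of lebesgue_rV N] mu) => //.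
- exact: measurable_boxes.
- move=> _ _ [A mA ->] [A' mA' ->]; exists (fun i => A i `&` A' i).
    by move=> i; exact: measurableI.
  apply/seteqP; split=> x /=; first by move=> [a b] i; split.
  by move=> h; split=> i; have [] := h i.
- by move=> k; exists (fun=> `[- k%:R, k%:R]%classic).
- apply/seteqP; split=> // x _.
  have [k xk] := rV_bounded x.
  by exists k => // i; rewrite /= in_itv/= -ler_norml; exact: xk.
- by move=> _ [A mA ->]; rewrite muE//; exact: lebesgue_rV_boxE.
- move=> k; rewrite [X in (X < _)%E]lebesgue_rV_boxE//.
  under eq_bigr do rewrite lebesgue_measure_itv/=.
  elim: (index_enum _) => [|i s IH]; first by rewrite big_nil ltry.
  rewrite big_cons; apply: lte_mul_pinfty => //.
  - by case: ifP => // /ltW; rewrite lee_fin -EFinB lee_fin subr_ge0.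
  - by case: ifP => // _; rewrite -EFinB.
Qed.

(** * Measure-preserving maps *)

Section preserves.
Context (R : realType) (d1 d2 : measure_display)
    (T1 : measurableType d1) (T2 : measurableType d2).

Definition preserves (m1 : set T1 -> \bar R) (m2 : set T2 -> \bar R) (f : T1 -> T2) : Prop :=
  measurable_fun setT f /\ forall A, measurable A -> m1 (f @^-1` A) = m2 A.

Lemma preserves_measurable (m1 : set T1 -> \bar R) (m2 : set T2 -> \bar R) (f : T1 -> T2) (A : set T2) :
  preserves m1 m2 f -> measurable A -> measurable (f @^-1` A).
Proof. by move=> [mf _] mA; rewrite -[X in measurable X]setTI; exact: mf. Qed.

Context (m1 : {measure set T1 -> \bar R}) (m2 : {measure set T2 -> \bar R}).

Lemma preserves_ge0_integral (f : T1 -> T2) (F : T2 -> \bar R) :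
  preserves m1 m2 f -> measurable_fun setT F -> (forall x, 0 <= F x)%E ->
  (\int[m1]_x F (f x) = \int[m2]_y F y)%E.
Proof.
move=> [mf fE] mF F0.
rewrite -[LHS]/(\int[m1]_x (F \o f) x)%E -(preimage_setT f).
rewrite -ge0_integral_pushforward//.
by apply: eq_measure_integral => A mA _; exact: fE.
Qed.

Lemma preserves_integrable (f : T1 -> T2) (F : T2 -> \bar R) :
  preserves m1 m2 f -> measurable_fun setT F ->
  m1.-integrable setT (F \o f) <-> m2.-integrable setT F.
Proof.
move=> pf mF; have mf := pf.1.
have E : (\int[m1]_x `|(F \o f) x| = \int[m2]_x `|F x|)%E.
  apply: (preserves_ge0_integral pf (F := fun x => `|F x|%E)) => //.
  exact: measurableT_comp.
split=> /integrableP[_ h]; apply/integrableP; split=> //.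
- by rewrite -E.
- exact: measurableT_comp.
- by rewrite E.
Qed.

Lemma preserves_integral (f : T1 -> T2) (F : T2 -> \bar R) :
  preserves m1 m2 f -> m2.-integrable setT F ->
  (\int[m1]_x F (f x) = \int[m2]_y F y)%E.
Proof.
move=> pf iF; have mf := pf.1; have mF := measurable_int _ iF.
have iFf : m1.-integrable setT (F \o f) by apply/(preserves_integrable pf mF).
rewrite -[LHS]/(\int[m1]_x (F \o f) x)%E -(preimage_setT f).
rewrite -integral_pushforward//.
  by apply: eq_measure_integral => A mA _; exact: pf.2.
Qed.

End preserves.

Lemma preserves_rVP R d (T : measurableType d)
    (m : {measure set T -> \bar R}) N (f : T -> 'rV[R]_N) :
  (forall i, measurable_fun setT (fun x => f x ord0 i)) ->
  (forall A : 'I_N -> set R, (forall i, measurable (A i)) ->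
    m (f @^-1` box A) = (\prod_(i < N) lebesgue_measure (A i))%E) ->
  preserves m (lebesgue_rV N) f.
Proof.
move=> mfi h; have mf : measurable_fun setT f by apply/measurable_fun_rVP.
split=> // A mA.
have <- := @lebesgue_rV_unique R N
  (measure_function_pushforward__canonical__measure_function_Measure m mf) h A mA.
by [].
Qed.

Lemma preserves_reindex R M N (s : 'I_M -> 'I_N) : bijective s ->
  preserves (@lebesgue_rV R N) (lebesgue_rV M) (fun x => \row_j x ord0 (s j)).
Proof.
move=> [s' sK s'K]; apply: preserves_rVP => [i|A mA].
  under eq_fun do rewrite mxE; exact: measurable_rV_coord.
rewrite (_ : _ @^-1` _ = box (fun i => A (s' i))).
  etransitivity; first exact: (lebesgue_rV_boxE (A := fun i => A (s' i))).
  rewrite (reindex s); last by exists s' => ? _.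
  by apply: eq_bigr => i _; rewrite sK.
apply/seteqP; split=> x /= h i; last first.
  by have := h (s i); rewrite mxE sK.
by have := h (s' i); rewrite mxE s'K.
Qed.

Lemma preserves_cons R n :
  preserves (lebesgue_measure \x @lebesgue_rV R n)%E (lebesgue_rV n.+1) (@cons_rV R n).
Proof. by split=> //; exact: measurable_cons_rV. Qed.

Lemma preserves_prod R d1 d2 d3 d4 (T1 : measurableType d1) (T2 : measurableType d2)
    (T3 : measurableType d3) (T4 : measurableType d4) (m1 : {sigma_finite_measure set T1 -> \bar R})
    (m2 : {sigma_finite_measure set T2 -> \bar R}) (m3 : {sigma_finite_measure set T3 -> \bar R})
    (m4 : {sigma_finite_measure set T4 -> \bar R}) (f : T1 -> T3) (g : T2 -> T4) :
  preserves m1 m3 f -> preserves m2 m4 g ->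
  preserves (m1 \x m2)%E (m3 \x m4)%E (fun p => (f p.1, g p.2)).
Proof.
move=> [mf fE] [mg gE].
have mfg : measurable_fun [set: T1 * T2] (fun p => (f p.1, g p.2)).
  by apply: measurable_fun_pair; exact: measurableT_comp.
split=> // A mA.
have -> := @product_measure_unique _ _ _ _ R m3 m4
  (measure_function_pushforward__canonical__measure_function_Measure (m1 \x m2)%E mfg) _ A mA.
  by [].
move=> B C mB mC; rewrite /= /pushforward.
rewrite (_ : _ @^-1` _ = (f @^-1` B) `*` (g @^-1` C))//.
have mB' : measurable (f @^-1` B) by rewrite -[X in measurable X]setTI; exact: mf.
have mC' : measurable (g @^-1` C) by rewrite -[X in measurable X]setTI; exact: mg.
transitivity (m1 (f @^-1` B) * m2 (g @^-1` C))%E; first exact: product_measure1E.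
by rewrite fE// gE.
Qed.

Lemma preserves_lebesgueP R d (T : measurableType d) (m : {measure set T -> \bar R}) (f : T -> R) :
  measurable_fun setT f ->
  (forall x y : R, m (f @^-1` `]x, y]) = lebesgue_measure (`]x, y]%classic : set R)) ->
  preserves m (@lebesgue_measure R) f.
Proof.
move=> mf h; split=> // A mA; apply/esym.
have h' (X : set (measurableTypeR R)) : ocitv X ->
    lebesgue_measure X = pushforward m (f : T -> measurableTypeR R) X.
  by move=> [[x y] _ <-]; rewrite /pushforward h.
exact: (@lebesgue_measure_unique R
  (measure_function_pushforward__canonical__measure_function_Measure
    m (mf : measurable_fun setT (f : T -> measurableTypeR R))) h' A mA).
Qed.

Lemma preserves_translation R (b : R) :
  preserves (@lebesgue_measure R) (@lebesgue_measure R) (fun x => x + b).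
Proof.
have mf : measurable_fun setT (fun x : R => x + b) by exact: measurable_funD.
apply: preserves_lebesgueP => // x y.
rewrite (_ : _ @^-1` _ = `]x - b, y - b]%classic); last first.
  by apply/seteqP; split=> z /=; rewrite !in_itv/= ltrBlDr lerBrDr.
rewrite -[LHS]/(lebesgue_measure _) !lebesgue_measure_itv/= !lte_fin ltrD2r.
by case: ifP => // _; rewrite -!EFinD; congr EFin; ring.
Qed.

Lemma ge0_integral_translation R (b : R) (F : R -> \bar R) :
  measurable_fun [set: R] F -> (forall x, 0 <= F x)%E ->
  (\int[lebesgue_measure]_x F (x + b)%R = \int[lebesgue_measure]_x F x)%E.
Proof.
move=> mF F0.
exact: (@preserves_ge0_integral R _ _ (measurableTypeR R) (measurableTypeR R)
  lebesgue_measure lebesgue_measure _ F (preserves_translation b)).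
Qed.

Lemma ge0_integral_scale R (a : R) (F : R -> \bar R) : a != 0 ->
  measurable_fun [set: R] F -> (forall x, 0 <= F x)%E ->
  (`|a|%:E * \int[lebesgue_measure]_x F (a * x)%R =
   \int[lebesgue_measure]_x F x)%E.
Proof.
move=> a0 mF F0.
have a0' : 0 <= `|a| by [].
have mf : measurable_fun setT (fun x : R => a * x) by exact: measurable_funM.
(* The dilation preserves Lebesgue measure once the source measure is multiplied by |a|, so the
   formula is checked on half-open intervals, whose end points swap when a is negative. *)
have pf : preserves (mscale (NngNum a0') (@lebesgue_measure R)) (@lebesgue_measure R) (fun x => a * x).
  apply: preserves_lebesgueP => // x y.
  rewrite /mscale/=.
  have [ap|an|a00] := ltgtP 0 a; last by rewrite -a00 eqxx in a0.
    rewrite (_ : _ @^-1` _ = `]x / a, y / a]%classic); last first.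
      by apply/seteqP; split=> z /=; rewrite !in_itv/= ltr_pdivrMr// ler_pdivlMr// ![a * _]mulrC.
    rewrite -[LHS]/(`|a|%:E * lebesgue_measure _)%E !lebesgue_measure_itv/= !lte_fin ltr_pM2r ?invr_gt0//.
    case: ifP => [_|]; last by rewrite mule0.
    by rewrite -!EFinD -EFinM gtr0_norm//; congr EFin; field.
  rewrite (_ : _ @^-1` _ = `[y / a, x / a[%classic); last first.
    by apply/seteqP; split=> z /=; rewrite !in_itv/= ltr_ndivlMr// ler_ndivrMr// ![a * _]mulrC andbC.
  rewrite -[LHS]/(`|a|%:E * lebesgue_measure _)%E !lebesgue_measure_itv/= !lte_fin ltr_nM2r ?invr_lt0//.
  case: ifP => [_|]; last by rewrite mule0.
  by rewrite -!EFinD -EFinM ltr0_norm//; congr EFin; field.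
rewrite -[RHS](preserves_ge0_integral pf)//.
rewrite [RHS](@ge0_integral_mscale _ _ R lebesgue_measure setT measurableT (NngNum a0') (fun x => F (a * x)))//.
exact: (measurableT_comp mF mf).
Qed.

Lemma preserves_translation_rV R N (b : 'rV[R]_N) :
  preserves (@lebesgue_rV R N) (lebesgue_rV N) (fun x => x + b).
Proof.
apply: preserves_rVP => [i|A mA].
  under eq_fun do rewrite mxE.
  by apply: measurable_funD => //; exact: measurable_rV_coord.
rewrite (_ : _ @^-1` _ = box (fun i => (fun t => t + b ord0 i) @^-1` A i)).
  have mA' i : measurable ((fun t => t + b ord0 i) @^-1` A i).
    exact: preserves_measurable (preserves_translation _) (mA i).
  etransitivity; first exact: (lebesgue_rV_boxE mA').
  by apply: eq_bigr => i _; exact: (preserves_translation _).2 (mA i).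
by apply/seteqP; split=> x /= h i; have := h i; rewrite mxE.
Qed.

(** * Tonelli in one coordinate and linear changes of variables *)

Lemma cons_rV0 R n (p : R * 'rV[R]_n) : cons_rV p ord0 ord0 = p.1.
Proof.
rewrite /cons_rV (_ : ord0 = lshift n (ord0 : 'I_1)); last exact/val_inj.
by rewrite (row_mxEl (p.1)%:M) mxE eqxx.
Qed.

Lemma cons_rVS R n (p : R * 'rV[R]_n) i :
  cons_rV p ord0 (lift ord0 i) = p.2 ord0 i.
Proof.
rewrite /cons_rV (_ : lift ord0 i = rshift 1 i); last exact/val_inj.
by rewrite (row_mxEr (p.1)%:M).
Qed.

Lemma measurable_mulmx R N M (A : 'M[R]_(N, M)) :
  measurable_fun setT (fun x : 'rV[R]_N => x *m A).
Proof.
apply/measurable_fun_rVP => i; under eq_fun do rewrite mxE.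
apply: measurable_sum => j; apply: measurable_funM => //.
exact: measurable_rV_coord.
Qed.

Lemma ge0_integral_cons R n (F : 'rV[R]_n.+1 -> \bar R) :
  measurable_fun [set: 'rV[R]_n.+1] F -> (forall x, 0 <= F x)%E ->
  (\int[lebesgue_rV n.+1]_x F x =
   \int[lebesgue_measure]_t \int[lebesgue_rV n]_x F (cons_rV (t, x)))%E.
Proof.
move=> mF F0; rewrite -(preserves_ge0_integral (preserves_cons R n))//.
apply: (@fubini_tonelli1 _ _ (measurableTypeR R) _ R lebesgue_measure (lebesgue_rV n) (fun p => F (cons_rV p))) => //.
exact: (measurableT_comp mF (@measurable_cons_rV R n)).
Qed.

Lemma ge0_integral_consC R n (F : 'rV[R]_n.+1 -> \bar R) :
  measurable_fun [set: 'rV[R]_n.+1] F -> (forall x, 0 <= F x)%E ->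
  (\int[lebesgue_rV n.+1]_x F x =
   \int[lebesgue_rV n]_x \int[lebesgue_measure]_t F (cons_rV (t, x)))%E.
Proof.
move=> mF F0; rewrite -(preserves_ge0_integral (preserves_cons R n))//.
apply: (@fubini_tonelli2 _ _ (measurableTypeR R) _ R lebesgue_measure (lebesgue_rV n) (fun p => F (cons_rV p))) => //.
exact: (measurableT_comp mF (@measurable_cons_rV R n)).
Qed.

Lemma measurable_integral1 R d1 d2 (T1 : measurableType d1) (T2 : measurableType d2)
    (m2 : {sigma_finite_measure set T2 -> \bar R}) (F : T1 * T2 -> \bar R) :
  measurable_fun [set: T1 * T2] F -> (forall x, 0 <= F x)%E ->
  measurable_fun [set: T1] (fun x => \int[m2]_y F (x, y))%E.
Proof. by move=> mF F0; exact: (measurable_fun_fubini_tonelli_F F mF F0). Qed.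

Lemma measurable_integral2 R d1 d2 (T1 : measurableType d1) (T2 : measurableType d2)
    (m1 : {sigma_finite_measure set T1 -> \bar R}) (F : T1 * T2 -> \bar R) :
  measurable_fun [set: T1 * T2] F -> (forall x, 0 <= F x)%E ->
  measurable_fun [set: T2] (fun y => \int[m1]_x F (x, y))%E.
Proof. by move=> mF F0; exact: (measurable_fun_fubini_tonelli_G F mF F0). Qed.

(** The determinant stays on the left, so that composing two changes is multiplicativity of the
    determinant and nothing is divided in the extended reals. *)
Definition linear_change R N (A : 'M[R]_N) : Prop :=
  forall F : 'rV[R]_N -> \bar R,
  measurable_fun [set: 'rV[R]_N] F -> (forall x, 0 <= F x)%E ->
  (`|\det A|%:E * \int[lebesgue_rV N]_x F (x *m A) =
   \int[lebesgue_rV N]_x F x)%E.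

Lemma linear_changeM R N (A B : 'M[R]_N) :
  linear_change A -> linear_change B -> linear_change (A *m B).
Proof.
move=> hA hB F mF F0; rewrite det_mulmx normrM EFinM -(hB F)//.
rewrite [(`|\det A|%:E * _)%E]muleC -muleA; congr (_ * _)%E.
under eq_integral do rewrite mulmxA.
rewrite (hA (fun x => F (x *m B)))//.
exact: (measurableT_comp mF (measurable_mulmx B)).
Qed.

Lemma linear_change_perm R N (s : 'S_N) :
  linear_change (perm_mx s : 'M[R]_N).
Proof.
move=> F mF F0; rewrite det_perm normrX normrN1 expr1n mul1e.
have bs : bijective (s^-1)%g by exists s => i; rewrite ?permKV ?permK.
rewrite -[RHS](preserves_ge0_integral (preserves_reindex R bs))//.
apply: eq_integral => x _; congr F; apply/rowP => i.
by rewrite -{1}[s]invgK -col_permE !mxE.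
Qed.

Lemma cons_rV_block R n (t : R) (x : 'rV[R]_n) (a : R) (r : 'rV[R]_n) (c : 'cV[R]_n) (D : 'M[R]_n) :
  cons_rV (t, x) *m block_mx a%:M r c D =
  cons_rV (t * a + (x *m c) ord0 ord0, t *: r + x *m D).
Proof.
rewrite /cons_rV /= (mul_row_block t%:M x) -scalar_mxM mul_scalar_mx; congr row_mx.
by apply/matrixP => i j; rewrite !ord1 !mxE eqxx.
Qed.

Lemma measurable_cons_comp R n (F : 'rV[R]_n.+1 -> \bar R) :
  measurable_fun [set: 'rV[R]_n.+1] F ->
  measurable_fun [set: R * 'rV[R]_n] (fun p => F (cons_rV p)).
Proof. by move=> mF; exact: (measurableT_comp mF (@measurable_cons_rV R n)). Qed.

Lemma measurable_cons_comp1 R n (F : 'rV[R]_n.+1 -> \bar R) t :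
  measurable_fun [set: 'rV[R]_n.+1] F ->
  measurable_fun [set: 'rV[R]_n] (fun x => F (cons_rV (t, x))).
Proof.
move=> mF; apply: (measurableT_comp (measurable_cons_comp mF)).
exact: measurable_pair1.
Qed.

Lemma measurable_cons_comp2 R n (F : 'rV[R]_n.+1 -> \bar R) x :
  measurable_fun [set: 'rV[R]_n.+1] F ->
  measurable_fun [set: R] (fun t => F (cons_rV (t, x))).
Proof.
move=> mF; apply: (measurableT_comp (measurable_cons_comp mF)).
exact: measurable_pair2.
Qed.

(** The vector (t, x) goes to (t a, t r + x D). For fixed t the inner integral absorbs D and then
    the translation by t r, and only a scaling in t is left. *)
Lemma linear_change_ublock R n (a : R) (r : 'rV[R]_n) (D : 'M[R]_n) :
  a != 0 -> linear_change D -> linear_change (block_mx a%:M r 0 D : 'M[R]_(1 + n)).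
Proof.
move=> a0 hD F mF F0; rewrite det_ublock det_scalar expr1 normrM EFinM.
rewrite (ge0_integral_cons (F := fun x => F (x *m _))) //; last first.
  exact: (measurableT_comp mF (measurable_mulmx _)).
rewrite -muleA -ge0_integralZl//; last 2 first.
- apply: (@measurable_integral1 R _ _ (measurableTypeR R) _ (lebesgue_rV n) (fun p => F (cons_rV p *m _))) => //.
  apply: (measurable_cons_comp (F := fun x => F (x *m _))).
  exact: (measurableT_comp mF (measurable_mulmx _)).
- by move=> x _; exact: integral_ge0.
pose H (t : R) : \bar R := (\int[lebesgue_rV n]_x F (cons_rV (t, x)))%E.
under eq_integral => t _.
  under eq_integral do rewrite cons_rV_block mulmx0 mxE addr0 [X in cons_rV (_, X)]addrC.
  rewrite (hD (fun x => F (cons_rV (t * a, x + t *: r)))) //; last first.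
    apply: (measurableT_comp (measurable_cons_comp1 (t * a) mF)).
    exact: (preserves_translation_rV _).1.
  rewrite (preserves_ge0_integral (preserves_translation_rV (t *: r))
    (F := fun x => F (cons_rV (t * a, x)))) //; last exact: measurable_cons_comp1.
  rewrite mulrC -/(H (a * t)); over.
rewrite (ge0_integral_scale (F := H))// ?ge0_integral_cons//.
- by apply: (@measurable_integral1 R _ _ (measurableTypeR R) _ (lebesgue_rV n) (fun p => F (cons_rV p))) => //; exact: measurable_cons_comp.
- by move=> t; exact: integral_ge0.
Qed.

(** Here (t, x) goes to (t a + x c, x D), so t is integrated first with x fixed, which makes x c a
    harmless translation. *)
Lemma linear_change_lblock R n (a : R) (c : 'cV[R]_n) (D : 'M[R]_n) :
  a != 0 -> linear_change D -> linear_change (block_mx a%:M 0 c D : 'M[R]_(1 + n)).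
Proof.
move=> a0 hD F mF F0; rewrite det_lblock det_scalar expr1 normrM EFinM.
rewrite (ge0_integral_consC (F := fun x => F (x *m _))) //; last first.
  exact: (measurableT_comp mF (measurable_mulmx _)).
rewrite [(`|a|%:E * _)%E]muleC -muleA -ge0_integralZl//; last 2 first.
- apply: (@measurable_integral2 R _ _ (measurableTypeR R) _ lebesgue_measure (fun p => F (cons_rV p *m _))) => //.
  apply: (measurable_cons_comp (F := fun x => F (x *m _))).
  exact: (measurableT_comp mF (measurable_mulmx _)).
- by move=> x _; exact: integral_ge0.
pose H x : \bar R := (\int[lebesgue_measure]_t F (cons_rV (t, x)))%E.
under eq_integral => x _.
  under eq_integral do rewrite cons_rV_block scaler0 add0r mulrC.
  rewrite (ge0_integral_scale (F := fun t => F (cons_rV (t + (x *m c) ord0 ord0, x *m D)))) //; last first.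
    apply: (measurableT_comp (measurable_cons_comp2 (x *m D) mF)).
    exact: (preserves_translation _).1.
  rewrite (ge0_integral_translation ((x *m c) ord0 ord0)
    (F := fun t => F (cons_rV (t, x *m D)))) //; last exact: measurable_cons_comp2.
  rewrite -/(H (x *m D)); over.
rewrite (hD H)// ?ge0_integral_consC//.
- by apply: (@measurable_integral2 R _ _ (measurableTypeR R) _ lebesgue_measure (fun p => F (cons_rV p))) => //; exact: measurable_cons_comp.
- by move=> t; exact: integral_ge0.
Qed.

Lemma linear_change_trig0 R (A : 'M[R]_0) : linear_change A.
Proof.
move=> F mF F0; rewrite det_mx00 normr1 mul1e.
by apply: eq_integral => x _; congr F; apply/rowP => -[].
Qed.

Lemma linear_change_upper R n (A : 'M[R]_n) :
  (forall i, A i i != 0) -> (forall i j : 'I_n, (j < i)%N -> A i j = 0) ->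
  linear_change A.
Proof.
elim: n A => [A _ _|n IHn A dA uA]; first exact: linear_change_trig0.
have -> : A = block_mx (A ord0 ord0)%:M (ursubmx (A : 'M[R]_(1 + n)))
    0 (drsubmx (A : 'M[R]_(1 + n))) :> 'M[R]_(1 + n).
  rewrite -[LHS](@submxK _ 1 n 1 n); congr block_mx.
    by apply/matrixP => i j; rewrite !ord1 !mxE eqxx; congr (A _ _); exact/val_inj.
  by apply/matrixP => i j; rewrite !mxE uA//= !ord1.
apply: linear_change_ublock => //; apply: IHn => [i|i j ji]; rewrite !mxE//.
by rewrite uA//= ltnS.
Qed.

Lemma linear_change_lower R n (A : 'M[R]_n) :
  (forall i, A i i != 0) -> (forall i j : 'I_n, (i < j)%N -> A i j = 0) ->
  linear_change A.
Proof.
elim: n A => [A _ _|n IHn A dA uA]; first exact: linear_change_trig0.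
have -> : A = block_mx (A ord0 ord0)%:M 0
    (dlsubmx (A : 'M[R]_(1 + n))) (drsubmx (A : 'M[R]_(1 + n))) :> 'M[R]_(1 + n).
  rewrite -[LHS](@submxK _ 1 n 1 n); congr block_mx.
    by apply/matrixP => i j; rewrite !ord1 !mxE eqxx; congr (A _ _); exact/val_inj.
  by apply/matrixP => i j; rewrite !mxE uA//= !ord1.
apply: linear_change_lblock => //; apply: IHn => [i|i j ji]; rewrite !mxE//.
by rewrite uA//= ltnS.
Qed.

(** LUP factorization reduces to a permutation, a unit lower triangular and an upper triangular
    factor. The last one has a nonzero diagonal because its determinant divides that of A. *)
Lemma linear_change_det R n (A : 'M[R]_n) :
  \det A != 0 -> linear_change A.
Proof.
case: n A => [A _|n A dA]; first exact: linear_change_trig0.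
have := cormen_lup_correct A; have := cormen_lup_perm A.
have := @cormen_lup_lower _ _ A; have := @cormen_lup_upper _ _ A.
case: cormen_lup => -[P L] U /= hU hL /is_perm_mxP[s ->] E.
have AE : A = perm_mx (s^-1)%g *m (L *m U).
  have := congr1 (mulmx (perm_mx (s^-1)%g)) (E : _ *m _ = _).
  by rewrite mulmxA -[X in X *m _ = _]perm_mxM mulVg perm_mx1 mul1mx.
rewrite AE; apply: linear_changeM; first exact: linear_change_perm.
apply: linear_changeM.
  apply: linear_change_lower => [i|i j ij]; rewrite hL// ?eqxx ?oner_eq0//.
    by case: eqP => // ijE; rewrite ijE ltnn in ij.
  exact: ltnW.
apply: linear_change_upper => // i.
have : \det U != 0.
  by move: dA; rewrite AE !det_mulmx !mulf_eq0 !negb_or => /and3P[].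
rewrite -det_tr det_trig.
  by move/prodf_neq0 => /(_ i isT); rewrite mxE.
by apply/is_trig_mxP => k l kl; rewrite mxE hU.
Qed.

Lemma preserves_orthogonal R N (O : 'M[R]_N) : O *m O^T = 1%:M ->
  preserves (@lebesgue_rV R N) (lebesgue_rV N) (fun x => x *m O).
Proof.
move=> OO; have dO : `|\det O| = 1.
  apply/eqP; rewrite -sqrp_eq1// -normrX ger0_norm ?sqr_ge0// expr2.
  by have := congr1 determinant OO; rewrite det_mulmx det_tr det1 => ->.
have cO : linear_change O.
  by apply: linear_change_det; rewrite -normr_eq0 dO oner_eq0.
split; first exact: measurable_mulmx.
move=> A mA.
have mI : measurable_fun [set: 'rV[R]_N] (fun x => (\1_A x : R)%:E).
  by apply/measurable_EFinP; exact: measurable_indic.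
have E : (\int[lebesgue_rV N]_x (\1_A (x *m O))%:E =
    \int[lebesgue_rV N]_x (\1_A x)%:E)%E.
  by rewrite -[LHS]mul1e -dO; apply: cO => // x; rewrite lee_fin.
have mA' : measurable ((fun x => x *m O) @^-1` A).
  by rewrite -[X in measurable X]setTI; exact: measurable_mulmx.
transitivity (\int[lebesgue_rV N]_x (\1_A (x *m O))%:E)%E; last first.
  by rewrite E integral_indic// setIT.
rewrite -[LHS]/(lebesgue_rV N _) -[in LHS](setIT (_ @^-1` _)).
by rewrite -integral_indic.
Qed.

(** The Householder reflection along v = u - |u| e, or the identity when v = 0. *)
Lemma exists_rotation R n (u : 'rV[R]_n.+1) :
  exists2 O : 'M[R]_n.+1, O *m O^T = 1%:M &
    u *m O = Num.sqrt (inner u u) *: delta_mx ord0 ord0.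
Proof.
set r := Num.sqrt _; set e : 'rV[R]_n.+1 := delta_mx ord0 ord0.
have innE (x y : 'rV[R]_n.+1) : x *m y^T = (inner x y)%:M.
  apply/matrixP => i j; rewrite !ord1 !mxE eqxx mulr1n /inner.
  by apply: eq_bigr => k _; rewrite !mxE.
have inn0 (x : 'rV[R]_n.+1) : inner x x = 0 -> x = 0.
  move=> /eqP; rewrite psumr_eq0 => [|i _]; last by rewrite -expr2 sqr_ge0.
  move=> /allP h; apply/rowP => i; rewrite mxE; apply/eqP.
  by have := h i (mem_index_enum _); rewrite mulf_eq0 orbb.
have r2 : r * r = inner u u.
  rewrite -expr2 sqr_sqrtr// sumr_ge0// => i _; rewrite -expr2; exact: sqr_ge0.
have ie x : inner x e = x ord0 ord0.
  rewrite /inner (bigD1 ord0)//= mxE !eqxx mulr1 big1 ?addr0// => i i0.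
  by rewrite mxE (negbTE i0) andbF mulr0.
pose v := u - r *: e.
have [v0|v0] := eqVneq v 0.
  exists 1%:M; first by rewrite trmx1 mulmx1.
  by rewrite mulmx1; apply/eqP; rewrite -subr_eq0 -/v v0.
have innB (x y z : 'rV[R]_n.+1) : inner x (y - z) = inner x y - inner x z.
  by rewrite /inner -sumrB; apply: eq_bigr => i _; rewrite !mxE mulrBr.
have innC (x y : 'rV[R]_n.+1) : inner x y = inner y x.
  by apply: eq_bigr => i _; rewrite mulrC.
have innZ (x y : 'rV[R]_n.+1) c : inner x (c *: y) = c * inner x y.
  by rewrite /inner mulr_sumr; apply: eq_bigr => i _; rewrite !mxE mulrCA.
(* Since u and r e have the same length, |v|^2 = 2 <u, v>; this makes the reflection subtract
   exactly v from u. *)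
have vv : inner v v = 2 * inner u v.
  have ve : inner v e = u ord0 ord0 - r by rewrite ie !mxE !eqxx mulr1.
  have vu : inner v u = r * r - r * u ord0 ord0 by rewrite innC innB innZ ie r2.
  by rewrite {2}/v innB innZ ve vu innC vu; ring.
have vv0 : inner v v != 0 by apply: contra_neq v0; exact: inn0.
exists (1%:M - (2 / inner v v) *: (v^T *m v)).
  have T : (1%:M - (2 / inner v v) *: (v^T *m v))^T =
      1%:M - (2 / inner v v) *: (v^T *m v).
    apply/matrixP => i j; rewrite !mxE eq_sym; congr (_ - _ * _).
    by apply: eq_bigr => k _; rewrite !mxE mulrC.
  rewrite {}T.
  rewrite mulmxBr mulmx1 mulmxBl mul1mx -!scalemxAl -!scalemxAr.
  rewrite -mulmxA [v *m (_ *m _)]mulmxA innE mul_scalar_mx -!scalemxAr !scalerA.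
  rewrite -addrA -opprD -scalerBl -[X in _ - X]scalerDl.
  rewrite (_ : 2 / inner v v + _ = 0) ?scale0r ?subr0//.
  by field.
rewrite mulmxBr mulmx1 -scalemxAr mulmxA innE mul_scalar_mx scalerA vv.
have uv0 : inner u v != 0 by move: vv0; rewrite vv mulf_eq0 negb_or => /andP[].
rewrite (_ : _ * _ = 1); last by field.
by rewrite scale1r /v opprB addrC subrK.
Qed.

(** * Lebesgue measure on matrices *)

Lemma big_mxvec (T : Type) (idx : T) (op : Monoid.com_law idx) n m (F : 'I_(n * m) -> T) :
  \big[op/idx]_(k < n * m) F k =
  \big[op/idx]_(i < n) \big[op/idx]_(j < m) F (mxvec_index i j).
Proof.
rewrite (reindex (uncurry (@mxvec_index n m))) /=; last exact: curry_mxvec_bij.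
by rewrite pair_bigA/=; apply: eq_bigr => -[].
Qed.

Lemma preserves_mxvecP R d (T : measurableType d)
    (mu : {measure set T -> \bar R}) n m (M : T -> 'M[R]_(n, m)) :
  (forall i j, measurable_fun setT (fun x => M x i j)) ->
  (forall A : 'I_n -> 'I_m -> set R, (forall i j, measurable (A i j)) ->
    mu [set x | forall i j, A i j (M x i j)] =
    (\prod_(i < n) \prod_(j < m) lebesgue_measure (A i j))%E) ->
  preserves mu (lebesgue_rV (n * m)) (fun x => mxvec (M x)).
Proof.
move=> mM h; apply: preserves_rVP => [k|A mA].
  by case/mxvec_indexP: k => i j; under eq_fun do rewrite mxvecE; exact: mM.
rewrite big_mxvec -h//; congr (mu _); apply/seteqP; split=> x /= Ax.
  by move=> i j; have := Ax (mxvec_index i j); rewrite mxvecE.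
by move=> k; case/mxvec_indexP: k => i j; rewrite mxvecE.
Qed.

Lemma measurable_vec_mx R n m (i : 'I_n) (j : 'I_m) :
  measurable_fun setT (fun x : 'rV[R]_(n * m) => vec_mx x i j).
Proof. by under eq_fun do rewrite mxE; exact: measurable_rV_coord. Qed.

Lemma col_mx_ord0 (R : Type) n m (a : 'rV[R]_m) (B : 'M[R]_(n, m)) (j : 'I_m) :
  (col_mx a B : 'M[R]_(n.+1, m)) ord0 j = a ord0 j.
Proof.
rewrite (_ : ord0 = lshift n (ord0 : 'I_1)); last exact/val_inj.
by rewrite (col_mxEu a).
Qed.

Lemma col_mx_lift (R : Type) n m (a : 'rV[R]_m) (B : 'M[R]_(n, m)) i j :
  (col_mx a B : 'M[R]_(n.+1, m)) (lift ord0 i) j = B i j.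
Proof.
rewrite (_ : lift ord0 i = rshift 1 i); last exact/val_inj.
by rewrite (col_mxEd a).
Qed.

Lemma row_mx_ord0 (R : Type) n m (a : 'cV[R]_n) (B : 'M[R]_(n, m)) i :
  (row_mx a B : 'M[R]_(n, m.+1)) i ord0 = a i ord0.
Proof.
rewrite (_ : ord0 = lshift m (ord0 : 'I_1)); last exact/val_inj.
by rewrite (row_mxEl a).
Qed.

Lemma row_mx_lift (R : Type) n m (a : 'cV[R]_n) (B : 'M[R]_(n, m)) i j :
  (row_mx a B : 'M[R]_(n, m.+1)) i (lift ord0 j) = B i j.
Proof.
rewrite (_ : lift ord0 j = rshift 1 j); last exact/val_inj.
by rewrite (row_mxEr a).
Qed.

(** Matrices are carried as row vectors through [mxvec], so that Lebesgue measure on them is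
    [lebesgue_rV (n * m)]. The map glues a first row onto the others; it goes from the product to
    the matrices so that integrals over matrices pull back to Tonelli's theorem. *)
Definition row_split (R : Type) n m (p : 'rV[R]_m * 'rV[R]_(n * m)) :
  'rV[R]_(n.+1 * m) := mxvec (col_mx p.1 (vec_mx p.2) : 'M[R]_(1 + n, m)).

Definition col_split (R : Type) n m (p : 'rV[R]_n * 'rV[R]_(n * m)) :
  'rV[R]_(n * m.+1) := mxvec (row_mx p.1^T (vec_mx p.2) : 'M[R]_(n, 1 + m)).

Lemma preserves_row_split R n m :
  preserves (@lebesgue_rV R m \x @lebesgue_rV R (n * m))%E
    (lebesgue_rV (n.+1 * m)) (@row_split R n m).
Proof.
apply: (@preserves_mxvecP _ _ _ _ n.+1 m
  (fun p => col_mx p.1 (vec_mx p.2) : 'M[R]_(1 + n, m))) => [i j|A mA].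
  case: (unliftP ord0 i) => [k|] ->{i}.
    under eq_fun do rewrite col_mx_lift.
    exact: (measurableT_comp (measurable_vec_mx k j) measurable_snd).
  under eq_fun do rewrite col_mx_ord0.
  exact: (measurableT_comp (measurable_rV_coord j) measurable_fst).
(* [B] decodes a flat index into its pair (i, j), turning the family over pairs into a box of row
   vectors. *)
pose B (k : 'I_(n * m)) :=
  let ij := (enum_val (cast_ord (esym (mxvec_cast n m)) k)) in A (lift ord0 ij.1) ij.2.
have BE i j : B (mxvec_index i j) = A (lift ord0 i) j.
  by rewrite /B /mxvec_index cast_ordK enum_rankK.
rewrite (_ : [set x | _] = box (A ord0) `*` box B).
  rewrite -[LHS]/((_ \x _)%E _) product_measure1E; last 2 first.
  - exact: measurable_box.
  - by apply: measurable_box => k; case/mxvec_indexP: k => i j; rewrite BE.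
  rewrite -[X in (X * _)%E]/(lebesgue_rV m _) -[X in (_ * X)%E]/(lebesgue_rV (n * m) _).
  rewrite !lebesgue_rV_boxE//; last by move=> k; case/mxvec_indexP: k => i j; rewrite BE.
  rewrite big_ord_recl big_mxvec; congr (_ * _)%E.
  by apply: eq_bigr => i _; apply: eq_bigr => j _; rewrite BE.
apply/seteqP; split=> -[x y] /=.
  move=> h; split=> [j|k].
    by have := h ord0 j; rewrite col_mx_ord0.
  case/mxvec_indexP: k => i j; rewrite BE.
  by have := h (lift ord0 i) j; rewrite col_mx_lift mxE.
move=> [hx hy] i j; case: (unliftP ord0 i) => [k|] ->{i}.
  by rewrite col_mx_lift mxE -BE; exact: hy.
by rewrite col_mx_ord0; exact: hx.
Qed.

Lemma preserves_col_split R n m :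
  preserves (@lebesgue_rV R n \x @lebesgue_rV R (n * m))%E
    (lebesgue_rV (n * m.+1)) (@col_split R n m).
Proof.
apply: (@preserves_mxvecP _ _ _ _ n m.+1
  (fun p => row_mx p.1^T (vec_mx p.2) : 'M[R]_(n, 1 + m))) => [i j|A mA].
  case: (unliftP ord0 j) => [k|] ->{j}.
    under eq_fun do rewrite row_mx_lift.
    exact: (measurableT_comp (measurable_vec_mx i k) measurable_snd).
  under eq_fun do rewrite row_mx_ord0 mxE.
  exact: (measurableT_comp (measurable_rV_coord i) measurable_fst).
pose B (k : 'I_(n * m)) :=
  let ij := (enum_val (cast_ord (esym (mxvec_cast n m)) k)) in A ij.1 (lift ord0 ij.2).
have BE i j : B (mxvec_index i j) = A i (lift ord0 j).
  by rewrite /B /mxvec_index cast_ordK enum_rankK.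
rewrite (_ : [set x | _] = box (fun i => A i ord0) `*` box B).
  rewrite -[LHS]/((_ \x _)%E _) product_measure1E; last 2 first.
  - exact: (measurable_box (A := fun i => A i ord0)).
  - by apply: measurable_box => k; case/mxvec_indexP: k => i j; rewrite BE.
  rewrite -[X in (X * _)%E]/(lebesgue_rV n _) -[X in (_ * X)%E]/(lebesgue_rV (n * m) _).
  rewrite !lebesgue_rV_boxE//; last by move=> k; case/mxvec_indexP: k => i j; rewrite BE.
  rewrite big_mxvec -big_split; apply: eq_bigr => i _; rewrite big_ord_recl.
  by congr (_ * _)%E; apply: eq_bigr => j _; rewrite BE.
apply/seteqP; split=> -[x y] /=.
  move=> h; split=> [i|k].
    by have := h i ord0; rewrite row_mx_ord0 mxE.
  case/mxvec_indexP: k => i j; rewrite BE.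
  by have := h i (lift ord0 j); rewrite row_mx_lift mxE.
move=> [hx hy] i j; case: (unliftP ord0 j) => [k|] ->{j}.
  by rewrite row_mx_lift mxE -BE; exact: hy.
by rewrite row_mx_ord0 mxE; exact: hx.
Qed.

Lemma preserves_trmx R n m :
  preserves (@lebesgue_rV R (n * m)) (lebesgue_rV (m * n)) (fun x => mxvec (vec_mx x)^T).
Proof.
apply: (@preserves_mxvecP _ _ _ _ m n (fun x => (vec_mx x)^T)) => [i j|A mA].
  by under eq_fun do rewrite mxE; exact: measurable_vec_mx.
pose B (k : 'I_(n * m)) :=
  let ij := (enum_val (cast_ord (esym (mxvec_cast n m)) k)) in A ij.2 ij.1.
have BE i j : B (mxvec_index i j) = A j i.
  by rewrite /B /mxvec_index cast_ordK enum_rankK.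
rewrite (_ : [set x | _] = box B).
  rewrite -[LHS]/(lebesgue_rV (n * m) _) lebesgue_rV_boxE; last first.
    by move=> k; case/mxvec_indexP: k => i j; rewrite BE.
  rewrite big_mxvec exchange_big; apply: eq_bigr => i _.
  by apply: eq_bigr => j _; rewrite BE.
apply/seteqP; split=> x /=.
  move=> h k; case/mxvec_indexP: k => i j; rewrite BE.
  by have := h j i; rewrite !mxE.
by move=> h i j; have := h (mxvec_index j i); rewrite BE !mxE.
Qed.

Lemma preserves_conj R d1 d2 (T1 : measurableType d1) (T2 : measurableType d2)
    (m1 : set T1 -> \bar R) (m2 : set T2 -> \bar R) (s : T1 -> T2) (g : T1 -> T1) (f : T2 -> T2) :
  preserves m1 m2 s -> preserves m1 m1 g -> measurable_fun setT f ->
  f \o s = s \o g -> preserves m2 m2 f.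
Proof.
move=> ps pg mf fs; split=> // A mA.
have mfA : measurable (f @^-1` A) by rewrite -[X in measurable X]setTI; exact: mf.
rewrite -ps.2// -comp_preimage fs comp_preimage pg.2 ?ps.2//.
exact: preserves_measurable ps mA.
Qed.

Lemma measurable_mul_rows R n m (O : 'M[R]_m) :
  measurable_fun setT (fun x : 'rV[R]_(n * m) => mxvec (vec_mx x *m O)).
Proof.
apply/measurable_fun_rVP => k; case/mxvec_indexP: k => i j.
under eq_fun do rewrite mxvecE mxE.
apply: measurable_sum => k; apply: measurable_funM => //.
exact: measurable_vec_mx.
Qed.

(** The splitting conjugates the action on n + 1 rows to the product of a rotation of the first row
    and the action on the others. *)
Lemma preserves_mul_rows R n m (O : 'M[R]_m) : O *m O^T = 1%:M ->
  preserves (@lebesgue_rV R (n * m)) (lebesgue_rV (n * m)) (fun x => mxvec (vec_mx x *m O)).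
Proof.
move=> OO; elim: n => [|n IHn].
  rewrite (_ : (fun x => _) = id)//.
  by apply/funext => x; apply/rowP => -[].
apply: (preserves_conj (@preserves_row_split R n m)
    (preserves_prod (preserves_orthogonal OO) IHn)).
  exact: measurable_mul_rows.
apply/funext => -[x y]; rewrite /row_split /= !mxvecK.
by rewrite (mul_col_mx x).
Qed.

(** * Polar coordinates *)

Lemma measurable_lt_set R d (T : measurableType d)
  (f g : T -> R) : measurable_fun [set: T] f -> measurable_fun [set: T] g ->
  measurable [set x | f x < g x].
Proof.
move=> mf mg; have := measurable_fun_ltr mf mg.
by move=> /(_ measurableT [set true]); rewrite setTI; apply.
Qed.

Lemma measurable_invr R : measurable_fun [set: R] (fun x : R => x^-1).
Proof.
have o : open [set x : R | x != 0].
  rewrite (_ : [set x | _] = ~` [set 0]); last first.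
    by apply/seteqP; split=> x /=; [move/eqP|move=> ?; exact/eqP].
  by apply: closed_openC; exact: closed_eq.
rewrite -(setvU [set x : R | x != 0]).
apply/measurable_funU.
- exact: measurableC (open_measurable o).
- exact: open_measurable o.
split; last first.
  by apply: open_continuous_measurable_fun => // x; rewrite inE /= => x0; exact: inv_continuous.
rewrite (_ : ~` _ = [set 0]); first exact: measurable_fun_set1.
by apply/seteqP; split=> x /=; [move/negP/negPn/eqP|move=> ->; rewrite eqxx].
Qed.

Lemma measurable_sqrt R : measurable_fun [set: R] (@Num.sqrt R).
Proof. by apply: continuous_measurable_fun => x; exact: sqrt_continuous. Qed.

(** The signed square t |t| replaces t^2 because it is an increasing bijection of the line, so the
    substitution needs no splitting into branches. *)
Lemma is_derive_signed_square R (t : R) :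
  is_derive t 1 (fun t : R => t * `|t|) (2 * `|t|).
Proof.
have H : h^-1 *: (((h *: 1 + t) * `|h *: 1 + t|) - t * `|t|) @[h --> (0:R)^'] --> 2 * `|t|.
  apply/cvgrPdist_le => e e0; near=> h.
  have h0 : h != 0 by near: h; exact: nbhs_dnbhs_neq.
  have he : `|h| <= e.
    near: h; exact: dnbhs0_le.
  have h0' : 0 < `|h| by rewrite normr_gt0.
  rewrite -(ler_pM2l h0') -normrM mulrBr [h%:A]mulr1 mulVKf//.
  (* The increment of t |t| differs from 2 |t| h by at most h^2, whatever the signs of t and t +
     h. *)
  apply: (@le_trans _ _ (`|h| * `|h|)); last by rewrite ler_pM2l.
  case: (lerP 0 t) => t0; case: (lerP 0 (h + t)) => ht0; case: (lerP 0 h) => hh0;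
  rewrite ?(ger0_norm t0) ?(ltr0_norm t0) ?(ger0_norm ht0) ?(ltr0_norm ht0)
     ?(ger0_norm hh0) ?(ltr0_norm hh0) ler_norml; apply/andP; split; nra.
by split; [apply/cvg_ex; eexists; exact: H|exact/cvg_lim].
Unshelve. all: by end_near. Qed.

Lemma integral_double_norm R (a b : R) : a < b ->
  (\int[lebesgue_measure]_(t in `]a, b]) (2 * `|t|)%:E = (b * `|b| - a * `|a|)%:E)%E.
Proof.
move=> ab.
have cn : continuous (fun t : R => 2 * `|t|).
  move=> x; apply: cvgM; first exact: cvg_cst.
  exact: (@norm_continuous _ R).
rewrite integral_itv_obnd_cbnd; last first.
  apply/measurable_EFinP; apply: measurable_funTS; exact: continuous_measurable_fun.
have D (x : R) := is_derive_signed_square x.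
have cF : continuous (fun t : R => t * `|t|).
  by move=> x; apply/differentiable_continuous/derivable1_diffP; case: (D x).
rewrite (@continuous_FTC2 R (fun t => 2 * `|t|) (fun t => t * `|t|))//.
- exact: continuous_subspaceT.
- split.
  + by move=> x _; case: (D x).
  + by apply: cvg_at_right_filter; exact: cF.
  + by apply: cvg_at_left_filter; exact: cF.
- by move=> x _; rewrite derive1E; case: (D x).
Qed.

Definition signed_sqrt R (x : R) := Num.sg x * Num.sqrt `|x|.

Lemma signed_sqrtK R (x : R) :
  signed_sqrt x * `|signed_sqrt x| = x.
Proof.
rewrite /signed_sqrt normrM (ger0_norm (sqrtr_ge0 _)) mulrACA -expr2 sqr_sqrtr//.
have [->|x0] := eqVneq x 0; first by rewrite normr0 mulr0.
by rewrite normr_sg x0 mulr1 -numEsg.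
Qed.

Lemma signed_square_mono R :
  {mono (fun t : R => t * `|t|) : x y / x < y}.
Proof.
apply: leW_mono; apply: le_mono => x y.
case: (lerP 0 x) => x0; case: (lerP 0 y) => y0 xy.
- by rewrite !ger0_norm//; nra.
- by nra.
- by rewrite (ltr0_norm x0) (ger0_norm y0); nra.
- by rewrite !ltr0_norm//; nra.
Qed.

(** The measure 2 |t| dt is realized as planar measure on the region 0 < u < 2 |t|. The map (t, u)
    -> t |t| from this region to the line then preserves Lebesgue measure, and on intervals this is
    the fundamental theorem of calculus. *)
Lemma ge0_integral_signed_square R (F : R -> \bar R) :
  measurable_fun [set: R] F -> (forall x, 0 <= F x)%E ->
  (\int[lebesgue_measure]_t (F (t * `|t|)%R * (2 * `|t|)%:E) =
   \int[lebesgue_measure]_s F s)%E.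
Proof.
move=> mF F0.
pose D := [set p : R * R | 0 < p.2] `&` [set p : R * R | p.2 < 2 * `|p.1|].
have mh : measurable_fun [set: R * R] (fun p : R * R => 2 * `|p.1|).
  apply: measurable_funM => //; apply: measurableT_comp => //.
have mD : measurable D.
  by apply: measurableI; apply: measurable_lt_set.
have mphi : measurable_fun [set: R * R] (fun p : R * R => p.1 * `|p.1|).
  by apply: measurable_funM => //; exact: measurableT_comp.
pose L2 := (@lebesgue_measure R \x @lebesgue_measure R)%E.
(* Integrating out u over its fibre of length 2 |t| produces the density. *)
have L2E (H : R -> \bar R) : measurable_fun [set: R] H -> (forall x, 0 <= H x)%E ->
  (\int[L2]_(p in D) H p.1 = \int[lebesgue_measure]_t (H t * (2 * `|t|)%:E))%E.
  move=> mH H0.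
  rewrite integral_mkcond.
  rewrite (@fubini_tonelli1 _ _ (measurableTypeR R) (measurableTypeR R) R lebesgue_measure lebesgue_measure)//; last 2 first.
  - apply/(measurable_restrictT _ _).1 => //.
    by apply: measurable_funTS; exact: (measurableT_comp mH measurable_fst).
  - by apply: erestrict_ge0.
  apply: eq_integral => t _; rewrite /fubini_F.
  transitivity (\int[lebesgue_measure]_(u in `]0%R, (2 * `|t|)%R[) (cst (H t) u))%E.
    rewrite [RHS]integral_mkcond; apply: eq_integral => u _.
    rewrite /patch /D/=; congr (if _ then _ else _).
    by apply/idP/idP; rewrite !inE/= in_itv/= => /andP.
  rewrite integral_cst//= lebesgue_measure_itv/= lte_fin.
  case: ifP => [_|]; first by rewrite sube0.
  by move/negbT; rewrite -leNgt => ht; rewrite (_ : 2 * `|t| = 0)//; apply/eqP; rewrite eq_le ht mulr_ge0.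
have pphi : preserves (mrestr L2 mD) (@lebesgue_measure R) (fun p : R * R => p.1 * `|p.1|).
  apply: preserves_lebesgueP => // x y.
  rewrite -[LHS]/(L2 (_ `&` D)).
  have [xy|yx] := ltP x y; last first.
    by rewrite set_itv_ge ?preimage_set0 ?set0I ?measure0// bnd_simp -leNgt.
  set a := signed_sqrt x; set b := signed_sqrt y.
  have ab : a < b.
    by rewrite -signed_square_mono !signed_sqrtK.
  transitivity (\int[L2]_(p in D) (\1_(`]a, b]%classic : set R) p.1 : R)%:E)%E.
    have mab : measurable ([set p : R * R | `]a, b]%classic p.1]).
      have := @measurable_fst _ _ (measurableTypeR R) (measurableTypeR R).
      move=> /(_ measurableT `]a, b]%classic); rewrite setTI; apply.
      exact: measurable_itv.
    have mxy : measurable ((fun p : R * R => p.1 * `|p.1|) @^-1` `]x, y]).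
      by rewrite -[X in measurable X]setTI; apply: mphi.
    transitivity (\int[L2]_(p in D)
        (\1_((fun p : R * R => p.1 * `|p.1|) @^-1` `]x, y]) p)%:E)%E.
      by rewrite integral_indic.
      apply: eq_integral => p _; congr EFin.
      rewrite !indicE; congr (_%:R); congr nat_of_bool.
      apply/idP/idP; rewrite !inE /= !in_itv/= => /andP[h1 h2].
        apply/andP; split.
          by rewrite -signed_square_mono signed_sqrtK.
        by rewrite leNgt -signed_square_mono signed_sqrtK -leNgt.
      apply/andP; split; move: h1 h2.
        by rewrite -(signed_square_mono a) signed_sqrtK.
      by rewrite !leNgt -(signed_square_mono b) signed_sqrtK.
  rewrite (L2E (fun t => (\1_(`]a, b]%classic : set R) t : R)%:E))//; last first.
    by apply/measurable_EFinP; exact: measurable_indic.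
  transitivity (\int[lebesgue_measure]_(t in `]a, b]) (2 * `|t|)%:E)%E.
    rewrite [RHS]integral_mkcond; apply: eq_integral => t _.
    by rewrite /patch indicE; case: ifP; rewrite ?mul1e ?mul0e.
  rewrite integral_double_norm// !signed_sqrtK lebesgue_measure_itv/= lte_fin xy.
  by rewrite EFinB.
rewrite -(@preserves_ge0_integral R _ _ _ (measurableTypeR R) _ _ _ F pphi)//.
have mDc : measurable (~` D) by exact: measurableC.
have mFphi : measurable_fun [set: R * R] (fun p : R * R => F (p.1 * `|p.1|)).
  exact: (measurableT_comp mF mphi).
(* The restricted measure lives on the whole plane but gives no mass to the complement of [D]. *)
transitivity (\int[mrestr L2 mD]_(p in setT `\` ~` D) F (p.1 * `|p.1|)%R)%E; last first.
  apply/esym; apply: ge0_negligible_integral => //.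
  have M0 : (@lebesgue_measure R \x @lebesgue_measure R)%E set0 = 0%E by rewrite measure0.
  by rewrite -[RHS]M0 -[LHS]/(L2 (_ `&` D)) setICl.
have mFs : measurable_fun [set: R] (fun t : R => F (t * `|t|)).
  by apply: (measurableT_comp mF); apply: measurable_funM => //; exact: measurableT_comp.
rewrite setTD setCK; transitivity (\int[L2]_(p in D) F (p.1 * `|p.1|)%R)%E.
  by apply/esym; apply: (L2E _ mFs).
apply: eq_measure_integral => A mA AD.
by rewrite -[RHS]/(L2 (_ `&` D)) setIidl.
Qed.

(** Twice the left side is the integral of G(|s| + c) by the signed square. Pointwise this is at
    most G(s + c) + G(-s + c), and both terms have the integral of G. *)
Lemma ge0_integral_square_le R (G : R -> \bar R) (c : R) :
  measurable_fun [set: R] G -> (forall x, 0 <= G x)%E ->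
  (\int[lebesgue_measure]_t (G (t ^+ 2 + c)%R * `|t|%:E) <=
   \int[lebesgue_measure]_s G s)%E.
Proof.
move=> mG G0.
have mabs : measurable_fun [set: R] (fun s : R => `|s| + c).
  by apply: measurable_funD => //; exact: measurableT_comp.
have mopp : measurable_fun [set: R] (fun s : R => -1 * s + c).
  by apply: measurable_funD => //; exact: measurable_funM.
have madd : measurable_fun [set: R] (fun s : R => s + c).
  exact: measurable_funD.
have mn : measurable_fun [set: R] (fun t : R => `|t|%:E).
  by apply/measurable_EFinP; exact: normr_measurable.
have msq : measurable_fun [set: R] (fun s : R => s ^+ 2 + c).
  by apply: measurable_funD => //; exact: measurable_funX.
have := @ge0_integral_signed_square R (fun s => G (`|s| + c)) (measurableT_comp mG mabs) (fun s => G0 _).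
under eq_integral => t _.
  rewrite normrM normr_id -expr2 real_normK ?num_real// EFinM muleCA.
  over.
rewrite ge0_integralZl//=; last 2 first.
- by apply: emeasurable_funM; first exact: (measurableT_comp mG msq).
- by move=> x _; rewrite mule_ge0.
move=> E; rewrite -(@lee_pmul2l _ 2%:E)// E.
apply: (@le_trans _ _ (\int[lebesgue_measure]_s (G (s + c)%R + G (-1 * s + c)%R))%E).
  apply: ge0_le_integral => //.
  - exact: (measurableT_comp mG mabs).
  - apply: emeasurable_funD; [exact: (measurableT_comp mG madd)|exact: (measurableT_comp mG mopp)].
  - move=> s _; case: (lerP 0 s) => s0; rewrite ?mulN1r.
      by rewrite (ger0_norm s0) leeDl.
    by rewrite (ltr0_norm s0) leeDr.
rewrite ge0_integralD//; [|exact: (measurableT_comp mG madd)|exact: (measurableT_comp mG mopp)].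
rewrite ge0_integral_translation//.
have N10 : (-1 : R) != 0 by rewrite oppr_eq0 oner_eq0.
have := @ge0_integral_scale R (-1) (fun s => G (s + c)) N10 (measurableT_comp mG madd) (fun=> G0 _).
rewrite normrN1 mul1e ge0_integral_translation// => ->.
by rewrite mule_natl mule2n.
Qed.

Lemma inner_cons_rV R n (t s : R) (x y : 'rV[R]_n) :
  inner (cons_rV (t, x)) (cons_rV (s, y)) = t * s + inner x y.
Proof.
rewrite /inner big_ord_recl !cons_rV0; congr (_ + _).
by apply: eq_bigr => i _; rewrite !cons_rVS.
Qed.

Lemma inner_ge0 R n (x : 'rV[R]_n) : 0 <= inner x x.
Proof. by apply: sumr_ge0 => i _; rewrite -expr2 sqr_ge0. Qed.

Lemma measurable_inner R d (T : measurableType d)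
    n (f g : T -> 'rV[R]_n) :
  measurable_fun [set: T] f -> measurable_fun [set: T] g ->
  measurable_fun [set: T] (fun x => inner (f x) (g x)).
Proof.
move=> /measurable_fun_rVP mf /measurable_fun_rVP mg.
by apply: measurable_sum => i; exact: measurable_funM.
Qed.

Lemma sqrt_inner_le R n (x : 'rV[R]_n) :
  Num.sqrt (inner x x) <= \sum_(i < n) `|x ord0 i|.
Proof.
have S0 : 0 <= \sum_(i < n) `|x ord0 i| by exact: sumr_ge0.
rewrite -[leRHS]ger0_norm// -sqrtr_sqr ler_sqrt ?sqr_ge0//.
rewrite expr2 mulr_suml; apply: ler_sum => i _.
rewrite -expr2 -real_normK ?num_real// expr2 ler_wpM2l//.
by rewrite (bigD1 i)//= lerDl sumr_ge0.
Qed.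

Lemma measurable_inner_ball R (d : nat) (s : R) :
  measurable [set x : 'rV[R]_d | inner x x <= s].
Proof.
rewrite (_ : [set x | _] = ~` [set x | s < inner x x]).
  apply: measurableC; apply: measurable_lt_set => //.
  exact: measurable_inner.
by apply/seteqP; split=> x /=; rewrite leNgt => /negP.
Qed.

Lemma lebesgue_ball_le R (d : nat) (s : R) :
  (lebesgue_rV d [set x : 'rV[R]_d | (inner x x <= s)%R] <= ((2 * Num.sqrt s) ^+ d)%:E)%E.
Proof.
have mB : measurable (box (fun _ : 'I_d => `[- Num.sqrt s, Num.sqrt s]%classic)).
  exact: (measurable_box (A := fun _ : 'I_d => `[- Num.sqrt s, Num.sqrt s]%classic)).
have mD := @measurable_inner_ball R d s.
apply: (@le_trans _ _ (lebesgue_rV d (box (fun=> `[- Num.sqrt s, Num.sqrt s]%classic)))).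
  apply: le_measure; rewrite ?inE//.
  move=> x /= xs i; rewrite /= in_itv/= -ler_norml.
  rewrite -[leLHS]ger0_norm// -sqrtr_sqr ler_wsqrtr// real_normK ?num_real//.
  apply: le_trans xs; rewrite /inner (bigD1 i)//= -expr2 lerDl.
  by apply: sumr_ge0 => j _; rewrite -expr2 sqr_ge0.
rewrite lebesgue_rV_boxE// (eq_bigr (fun=> (2 * Num.sqrt s)%:E)).
  by rewrite prodEFin prodr_const card_ord.
move=> i _; rewrite lebesgue_measure_itv/= lte_fin; case: ifP => [_|/negbT].
  by rewrite -EFinB; congr EFin; ring.
rewrite -leNgt => h; congr EFin; have := sqrtr_ge0 s.
by move: h; lra.
Qed.

(** Polar coordinates without spheres: in dimension d + 1 the weight |w|^(1-d) times r^d dr is r dr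
    = ds / 2 with s = |w|^2. One factor |w| is bounded by the sum of the |w_i|, a single coordinate
    is treated by symmetry, and s = w_0^2 + |x|^2 replaces w_0. The remaining x ranges over a ball
    of squared radius s. *)
Lemma polar_bound R (d : nat) (k : R -> R) :
  measurable_fun [set: R] k -> (forall x, 0 <= k x) ->
  (\int[lebesgue_rV d.+1]_w
     (k (inner w w) * (Num.sqrt (inner w w) * (Num.sqrt (inner w w))^-1 ^+ d))%:E <=
   (d.+1%:R * 2 ^+ d)%:E * \int[lebesgue_measure]_s (k s)%:E)%E.
Proof.
move=> mk k0.
(* The singular factor s^(-d/2) will be cancelled by the volume bound (2 sqrt s)^d of the ball in
   dimension d. *)
pose H (s : R) : R := k s * (Num.sqrt s)^-1 ^+ d.
have H0 s : 0 <= H s by rewrite mulr_ge0// exprn_ge0// invr_ge0 sqrtr_ge0.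
have msqrt := @measurable_sqrt R.
have mH : measurable_fun [set: R] H.
  apply: measurable_funM => //; apply: measurable_funX.
  exact: (measurableT_comp (@measurable_invr R) msqrt).
have mi n : measurable_fun [set: 'rV[R]_n] (fun x => inner x x) by exact: measurable_inner.
have mHi i : measurable_fun [set: 'rV[R]_d.+1] (fun w => (H (inner w w) * `|w ord0 i|)%:E).
  apply/measurable_EFinP; apply: measurable_funM.
    exact: (measurableT_comp mH (mi _)).
  apply: measurableT_comp => //; exact: measurable_rV_coord.
apply: (@le_trans _ _ (\int[lebesgue_rV d.+1]_w
   \sum_(i < d.+1) (H (inner w w) * `|w ord0 i|)%:E)%E).
  apply: ge0_le_integral => //.
  - by move=> w _; rewrite lee_fin !mulr_ge0// ?sqrtr_ge0// exprn_ge0// invr_ge0 sqrtr_ge0.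
  - apply/measurable_EFinP; apply: measurable_funM; first exact: (measurableT_comp mk (mi _)).
    apply: measurable_funM; first exact: (measurableT_comp msqrt (mi _)).
    apply: measurable_funX; apply: (measurableT_comp (@measurable_invr R)).
    exact: (measurableT_comp msqrt (mi _)).
  - exact: emeasurable_sum.
  - move=> w _; rewrite sumEFin lee_fin -mulr_sumr mulrCA mulrC.
    by apply: ler_wpM2l; [exact: H0|exact: sqrt_inner_le].
rewrite ge0_integral_sum//; last by move=> i w _; rewrite lee_fin mulr_ge0.
rewrite (eq_bigr (fun=> \int[lebesgue_rV d.+1]_w (H (inner w w) * `|w ord0 ord0|)%:E)%E); last first.
  move=> i _.
  have bs : bijective (tperm ord0 i) by exists (tperm ord0 i); exact: tpermK.
  rewrite -[RHS](preserves_ge0_integral (preserves_reindex R bs))//; last first.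
    by move=> x; rewrite lee_fin mulr_ge0.
  apply: eq_integral => x _; rewrite mxE tpermL; congr (H _ * _)%:E.
  rewrite /inner [LHS](reindex_inj (@perm_inj _ (tperm ord0 i))).
  by apply: eq_bigr => j _; rewrite !mxE.
suff B : (\int[lebesgue_rV d.+1]_w (H (inner w w) * `|w ord0 ord0|)%:E <=
    (2 ^+ d)%:E * \int[lebesgue_measure]_s (k s)%:E)%E.
  apply: (@le_trans _ _ (\sum_(i < d.+1)
      (2 ^+ d)%:E * \int[lebesgue_measure]_s (k s)%:E)%E).
    by apply: lee_sum => i _; exact: B.
  rewrite -ge0_sume_distrl; last by move=> i _; rewrite lee_fin exprn_ge0.
  by rewrite sumEFin sumr_const card_ord -[_ *+ d.+1]mulr_natl.
rewrite ge0_integral_consC//; last by move=> x; rewrite lee_fin mulr_ge0.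
(* After the substitution s = t^2 + |x|^2 the variable s is at least |x|^2; [S] records this
   constraint so that the order of integration can be exchanged. *)
pose S := [set p : 'rV[R]_d * R | inner p.1 p.1 <= p.2].
have mS : measurable S.
  rewrite (_ : S = ~` [set p | p.2 < inner p.1 p.1]).
    apply: measurableC; apply: measurable_lt_set; first exact: measurable_snd.
    exact: (measurableT_comp (mi d) measurable_fst).
  by apply/seteqP; split=> x /=; rewrite /S/= leNgt => /negP.
pose K (p : 'rV[R]_d * R) : \bar R := (H p.2 * (\1_S p : R))%:E.
have K0 p : (0 <= K p)%E by rewrite lee_fin mulr_ge0.
have mK : measurable_fun [set: 'rV[R]_d * R] K.
  apply/measurable_EFinP; apply: measurable_funM; last exact: measurable_indic.
  exact: (measurableT_comp mH measurable_snd).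
have mK1 x : measurable_fun [set: R] (fun s => K (x, s)).
  by apply: (measurableT_comp mK); exact: measurable_pair1.
have mK2 s : measurable_fun [set: 'rV[R]_d] (fun x => K (x, s)).
  by apply: (measurableT_comp mK); exact: measurable_pair2.
apply: (@le_trans _ _ (\int[lebesgue_rV d]_x \int[lebesgue_measure]_s K (x, s))%E).
  apply: ge0_le_integral => //.
  - by move=> x _; apply: integral_ge0 => t _; rewrite lee_fin mulr_ge0.
  - apply: (@measurable_integral2 R _ _ (measurableTypeR R) _ lebesgue_measure
      (fun p => (H (inner (cons_rV p) (cons_rV p)) * `|cons_rV p ord0 ord0|)%:E)).
      exact: (measurable_cons_comp (mHi ord0)).
    by move=> p; rewrite lee_fin mulr_ge0.
  - exact: (@measurable_integral1 R _ _ _ (measurableTypeR R) lebesgue_measure K mK K0).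
  - move=> x _; apply: le_trans (ge0_integral_square_le (inner x x) (mK1 x) (fun s => K0 _)).
    apply: eqW; apply: eq_integral => t _.
    rewrite /K inner_cons_rV cons_rV0 /= -expr2 -EFinM indicE mem_set ?mulr1//.
    by rewrite /S/= lerDr sqr_ge0.
rewrite (@fubini_tonelli _ _ _ (measurableTypeR R) R (lebesgue_rV d) lebesgue_measure K mK K0).
have mkE : measurable_fun [set: R] (fun s => (k s)%:E) by exact/measurable_EFinP.
have p2 : (0 <= (2 ^+ d : R)%:E)%E by rewrite lee_fin exprn_ge0.
rewrite -ge0_integralZl//; last by move=> x _; rewrite lee_fin.
apply: ge0_le_integral => //.
- by move=> s _; exact: integral_ge0.
- exact: (@measurable_integral2 R _ _ _ (measurableTypeR R) (lebesgue_rV d) K mK K0).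
- by apply: emeasurable_funM.
move=> s _; rewrite /fubini_G /K /=.
under eq_integral do rewrite EFinM.
have mSs := @measurable_inner_ball R d s.
rewrite ge0_integralZl//; last 2 first.
- rewrite (_ : (fun x => _) = (fun x => (\1_[set x : 'rV[R]_d | inner x x <= s] x : R)%:E)).
    by apply/measurable_EFinP; exact: measurable_indic.
  by apply/funext => x; rewrite !indicE.
- by rewrite lee_fin; exact: H0.
rewrite (eq_integral (fun x => (\1_[set x : 'rV[R]_d | inner x x <= s] x : R)%:E)); last first.
  by move=> x _; rewrite !indicE.
rewrite integral_indic// setIT.
apply: (le_trans (lee_wpmul2l _ (lebesgue_ball_le d s))) => //; first by rewrite lee_fin.
rewrite -!EFinM lee_fin /H exprMn [leRHS]mulrC -mulrA ler_wpM2l// mulrCA.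
apply: ler_piMr; first by rewrite exprn_ge0.
rewrite -exprMn; apply: exprn_ile1.
  by rewrite mulr_ge0// ?invr_ge0 sqrtr_ge0.
(* For sqrt s = 0 the inverse is 0 by convention, so the product is 0 rather than 1; an inequality
   is enough. *)
have [->|q0] := eqVneq (Num.sqrt s) 0; first by rewrite mulr0.
by rewrite mulVf.
Qed.

(** * Boundedness of the density of Gram matrices *)

Lemma ge0_integral_prod_rV R n (f : 'I_n -> R -> R) :
  (forall i, measurable_fun [set: R] (f i)) -> (forall i x, 0 <= f i x) ->
  (\int[lebesgue_rV n]_x (\prod_(i < n) f i (x ord0 i))%:E =
   \prod_(i < n) \int[lebesgue_measure]_t (f i t)%:E)%E.
Proof.
elim: n f => [|n IHn] f mf f0.
  under eq_integral do rewrite big_ord0.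
  by rewrite big_ord0 integral_cst//= diracT mule1.
have mp k (g : 'I_k -> R -> R) : (forall i, measurable_fun [set: R] (g i)) ->
    measurable_fun [set: 'rV[R]_k] (fun x => (\prod_(i < k) g i (x ord0 i))%:E).
  move=> mg; apply/measurable_EFinP; apply: measurable_prod => i _.
  exact: (measurableT_comp (mg i) (measurable_rV_coord i)).
have mfE : measurable_fun [set: R] (fun t => (f ord0 t)%:E) by exact/measurable_EFinP.
rewrite ge0_integral_cons//; [|exact: mp|by move=> x; rewrite lee_fin prodr_ge0].
under eq_integral => t _.
  under eq_integral => x _.
    rewrite big_ord_recl cons_rV0 /= EFinM.
    under eq_bigr do rewrite cons_rVS /=.
    over.
  rewrite ge0_integralZl//; last 3 first.
  - exact: (mp n (fun i => f (lift ord0 i))).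
  - by move=> x _; rewrite lee_fin prodr_ge0.
  - by rewrite lee_fin.
  rewrite (IHn (fun i => f (lift ord0 i)))// muleC.
  over.
rewrite ge0_integralZl//; last 2 first.
- by move=> x _; rewrite lee_fin.
- by apply: prode_ge0 => i _; apply: integral_ge0 => t _; rewrite lee_fin.
by rewrite big_ord_recl muleC.
Qed.

Lemma lee_prod (R : realDomainType) (I : Type) (s : seq I) (P : pred I) (f g : I -> \bar R) :
  (forall i, P i -> 0 <= f i <= g i)%E ->
  (\prod_(i <- s | P i) f i <= \prod_(i <- s | P i) g i)%E.
Proof.
move=> fg; suff /andP[] : (0 <= \prod_(i <- s | P i) f i <= \prod_(i <- s | P i) g i)%E by [].
elim/big_ind2 : _ => //; first by rewrite lee01 lexx.
move=> x1 x2 y1 y2 /andP[x0 x12] /andP[y0 y12].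
by rewrite mule_ge0// lee_pmul.
Qed.

(** Only the entries on and above the diagonal are independent. The weights are indexed by natural
    numbers so that the induction on rows can shift both indices without changing their type. *)
Definition gram_prod R n m (k : nat -> nat -> R -> R) (x : 'rV[R]_(n * m)) : R :=
  \prod_(i < n) \prod_(j < n | (i <= j)%N)
    k i j ((vec_mx x *m (vec_mx x)^T) i j).

Definition weights_le R (L : R) (k : R -> R) : Prop :=
  [/\ measurable_fun [set: R] k, forall x, 0 <= k x &
    (\int[lebesgue_measure]_t (k t)%:E <= L%:E)%E].

(** Boundedness of the density of the Gram matrix of n vectors in R^m, tested on products of weights
    with L^1 norm at most L. *)
Definition gram_bound R n m (L C : R) : Prop :=
  forall k : nat -> nat -> R -> R, (forall i j, weights_le L (k i j)) ->
  (\int[lebesgue_rV (n * m)]_x (gram_prod k x)%:E <= C%:E)%E.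

Lemma gram_prod_ge0 R n m (L : R) (k : nat -> nat -> R -> R) (x : 'rV[R]_(n * m)) :
  (forall i j, weights_le L (k i j)) -> 0 <= gram_prod k x.
Proof.
by move=> hk; apply: prodr_ge0 => i _; apply: prodr_ge0 => j _; case: (hk i j).
Qed.

Lemma weights_le_ge0 R (L : R) (k : R -> R) : weights_le L k -> 0 <= L.
Proof.
by move=> [_ k0 kL]; rewrite -lee_fin; apply: le_trans kL; apply: integral_ge0 => x _; rewrite lee_fin.
Qed.

Lemma gram_bound_ge0 R n m (L C : R) (k : nat -> nat -> R -> R) :
  (forall i j, weights_le L (k i j)) -> gram_bound n m L C -> 0 <= C.
Proof.
move=> hk hC; rewrite -lee_fin; apply: le_trans (hC _ hk); apply: integral_ge0 => x _.
by rewrite lee_fin (gram_prod_ge0 _ hk).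
Qed.

Lemma measurable_gram_prod R n m (L : R) (k : nat -> nat -> R -> R) :
  (forall i j, weights_le L (k i j)) ->
  measurable_fun [set: 'rV[R]_(n * m)] (gram_prod k).
Proof.
move=> hk; apply: measurable_prod => i _.
under eq_fun do rewrite big_mkcond /=.
apply: measurable_prod => j _; have [_|_] := leqP i j; last exact: measurable_cst.
have [mk _ _] := hk i j; apply: (measurableT_comp mk).
under eq_fun do rewrite mxE.
apply: measurable_sum => l; apply: measurable_funM; first exact: measurable_vec_mx.
by under eq_fun do rewrite mxE; exact: measurable_vec_mx.
Qed.

Lemma weights_le_translation R (L c : R) (k : R -> R) :
  weights_le L k -> weights_le L (fun t => k (t + c)).
Proof.
move=> [mk k0 kL]; have mD : measurable_fun [set: R] (fun t : R => t + c).
  exact: measurable_funD.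
split=> //; first exact: (measurableT_comp mk mD).
rewrite (ge0_integral_translation c (F := fun t => (k t)%:E))//.
exact/measurable_EFinP.
Qed.

Lemma weights_le_scale R (L c : R) (k : R -> R) : 0 < c ->
  weights_le L k -> weights_le (c^-1 * L) (fun t => k (c * t)).
Proof.
move=> c0 [mk k0 kL]; have mM : measurable_fun [set: R] (fun t : R => c * t).
  exact: measurable_funM.
split=> //; first exact: (measurableT_comp mk mM).
rewrite -(@lee_pmul2l _ c%:E) ?lte_fin// -EFinM mulVKf ?gt_eqF//.
rewrite -{1}(gtr0_norm c0).
rewrite (ge0_integral_scale (F := fun t => (k t)%:E)) ?gt_eqF//.
exact/measurable_EFinP.
Qed.

(** Coordinates continued by 0, to let a weight indexed by natural numbers be translated by b_i
    b_j. *)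
Definition nat_coord R n (b : 'rV[R]_n) (i : nat) : R :=
  oapp (fun i' : 'I_n => b ord0 i') 0 (insub i).

Lemma nat_coordE R n (b : 'rV[R]_n) (i : 'I_n) :
  nat_coord b i = b ord0 i.
Proof. by rewrite /nat_coord valK. Qed.

Lemma gram_col_split R n m (b : 'rV[R]_n) (w : 'rV[R]_(n * m)) i j :
  (vec_mx (col_split (b, w)) *m (vec_mx (col_split (b, w)))^T) i j =
  (vec_mx w *m (vec_mx w)^T) i j + b ord0 i * b ord0 j.
Proof.
rewrite mxE big_ord_recl addrC; congr (_ + _).
  rewrite mxE; apply: eq_bigr => l _; rewrite ![in LHS]mxE !mxvecE.
  by rewrite !row_mx_lift !mxE.
by rewrite ![in LHS]mxE !mxvecE !row_mx_ord0 !mxE.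
Qed.

Lemma gram_prod_col_split R n m k (b : 'rV[R]_n) (w : 'rV[R]_(n * m)) :
  gram_prod k (col_split (b, w)) =
  gram_prod (fun i j t => k i j (t + nat_coord b i * nat_coord b j)) w.
Proof.
apply: eq_bigr => i _; apply: eq_bigr => j _.
by rewrite gram_col_split !nat_coordE.
Qed.

Lemma gram_rotation R n m (x : 'rV[R]_(n * m)) (Q : 'M[R]_m) :
  Q *m Q^T = 1%:M -> vec_mx (mxvec (vec_mx x *m Q)) *m (vec_mx (mxvec (vec_mx x *m Q)))^T =
    vec_mx x *m (vec_mx x)^T.
Proof.
by move=> QQ; rewrite mxvecK trmx_mul -mulmxA [Q *m _]mulmxA QQ mul1mx.
Qed.

(* A rotation taking [y] to a multiple of the first basis vector turns the
   linear weights into weights on the first coordinates [b] of the rows, and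
   shifts the Gram matrix of the remaining coordinates by the outer square of [b]. *)
Lemma gram_bound_linear R n m (L C : R) (y : 'rV[R]_m.+1)
    (h : nat -> R -> R) (k : nat -> nat -> R -> R) :
  gram_bound n m L C -> 0 < inner y y ->
  (forall i, weights_le L (h i)) -> (forall i j, weights_le L (k i j)) ->
  (\int[lebesgue_rV (n * m.+1)]_z
     ((\prod_(i < n) h i ((vec_mx z *m y^T) i ord0)) * gram_prod k z)%:E <=
   (C * ((Num.sqrt (inner y y))^-1 * L) ^+ n)%:E)%E.
Proof.
move=> hC y0 hh hk.
have [Q QQ yQ] := exists_rotation y; set r := Num.sqrt _ in yQ *.
have r0 : 0 < r by rewrite sqrtr_gt0.
have QQ' : Q^T *m Q^T^T = 1%:M by rewrite trmxK; exact: mulmx1C.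
set F := fun z => (_)%:E.
have mF : measurable_fun [set: 'rV[R]_(n * m.+1)] F.
  apply/measurable_EFinP; apply: measurable_funM; last exact: measurable_gram_prod hk.
  apply: measurable_prod => i _; have [mh _ _] := hh i.
  apply: (measurableT_comp mh); under eq_fun do rewrite mxE.
  apply: measurable_sum => j; apply: measurable_funM => //; exact: measurable_vec_mx.
have F0 z : (0 <= F z)%E.
  rewrite lee_fin mulr_ge0 ?(gram_prod_ge0 _ hk)// prodr_ge0// => i _.
  by case: (hh i).
rewrite -(preserves_ge0_integral (preserves_mul_rows n QQ'))//.
(* Rotating all rows by Q^T leaves the Gram matrix unchanged and turns each product of a row with y
   into r times the first coordinate of the row. *)
set G := fun z => F (mxvec (vec_mx z *m Q^T)).
have mG : measurable_fun [set: 'rV[R]_(n * m.+1)] G.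
  exact: (measurableT_comp mF (measurable_mul_rows _)).
rewrite -(preserves_ge0_integral (preserves_col_split R n m) (F := G))//; last by move=> z; exact: F0.
have mGs : measurable_fun [set: 'rV[R]_n * 'rV[R]_(n * m)] (fun p => G (col_split p)).
  exact: (measurableT_comp mG (preserves_col_split R n m).1).
rewrite (@fubini_tonelli1 _ _ _ _ R (lebesgue_rV n) (lebesgue_rV (n * m)) (fun p => G (col_split p)))//; last by move=> p; exact: F0.
rewrite /fubini_F.
(* Splitting off the first column b adds b_i b_j to the Gram entries of the other columns. For fixed
   b this only translates the weights, so the hypothesis [hC] applies with the same L. *)
pose kb (b : 'rV[R]_n) (i j : nat) (t : R) := k i j (t + nat_coord b i * nat_coord b j).
have GE (b : 'rV[R]_n) (w : 'rV[R]_(n * m)) : G (col_split (b, w)) =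
    ((\prod_(i < n) h i (r * b ord0 i))%:E * (gram_prod (kb b) w)%:E)%E.
  rewrite /G /F EFinM; congr (_%:E * _%:E)%E.
    apply: eq_bigr => i _; rewrite mxvecK -mulmxA -trmx_mul yQ; congr h.
    rewrite mxE (bigD1 ord0)//= big1 ?addr0.
      rewrite [in LHS]mxE mxvecE row_mx_ord0 !mxE !eqxx mulr1 mulrC//.
    by move=> j j0; rewrite !mxE (negbTE j0) !mulr0.
  rewrite -gram_prod_col_split; apply: eq_bigr => i _; apply: eq_bigr => j _.
  by rewrite gram_rotation.
have mp : measurable_fun [set: 'rV[R]_n] (fun b => (\prod_(i < n) h i (r * b ord0 i))%:E).
  apply/measurable_EFinP; apply: measurable_prod => i _; have [mh _ _] := hh i.
  apply: (measurableT_comp mh); apply: measurable_funM => //; exact: measurable_rV_coord.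
have p0 (b : 'rV[R]_n) : 0 <= \prod_(i < n) h i (r * b ord0 i).
  by apply: prodr_ge0 => i _; case: (hh i).
have hkb b i j : weights_le L (kb b i j).
  exact: weights_le_translation (hk i j).
have C0 := gram_bound_ge0 hk hC.
have L0 := weights_le_ge0 (hk 0 0).
apply: (@le_trans _ _ (\int[lebesgue_rV n]_b (C%:E * (\prod_(i < n) h i (r * b ord0 i))%:E))%E).
  apply: ge0_le_integral => //.
  - by move=> b _; apply: integral_ge0 => w _; exact: F0.
  - by apply: (@measurable_integral1 R _ _ _ _ (lebesgue_rV (n * m)) (fun p => G (col_split p)) mGs) => p; exact: F0.
  - exact: emeasurable_funM.
  - move=> b _; under eq_integral do rewrite GE.
    rewrite ge0_integralZl ?lee_fin//.
    + rewrite muleC; apply: lee_wpmul2r; first by rewrite lee_fin.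
      exact: hC.
    + by apply/measurable_EFinP; exact: measurable_gram_prod (hkb b).
    + by move=> w _; rewrite lee_fin (gram_prod_ge0 _ (hkb b)).
rewrite ge0_integralZl ?lee_fin//; last by move=> b _; rewrite lee_fin.
rewrite [leRHS]EFinM; apply: lee_wpmul2l; first by rewrite lee_fin.
(* Each of the n rows contributes one factor, of integral at most L / r by scaling. *)
rewrite (ge0_integral_prod_rV (f := fun i t => h i (r * t))); last 2 first.
- by move=> i; case: (weights_le_scale r0 (hh i)).
- by move=> i x; case: (hh i).
rewrite -[X in _ ^+ X]card_ord -prodr_const -prodEFin.
apply: lee_prod => i _; apply/andP; split.
  by apply: integral_ge0 => x _; case: (hh i) => _ h0 _; rewrite lee_fin.
by case: (weights_le_scale r0 (hh i)).
Qed.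

Lemma gram_prod_row_split R n m k (y : 'rV[R]_m) (z : 'rV[R]_(n * m)) :
  gram_prod k (row_split (y, z)) =
  k 0 0 (inner y y) * ((\prod_(i < n) k 0 i.+1 ((vec_mx z *m y^T) i ord0)) *
    gram_prod (fun i j => k i.+1 j.+1) z).
Proof.
rewrite /gram_prod big_ord_recl big_mkcond /= big_ord_recl /= -mulrA; congr (_ * (_ * _)).
- congr (k _ _ _); rewrite mxE; apply: eq_bigr => l _.
  by rewrite ![in LHS]mxE !mxvecE !col_mx_ord0.
- apply: eq_bigr => i _; congr (k _ _ _); rewrite !mxE; apply: eq_bigr => l _.
  by rewrite ![in LHS]mxE !mxvecE col_mx_ord0 col_mx_lift !mxE mulrC.
- apply: eq_bigr => i _; rewrite big_mkcond /= big_ord_recl /= mul1r -big_mkcond /=.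
  apply: eq_bigr => j _; congr (k _ _ _); rewrite !mxE; apply: eq_bigr => l _.
  by rewrite ![in LHS]mxE !mxvecE !col_mx_lift !mxE.
Qed.

(** Induction on rows. Fixing the first row y, the other rows see linear weights in their products
    with y, and [gram_bound_linear] costs |y|^-n. In dimension n + 2 this is the weight |y|^(1-d) of
    [polar_bound] with d = n + 1, which is why there is exactly one more column than there are
    rows. *)
Theorem gram_bound_square R n (L : R) :
  exists C : R, @gram_bound R n n.+1 L C.
Proof.
elim: n => [|n [C IHn]].
  exists 1 => k _; rewrite (eq_integral (cst 1%E)); last by move=> x _; rewrite /gram_prod big_ord0.
  by rewrite integral_cst//= diracT mule1.
exists ((C * L ^+ n) * (n.+2%:R * 2 ^+ n.+1 * L)) => k hk.
have C0 := gram_bound_ge0 hk IHn.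
have [mk00 k00 kL00] := hk 0 0; have L0 := weights_le_ge0 (hk 0 0).
have mg := measurable_gram_prod (n := n.+1) (m := n.+2) hk.
have mgE : measurable_fun [set: 'rV[R]_(n.+1 * n.+2)] (fun x => (gram_prod k x)%:E).
  exact/measurable_EFinP.
have g0 x : (0 <= (gram_prod (n := n.+1) (m := n.+2) k x)%:E)%E.
  by rewrite lee_fin (gram_prod_ge0 _ hk).
rewrite -(preserves_ge0_integral (preserves_row_split R n n.+2) (F := fun x => (gram_prod k x)%:E))//.
have mgs : measurable_fun [set: 'rV[R]_n.+2 * 'rV[R]_(n * n.+2)]
    (fun p => (gram_prod k (row_split p))%:E).
  exact: (measurableT_comp mgE (preserves_row_split R n n.+2).1).
rewrite (@fubini_tonelli1 _ _ _ _ R (lebesgue_rV n.+2) (lebesgue_rV (n * n.+2)) (fun p => (gram_prod k (row_split p))%:E))//.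
rewrite /fubini_F.
pose P (y : 'rV[R]_n.+2) := k 0 0 (inner y y) *
  (Num.sqrt (inner y y) * (Num.sqrt (inner y y))^-1 ^+ n.+1).
have P0 y : 0 <= P y by rewrite !mulr_ge0// ?sqrtr_ge0// exprn_ge0// invr_ge0 sqrtr_ge0.
have mi : measurable_fun [set: 'rV[R]_n.+2] (fun y => inner y y) by exact: measurable_inner.
have msqrt := @measurable_sqrt R.
have mP : measurable_fun [set: 'rV[R]_n.+2] (fun y => (P y)%:E).
  apply/measurable_EFinP; apply: measurable_funM; first exact: (measurableT_comp mk00 mi).
  apply: measurable_funM; first exact: (measurableT_comp msqrt mi).
  apply: measurable_funX; apply: (measurableT_comp (@measurable_invr R)).
  exact: (measurableT_comp msqrt mi).
apply: (@le_trans _ _ (\int[lebesgue_rV n.+2]_y ((C * L ^+ n)%:E * (P y)%:E))%E); last first.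
  rewrite ge0_integralZl//; last 2 first.
  - by move=> y _; rewrite lee_fin.
  - by rewrite lee_fin mulr_ge0// exprn_ge0.
  rewrite [leRHS]EFinM; apply: lee_wpmul2l; first by rewrite lee_fin mulr_ge0// exprn_ge0.
  apply: le_trans (polar_bound n.+1 mk00 k00) _.
  by rewrite [leRHS]EFinM; apply: lee_wpmul2l => //; rewrite lee_fin mulr_ge0// exprn_ge0.
apply: ae_ge0_le_integral => //.
- by move=> y _; exact: integral_ge0.
- exact: (@measurable_integral1 R _ _ _ _ (lebesgue_rV (n * n.+2)) (fun p => (gram_prod k (row_split p))%:E) mgs).
- by move=> y _; rewrite -EFinM lee_fin mulr_ge0// mulr_ge0// exprn_ge0.
- exact: emeasurable_funM.
(* The row y = 0 fixes no axis to rotate to; it is discarded as a null set. *)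
exists (box (fun _ : 'I_n.+2 => [set 0])); split.
- exact: (measurable_box (A := fun _ : 'I_n.+2 => [set 0])).
- etransitivity; first exact: (lebesgue_rV_boxE (A := fun _ : 'I_n.+2 => [set 0])).
  rewrite (eq_bigr (fun=> 0%E)) ?big_ord_recl ?mul0e// => i _.
  exact: lebesgue_measure_set1.
move=> y /= ny i /=; apply: contrapT => yi; apply: ny => _.
have q0 : 0 < inner y y.
  rewrite lt_neqAle inner_ge0 andbT eq_sym; apply/negP => /eqP q0; apply: yi.
  move/eqP : q0; rewrite psumr_eq0 => [|j _]; last by rewrite -expr2 sqr_ge0.
  by move/allP/(_ i (mem_index_enum _)); rewrite mulf_eq0 orbb => /eqP.
have r0 : Num.sqrt (inner y y) != 0 by rewrite gt_eqF// sqrtr_gt0.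
under eq_integral do rewrite gram_prod_row_split EFinM.
have hk0 j : weights_le L (k 0 j.+1) by exact: hk.
have hkS i' j : weights_le L (k i'.+1 j.+1) by exact: hk.
rewrite ge0_integralZl ?lee_fin//; last 2 first.
- apply/measurable_EFinP; apply: measurable_funM; last exact: (measurable_gram_prod hkS).
  apply: measurable_prod => j _; have [mh _ _] := hk0 j.
  apply: (measurableT_comp mh); under eq_fun do rewrite mxE.
  apply: measurable_sum => l; apply: measurable_funM => //; exact: measurable_vec_mx.
- move=> z _; rewrite lee_fin mulr_ge0// ?(gram_prod_ge0 _ hkS)// prodr_ge0// => j _.
  by case: (hk0 j).
apply: le_trans (lee_wpmul2l _ (gram_bound_linear IHn q0 hk0 hkS)) _.
  by rewrite lee_fin.
(* One of the n + 1 factors |y|^-1 cancels the factor |y| of [P], leaving |y|^-n. *)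
rewrite -!EFinM lee_fin /P exprMn exprS.
rewrite (mulrA (Num.sqrt _)) mulfV// mul1r; apply: eqW; ring.
Qed.

(** Row sums are products with the vector (1,...,1), a case of [gram_bound_linear]; that direction
    takes one column, whence n + 2 of them. *)
Lemma gram_bound_density R n (L : R) :
  exists C : R, forall (h : nat -> R -> R) (k : nat -> nat -> R -> R),
  (forall i, weights_le L (h i)) -> (forall i j, weights_le L (k i j)) ->
  (\int[lebesgue_rV (n * n.+2)]_z
     ((\prod_(i < n) h i (\sum_(p < n.+2) vec_mx z i p)) * gram_prod k z)%:E <=
   C%:E)%E.
Proof.
have [C hC] := gram_bound_square n L.
pose y : 'rV[R]_n.+2 := const_mx 1.
have y0 : 0 < inner y y.
  rewrite /inner big_ord_recl !mxE mulr1 ltr_pwDl// sumr_ge0// => i _.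
  by rewrite !mxE mulr1.
exists (C * ((Num.sqrt (inner y y))^-1 * L) ^+ n) => h k hh hk.
apply: le_trans (gram_bound_linear hC y0 hh hk).
apply: eqW; apply: eq_integral => z _.
congr (_ * _)%:E; apply: eq_bigr => i _; congr (h _ _); rewrite [RHS]mxE.
by apply: eq_bigr => p _; rewrite !mxE mulr1.
Qed.

(** * Complex-valued integrals *)

Lemma complex_ReM (R : rcfType) (z w : R[i]) :
  complex.Re (z * w) = complex.Re z * complex.Re w - complex.Im z * complex.Im w.
Proof. by case: z w => [a b] [c d]. Qed.

Lemma complex_ImM (R : rcfType) (z w : R[i]) :
  complex.Im (z * w) = complex.Re z * complex.Im w + complex.Im z * complex.Re w.
Proof. by case: z w => [a b] [c d]. Qed.

Lemma sqr_normcE (R : rcfType) (z : R[i]) :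
  normc z ^+ 2 = complex.Re z ^+ 2 + complex.Im z ^+ 2.
Proof. by case: z => a b; rewrite /normc sqr_sqrtr// addr_ge0// sqr_ge0. Qed.

Lemma normc_ge0 (R : rcfType) (z : R[i]) : 0 <= normc z.
Proof. by case: z => a b; exact: sqrtr_ge0. Qed.

Lemma normc_real (R : rcfType) (x : R) : 0 <= x -> normc (x%:C)%C = x.
Proof. by move=> x0; rewrite /normc /= expr0n addr0 sqrtr_sqr ger0_norm. Qed.

Lemma normc_ge_absRe (R : rcfType) (z : R[i]) : `|complex.Re z| <= normc z.
Proof.
rewrite -ler_sqr ?nnegrE ?normc_ge0// sqr_normcE real_normK ?num_real//.
by rewrite lerDl sqr_ge0.
Qed.

Lemma normc_ge_absIm (R : rcfType) (z : R[i]) : `|complex.Im z| <= normc z.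
Proof.
rewrite -ler_sqr ?nnegrE ?normc_ge0// sqr_normcE real_normK ?num_real//.
by rewrite lerDr sqr_ge0.
Qed.

Lemma normc_le_add (R : rcfType) (z : R[i]) :
  normc z <= `|complex.Re z| + `|complex.Im z|.
Proof.
rewrite -ler_sqr ?nnegrE ?normc_ge0 ?addr_ge0// sqr_normcE sqrrD.
by rewrite !real_normK ?num_real// addrAC lerDl mulrn_wge0// mulr_ge0.
Qed.

Lemma normc_conjc (R : rcfType) (z : R[i]) : normc (conjc z) = normc z.
Proof. by case: z => a b; rewrite /normc/= sqrrN. Qed.

Lemma normc_expi R (t : R) : normc (expi t) = 1.
Proof. by rewrite /normc /expi cos2Dsin2 sqrtr1. Qed.

Lemma expiD R (s t : R) : expi (s + t) = expi s * expi t.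
Proof.
rewrite /expi cosD sinD; apply/eqP; rewrite eq_complex /=.
by apply/andP; split; apply/eqP; ring.
Qed.

Lemma conjc_expi R (t : R) : conjc (expi t) = expi (- t).
Proof. by rewrite /expi /= cosN sinN. Qed.

Section complex_integral.
Context (d : measure_display) (T : measurableType d) (R : realType).

Definition cmeas (f : T -> R[i]) : Prop :=
  measurable_fun [set: T] (fun x => complex.Re (f x)) /\
  measurable_fun [set: T] (fun x => complex.Im (f x)).

Lemma cmeasM (f g : T -> R[i]) : cmeas f -> cmeas g -> cmeas (fun x => f x * g x).
Proof.
move=> [fr fi] [gr gi]; split.
  under eq_fun do rewrite complex_ReM.
  by apply: measurable_funB; exact: measurable_funM.
under eq_fun do rewrite complex_ImM.
by apply: measurable_funD; exact: measurable_funM.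
Qed.

Lemma cmeas_expi (t : T -> R) : measurable_fun [set: T] t -> cmeas (fun x => expi (t x)).
Proof.
move=> mt; split => /=.
  apply: (measurableT_comp _ mt); apply: continuous_measurable_fun; exact: continuous_cos.
apply: (measurableT_comp _ mt); apply: continuous_measurable_fun; exact: continuous_sin.
Qed.

Lemma cmeas_conjc (f : T -> R[i]) : cmeas f -> cmeas (fun x => conjc (f x)).
Proof.
move=> [mr mi]; split.
  by rewrite (_ : (fun x => _) = (fun x => complex.Re (f x)))//; apply/funext => x; case: (f x).
rewrite (_ : (fun x => _) = (fun x => - complex.Im (f x))).
  exact: measurableT_comp.
by apply/funext => x; case: (f x).
Qed.

Lemma cmeas_real (f : T -> R) : measurable_fun [set: T] f -> cmeas (fun x => (f x)%:C%C).
Proof. by move=> mf; split. Qed.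

Lemma measurable_normc (f : T -> R[i]) : cmeas f -> measurable_fun [set: T] (fun x => normc (f x)).
Proof.
move=> [mr mi].
rewrite (_ : (fun x => _) = (fun x => Num.sqrt (complex.Re (f x) ^+ 2 + complex.Im (f x) ^+ 2))).
  by apply: (measurableT_comp (@measurable_sqrt R)); apply: measurable_funD; exact: measurable_funX.
by apply/funext => x; case: (f x).
Qed.

Definition cintegrable (mu : {measure set T -> \bar R}) (f : T -> R[i]) : Prop :=
  cmeas f /\ mu.-integrable setT (fun x => (normc (f x))%:E).

(** The same formula as [integral_rV] but over any measure: matrices, products and surface
    coordinates then share the same lemmas, and for [lebesgue_rV] the two are convertible. *)
Definition cintegral (mu : {measure set T -> \bar R}) (f : T -> R[i]) : R[i] :=
  Complex (\int[mu]_x complex.Re (f x)) (\int[mu]_x complex.Im (f x)).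

Context (mu : {measure set T -> \bar R}).

Lemma eq_cintegral (f g : T -> R[i]) :
  f =1 g -> cintegral mu f = cintegral mu g.
Proof. by move=> /funext ->. Qed.

Lemma cintegrable_Re (f : T -> R[i]) :
  cintegrable mu f -> mu.-integrable setT (EFin \o (fun x => complex.Re (f x))).
Proof.
move=> [[mr mi]]; apply: le_integrable => //; first exact/measurable_EFinP.
by move=> x _ /=; rewrite lee_fin (ger0_norm (normc_ge0 _)) normc_ge_absRe.
Qed.

Lemma cintegrable_Im (f : T -> R[i]) :
  cintegrable mu f -> mu.-integrable setT (EFin \o (fun x => complex.Im (f x))).
Proof.
move=> [[mr mi]]; apply: le_integrable => //; first exact/measurable_EFinP.
by move=> x _ /=; rewrite lee_fin (ger0_norm (normc_ge0 _)) normc_ge_absIm.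
Qed.

Lemma cintegrable_le (f : T -> R[i]) (h : T -> R) :
  cmeas f -> mu.-integrable setT (EFin \o h) -> (forall x, normc (f x) <= h x) ->
  cintegrable mu f.
Proof.
move=> mf ih fh; split=> //; apply: le_integrable ih => //.
  by apply/measurable_EFinP; exact: measurable_normc.
move=> x _ /=; rewrite lee_fin (ger0_norm (normc_ge0 _)).
exact: le_trans (fh x) (ler_norm _).
Qed.

Lemma integrable_scale (r : R) (g : T -> R) :
  mu.-integrable setT (EFin \o g) -> mu.-integrable setT (EFin \o (fun x => r * g x)).
Proof. exact: integrableZl. Qed.

Lemma EFin_Rintegral (f : T -> R) : mu.-integrable setT (EFin \o f) ->
  (\int[mu]_x f x)%:E = (\int[mu]_x (f x)%:E)%E.
Proof. by move=> /(integrable_fin_num measurableT); exact: fineK. Qed.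

Lemma cintegralZ (c : R[i]) (f : T -> R[i]) :
  cintegrable mu f -> cintegral mu (fun x => c * f x) = c * cintegral mu f.
Proof.
move=> If; have Ir := cintegrable_Re If; have Ii := cintegrable_Im If.
apply/eqP; rewrite eq_complex complex_ReM complex_ImM /=; apply/andP; split; apply/eqP.
  under eq_Rintegral do rewrite complex_ReM.
  by rewrite RintegralB ?RintegralZl//; exact: integrable_scale.
under eq_Rintegral do rewrite complex_ImM.
by rewrite RintegralD ?RintegralZl//; exact: integrable_scale.
Qed.

(** With z the integral, |z|^2 is the integral of the real part of conj(z) f, which is at most |z|
    |f| pointwise by Lagrange's identity; then |z| is cancelled. *)
Lemma normc_cintegral (f : T -> R[i]) :
  cintegrable mu f ->
  ((normc (cintegral mu f))%:E <= \int[mu]_x (normc (f x))%:E)%E.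
Proof.
move=> If; have Ir := cintegrable_Re If; have Ii := cintegrable_Im If.
have In : mu.-integrable setT (EFin \o (fun x => normc (f x))) by case: If.
set z := cintegral mu f.
rewrite -[leRHS]fineK; last exact: integrable_fin_num.
rewrite lee_fin -/(Rintegral mu setT (fun x => normc (f x))).
have [z0|z0] := eqVneq (normc z) 0.
  by rewrite z0; apply: Rintegral_ge0 => x _; exact: normc_ge0.
have zp : 0 < normc z by rewrite lt_def z0 normc_ge0.
rewrite -(ler_pM2l zp) -RintegralZl// -expr2 sqr_normcE.
have E : complex.Re z ^+ 2 + complex.Im z ^+ 2 =
    \int[mu]_x (complex.Re z * complex.Re (f x) + complex.Im z * complex.Im (f x)).
  by rewrite RintegralD ?RintegralZl ?expr2//; exact: integrable_scale.
rewrite E; apply: le_Rintegral => //.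
- exact: (integrableD measurableT (integrable_scale _ Ir) (integrable_scale _ Ii)).
- exact: integrable_scale.
- move=> x _; apply: le_trans (ler_norm _) _.
  rewrite -ler_sqr ?nnegrE ?mulr_ge0 ?normc_ge0// real_normK ?num_real//.
  rewrite exprMn !sqr_normcE -subr_ge0.
  rewrite (_ : _ - _ = (complex.Re z * complex.Im (f x) - complex.Im z * complex.Re (f x)) ^+ 2).
    exact: sqr_ge0.
  ring.
Qed.

Lemma cintegrable_ReIm (f : T -> R[i]) :
  mu.-integrable setT (EFin \o (fun x => complex.Re (f x))) ->
  mu.-integrable setT (EFin \o (fun x => complex.Im (f x))) -> cintegrable mu f.
Proof.
move=> ir ii; have mf : cmeas f.
  by split; apply/measurable_EFinP; [exact: measurable_int ir|exact: measurable_int ii].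
split=> //; have := integrableD measurableT (integrable_abse ir) (integrable_abse ii).
apply: le_integrable => //; first by apply/measurable_EFinP; exact: measurable_normc.
move=> x _; rewrite /= lee_fin ger0_norm ?normc_ge0//.
by apply: le_trans (ler_norm _); exact: normc_le_add.
Qed.

Lemma cintegral_conjc (f : T -> R[i]) :
  cintegrable mu f -> cintegral mu (fun x => conjc (f x)) = conjc (cintegral mu f).
Proof.
move=> If; have Ii := cintegrable_Im If.
rewrite /cintegral /= -[X in - X]mul1r -mulNr -RintegralZl//.
by congr Complex; apply: eq_Rintegral => x _; case: (f x) => // u v /=; rewrite mulN1r.
Qed.

End complex_integral.

Lemma cmeas_comp d1 d2 (T1 : measurableType d1)
    (T2 : measurableType d2) R (f : T2 -> R[i]) (g : T1 -> T2) :
  cmeas f -> measurable_fun setT g -> cmeas (f \o g).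
Proof. by move=> [mr mi] mg; split; [exact: (measurableT_comp mr mg)|exact: (measurableT_comp mi mg)]. Qed.

Lemma preserves_cintegral R d1 d2 (T1 : measurableType d1) (T2 : measurableType d2)
    (m1 : {measure set T1 -> \bar R}) (m2 : {measure set T2 -> \bar R})
    (f : T1 -> T2) (F : T2 -> R[i]) :
  preserves m1 m2 f -> cintegrable m2 F ->
  cintegral m1 (fun x => F (f x)) = cintegral m2 F.
Proof.
move=> pf IF; rewrite /cintegral /Rintegral.
have /= -> := preserves_integral pf (cintegrable_Re IF).
by have /= -> := preserves_integral pf (cintegrable_Im IF).
Qed.

Lemma preserves_cintegrable R d1 d2 (T1 : measurableType d1) (T2 : measurableType d2)
    (m1 : {measure set T1 -> \bar R}) (m2 : {measure set T2 -> \bar R})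
    (f : T1 -> T2) (F : T2 -> R[i]) :
  preserves m1 m2 f -> cmeas F -> cintegrable m1 (F \o f) -> cintegrable m2 F.
Proof.
move=> pf mF [_ i1]; split=> //.
apply/(preserves_integrable pf (F := fun x => (normc (F x))%:E)) => //.
by apply/measurable_EFinP; exact: measurable_normc.
Qed.

Section complex_fubini.
Context (R : realType) (d1 d2 : measure_display)
    (T1 : measurableType d1) (T2 : measurableType d2)
    (m1 : {sigma_finite_measure set T1 -> \bar R})
    (m2 : {sigma_finite_measure set T2 -> \bar R}).

Lemma integrable_prodM (a : T1 -> R) (b : T2 -> R) :
  m1.-integrable setT (EFin \o a) -> m2.-integrable setT (EFin \o b) ->
  (m1 \x m2)%E.-integrable setT (EFin \o (fun p : T1 * T2 => a p.1 * b p.2)).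
Proof.
move=> /integrableP[ma ia] /integrableP[mb ib].
have mab : measurable_fun [set: T1 * T2] (EFin \o (fun p : T1 * T2 => a p.1 * b p.2)).
  apply/measurable_EFinP; apply: measurable_funM.
    by apply: (measurableT_comp _ measurable_fst); exact/measurable_EFinP.
  by apply: (measurableT_comp _ measurable_snd); exact/measurable_EFinP.
apply/(@integrable12ltyP _ _ _ _ R m1 m2 _ mab) => /=.
have mna : measurable_fun [set: T1] (fun x => `|a x|%:E).
  by apply/measurable_EFinP; apply: measurableT_comp => //; exact/measurable_EFinP.
have mnb : measurable_fun [set: T2] (fun x => `|b x|%:E).
  by apply/measurable_EFinP; apply: measurableT_comp => //; exact/measurable_EFinP.
under eq_integral => x _.
  under eq_integral do rewrite normrM EFinM.
  rewrite ge0_integralZl// muleC.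
  over.
rewrite ge0_integralZl//; last by apply: integral_ge0.
by apply: lte_mul_pinfty => //; [exact: integral_ge0|rewrite ge0_fin_numE//; exact: integral_ge0].
Qed.

(** Domination by a product makes every section integrable, not merely almost every one. Hence the
    real-valued iterated integrals agree everywhere with [fubini_F] and [fubini_G], and taking
    [fine] loses nothing. *)
Lemma Rfubini (F : T1 * T2 -> R) (a : T1 -> R) (b : T2 -> R) :
  measurable_fun [set: T1 * T2] F ->
  m1.-integrable setT (EFin \o a) -> m2.-integrable setT (EFin \o b) ->
  (forall p, `|F p| <= a p.1 * b p.2) ->
  [/\ m1.-integrable setT (EFin \o (fun x => \int[m2]_y F (x, y))),
    m2.-integrable setT (EFin \o (fun y => \int[m1]_x F (x, y))) &
    \int[m1]_x \int[m2]_y F (x, y) = \int[m2]_y \int[m1]_x F (x, y)].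
Proof.
move=> mF ia ib Fab; have iab := integrable_prodM ia ib.
have mFE : measurable_fun [set: T1 * T2] (EFin \o F) by exact/measurable_EFinP.
have iF : (m1 \x m2)%E.-integrable setT (EFin \o F).
  apply: le_integrable iab => // p _ /=.
  by rewrite lee_fin; exact: le_trans (Fab p) (ler_norm _).
have e1 : EFin \o (fun x => \int[m2]_y F (x, y)) = fubini_F m2 (EFin \o F).
  apply/funext => x; rewrite /fubini_F /= /Rintegral fineK//.
  apply: integrable_fin_num => //.
  apply: (@le_integrable _ _ R m2 setT measurableT (EFin \o (fun y => F (x, y))) (fun y => (a x)%:E * (EFin \o b) y)%E).
  - exact: (measurableT_comp mFE (measurable_pair1 x)).
  - by move=> y _ /=; rewrite lee_fin; exact: le_trans (Fab (x, y)) (ler_norm _).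
  - exact: integrableZl.
have e2 : EFin \o (fun y => \int[m1]_x F (x, y)) = fubini_G m1 (EFin \o F).
  apply/funext => y; rewrite /fubini_G /= /Rintegral fineK//.
  apply: integrable_fin_num => //.
  apply: (@le_integrable _ _ R m1 setT measurableT (EFin \o (fun x => F (x, y))) (fun x => (b y)%:E * (EFin \o a) x)%E).
  - exact: (measurableT_comp mFE (measurable_pair2 y)).
  - by move=> x _ /=; rewrite lee_fin mulrC; exact: le_trans (Fab (x, y)) (ler_norm _).
  - exact: integrableZl.
split; first by rewrite e1; exact: integrable_fubini_F.
  pose A := \int[m1]_x a x.
  apply: (@le_integrable _ _ R m2 setT measurableT _ (fun y => A%:E * (EFin \o b) y)%E).
  - by rewrite e2; exact: (measurable_fubini_G iF).
  - move=> y _ /=; rewrite lee_fin; apply: le_trans (ler_norm _).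
    have iFy : m1.-integrable setT (EFin \o (fun x => F (x, y))).
      apply: (@le_integrable _ _ R m1 setT measurableT (EFin \o (fun x => F (x, y))) (fun x => (b y)%:E * (EFin \o a) x)%E).
      + exact: (measurableT_comp mFE (measurable_pair2 y)).
      + by move=> x _ /=; rewrite lee_fin mulrC; exact: le_trans (Fab (x, y)) (ler_norm _).
      + exact: integrableZl.
    apply: le_trans (le_normr_Rintegral measurableT iFy) _.
    rewrite /A -RintegralZr//; apply: le_Rintegral => //.
    + exact: (integrable_abse iFy).
    + rewrite (_ : EFin \o _ = (fun x => (b y)%:E * (EFin \o a) x)%E).
        exact: integrableZl.
      by apply/funext => x /=; rewrite -EFinM mulrC.
  - exact: integrableZl.
rewrite [LHS]/Rintegral [RHS]/Rintegral; congr fine.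
transitivity (\int[m1]_x fubini_F m2 (EFin \o F) x)%E; first by rewrite -e1.
transitivity (\int[m2]_y fubini_G m1 (EFin \o F) y)%E; last by rewrite -e2.
by rewrite (integral12_prod_meas1 iF) (integral21_prod_meas1 iF).
Qed.

Lemma cfubini (F : T1 * T2 -> R[i]) (a : T1 -> R) (b : T2 -> R) :
  cmeas F ->
  m1.-integrable setT (EFin \o a) -> m2.-integrable setT (EFin \o b) ->
  (forall p, normc (F p) <= a p.1 * b p.2) ->
  [/\ cintegrable m1 (fun x => cintegral m2 (fun y => F (x, y))),
    cintegrable m2 (fun y => cintegral m1 (fun x => F (x, y))) &
    cintegral m1 (fun x => cintegral m2 (fun y => F (x, y))) =
    cintegral m2 (fun y => cintegral m1 (fun x => F (x, y)))].
Proof.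
move=> [mr mi] ia ib Fab.
have br p : `|complex.Re (F p)| <= a p.1 * b p.2.
  exact: le_trans (normc_ge_absRe _) (Fab p).
have bi p : `|complex.Im (F p)| <= a p.1 * b p.2.
  exact: le_trans (normc_ge_absIm _) (Fab p).
have [r1 r2 r3] := Rfubini mr ia ib br.
have [i1 i2 i3] := Rfubini mi ia ib bi.
split; [exact: cintegrable_ReIm|exact: cintegrable_ReIm|].
by rewrite /cintegral /= r3 i3.
Qed.

Lemma cintegral_prodE (F : T1 * T2 -> R[i]) (a : T1 -> R) (b : T2 -> R) :
  cmeas F ->
  m1.-integrable setT (EFin \o a) -> m2.-integrable setT (EFin \o b) ->
  (forall p, normc (F p) <= a p.1 * b p.2) ->
  cintegral (m1 \x m2)%E F = cintegral m1 (fun x => cintegral m2 (fun y => F (x, y))).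
Proof.
move=> mF ia ib Fab; have IF := cintegrable_le mF (integrable_prodM ia ib) Fab.
have S (G : T1 * T2 -> R) : (m1 \x m2)%E.-integrable setT (EFin \o G) ->
    measurable_fun [set: T1 * T2] G -> (forall p, `|G p| <= a p.1 * b p.2) ->
    \int[(m1 \x m2)%E]_p G p = \int[m1]_x \int[m2]_y G (x, y).
  move=> iG mG Gab; rewrite {1 2}/Rintegral -(integral12_prod_meas1 iG); congr fine.
  apply: eq_integral => x _; rewrite /fubini_F /Rintegral fineK//.
  apply: integrable_fin_num => //.
  apply: (@le_integrable _ _ R m2 setT measurableT (EFin \o (fun y => G (x, y))) (fun y => (a x)%:E * (EFin \o b) y)%E).
  - apply/measurable_EFinP; exact: (measurableT_comp mG (measurable_pair1 x)).
  - by move=> y _ /=; rewrite lee_fin; exact: le_trans (Gab (x, y)) (ler_norm _).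
  - exact: integrableZl.
rewrite /cintegral /= !S//.
- exact: cintegrable_Im.
- by case: mF.
- by move=> p; exact: le_trans (normc_ge_absIm _) (Fab p).
- exact: cintegrable_Re.
- by case: mF.
- by move=> p; exact: le_trans (normc_ge_absRe _) (Fab p).
Qed.

Lemma cintegral_prodM (f : T1 -> R[i]) (g : T2 -> R[i]) :
  cintegrable m1 f -> cintegrable m2 g ->
  cintegrable (m1 \x m2)%E (fun p => f p.1 * g p.2) /\
  cintegral (m1 \x m2)%E (fun p => f p.1 * g p.2) = cintegral m1 f * cintegral m2 g.
Proof.
move=> If Ig; have [mf nf] := If; have [mg ng] := Ig.
have mF : cmeas (fun p : T1 * T2 => f p.1 * g p.2).
  by apply: cmeasM; [exact: (cmeas_comp mf measurable_fst)|exact: (cmeas_comp mg measurable_snd)].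
have b p : normc (f p.1 * g p.2) <= normc (f p.1) * normc (g p.2) by rewrite normcM.
split; first exact: cintegrable_le mF (integrable_prodM nf ng) b.
rewrite (cintegral_prodE mF nf ng b).
transitivity (cintegral m1 (fun x => cintegral m2 g * f x)).
  by apply: eq_cintegral => x /=; rewrite cintegralZ// mulrC.
by rewrite cintegralZ// mulrC.
Qed.

End complex_fubini.

(** * The window and its Fourier transform *)

(** A truncated parabola vanishes at the end points of its support, so its Fourier transform decays
    like x^-2 and is integrable, while its integrals against sines and cosines stay elementary. *)
Definition window R (M t : R) : R :=
  if `|t| <= M then 1 - (t / M) ^+ 2 else 0.

(** A dilate of 16 / (1 + x^2) normalized so that its integral does not depend on M. *)
Definition window_bound R (M x : R) : R := 16 * M / (1 + (M * x) ^+ 2).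

Lemma eq_integral_lebesgue R (f g : R -> \bar R) : f =1 g ->
  (\int[lebesgue_measure]_t f t = \int[lebesgue_measure]_t g t)%E.
Proof. by move=> /funext ->. Qed.

Lemma integral_indic_itv R (a b : R) : a <= b ->
  (\int[lebesgue_measure]_t (\1_(`[a, b]%classic : set R) t : R)%:E = (b - a)%:E)%E.
Proof.
move=> ab; rewrite integral_indic// setIT -[LHS]/(lebesgue_measure _).
rewrite lebesgue_measure_itv/= lte_fin; move: ab; rewrite le_eqVlt => /predU1P[->|->].
  by rewrite ltxx subrr.
by rewrite EFinB.
Qed.

Lemma window_ge0 R (M t : R) : 0 < M -> 0 <= window M t.
Proof.
move=> M0; rewrite /window; case: ifP => // tM.
rewrite subr_ge0 -real_normK ?num_real// normrM normfV (gtr0_norm M0).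
by apply: exprn_ile1; [rewrite divr_ge0// ltW|rewrite ler_pdivrMr// mul1r].
Qed.

Lemma windowE R (M t : R) :
  window M t = ((fun t => 1 - (t / M) ^+ 2) \_ (`[- M, M]%classic : set R)) t.
Proof. by rewrite /window patchE mem_setE in_itv/= -ler_norml. Qed.

Lemma continuous_parabola R (M : R) : continuous (fun t : R => 1 - (t / M) ^+ 2).
Proof.
move=> t; apply: cvgB; first exact: cvg_cst.
by apply: cvgM; apply: cvgM; [exact: cvg_id|exact: cvg_cst|exact: cvg_id|exact: cvg_cst].
Qed.

Lemma measurable_window R (M : R) : measurable_fun [set: R] (window M).
Proof.
rewrite (_ : window M = (fun t => 1 - (t / M) ^+ 2) \_ (`[- M, M]%classic : set R)).
  apply/(measurable_restrictT _ _).1 => //; apply: measurable_funTS.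
  by apply: continuous_measurable_fun; exact: continuous_parabola.
by apply/funext => t; rewrite windowE.
Qed.

Lemma integrable_window R (M : R) : 0 < M ->
  lebesgue_measure.-integrable [set: R] (EFin \o window M).
Proof.
move=> M0.
have iI : lebesgue_measure.-integrable [set: R] (EFin \o (\1_(`[- M, M]%classic : set R) : R -> R)).
  apply/integrableP; split.
    by apply/measurable_EFinP; exact: measurable_indic.
  rewrite (@eq_integral_lebesgue R _ (fun x => (\1_(`[- M, M]%classic : set R) x : R)%:E)); last first.
    by move=> x /=; rewrite ger0_norm.
  by rewrite integral_indic_itv ?ltry// ge0_cp// ltW.
apply: le_integrable iI => //.
  by apply/measurable_EFinP; exact: measurable_window.
move=> x _ /=; rewrite lee_fin !ger0_norm ?window_ge0//.
rewrite windowE patchE indicE; case: ifP => // _.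
by rewrite gerBl sqr_ge0.
Qed.

(** The result of two integrations by parts of (1 - (t / M)^2) cos(x t). *)
Definition window_cos_primitive R (M x t : R) : R :=
  (1 - (t / M) ^+ 2) * (sin (x * t) / x) - 2 * t / M ^+ 2 * (cos (x * t) / x ^+ 2) +
  2 / M ^+ 2 * (sin (x * t) / x ^+ 3).

Lemma is_derive_window_cos R (M x t : R) : M != 0 -> x != 0 ->
  is_derive t 1 (window_cos_primitive M x) ((1 - (t / M) ^+ 2) * cos (x * t)).
Proof.
move=> M0 x0; rewrite /window_cos_primitive.
have dm : is_derive t 1 (fun t : R => x * t) x.
  by apply: is_derive_eq; rewrite [LHS]mulr1.
have ds : is_derive t 1 (fun t : R => sin (x * t)) (x * cos (x * t)).
  by apply: is_derive_eq; rewrite mulrC.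
have dc : is_derive t 1 (fun t : R => cos (x * t)) (- x * sin (x * t)).
  by apply: is_derive_eq; ring.
apply: is_derive_eq; rewrite /GRing.scale /=; field.
by rewrite M0 x0.
Qed.

(** At t = M and t = -M the term in 1 / x vanishes together with the parabola, so only terms of
    order x^-2 and x^-3 remain. *)
Lemma Rintegral_window_cos R (M x : R) : 0 < M -> x != 0 ->
  \int[lebesgue_measure]_t (window M t * cos (t * x)) =
  4 / (M ^+ 2 * x ^+ 3) * sin (x * M) - 4 / (M * x ^+ 2) * cos (x * M).
Proof.
move=> M0 x0.
transitivity (\int[lebesgue_measure]_(t in `[- M, M]) ((1 - (t / M) ^+ 2) * cos (x * t))).
  rewrite [RHS]Rintegral_mkcond; apply: eq_Rintegral => t _.
  by rewrite windowE !patchE [t * x]mulrC; case: ifP => _; rewrite ?mul0r.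
have ab : - M < M by rewrite gtrN.
have D (t : R) := is_derive_window_cos t (lt0r_neq0 M0) x0.
have cF : continuous (window_cos_primitive M x).
  by move=> t; apply/differentiable_continuous/derivable1_diffP; case: (D t).
rewrite /Rintegral (@continuous_FTC2 R (fun t => (1 - (t / M) ^+ 2) * cos (x * t)) (window_cos_primitive M x))//.
- rewrite -EFinB /= /window_cos_primitive mulrN cosN sinN; field.
  by rewrite x0 gt_eqF.
- apply: continuous_subspaceT => t; apply: cvgM; first exact: continuous_parabola.
  apply: continuous_comp; last exact: continuous_cos.
  by apply: cvgM; [exact: cvg_cst|exact: cvg_id].
- split.
  + by move=> t _; case: (D t).
  + by apply: cvg_at_right_filter; exact: cF.
  + by apply: cvg_at_left_filter; exact: cF.
- by move=> t _; rewrite derive1E; case: (D t).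
Qed.

(** The positive and negative parts have equal integrals by t -> -t. If these are infinite, their
    difference is infinite too and [fine] sends it to 0. *)
Lemma Rintegral_odd R (f : R -> R) : measurable_fun [set: R] f ->
  (forall t, f (- t) = - f t) -> \int[lebesgue_measure]_t f t = 0.
Proof.
move=> mf fN; rewrite /Rintegral integralE.
pose F := (EFin \o f)^\+%E.
have mF : measurable_fun [set: R] F by apply: measurable_funepos; exact/measurable_EFinP.
have N1 : -1 != 0 :> R by rewrite oppr_eq0 oner_eq0.
have := ge0_integral_scale N1 mF (funepos_ge0 _); rewrite normrN1 mul1e.
rewrite (@eq_integral_lebesgue R _ (EFin \o f)^\-%E); last first.
  by move=> t; rewrite /F funeposE funenegE /= mulN1r fN EFinN.
by rewrite /F => ->; case: (integral _ _ _) => //= x; rewrite subrr.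
Qed.

Lemma cintegrable_window R (M x : R) : 0 < M ->
  cintegrable (@lebesgue_measure R) (fun t => (window M t)%:C%C * expi (t * x)).
Proof.
move=> M0; apply: (@cintegrable_le _ (measurableTypeR R) R lebesgue_measure _ (window M)).
- apply: cmeasM; first by apply: cmeas_real; exact: measurable_window.
  by apply: cmeas_expi; exact: measurable_funM.
- exact: integrable_window.
- by move=> t; rewrite normcM normc_expi mulr1 normc_real// window_ge0.
Qed.

Lemma normc_window_fourier R (M x : R) : 0 < M ->
  normc (cintegral (@lebesgue_measure R) (fun t => (window M t)%:C%C * expi (t * x))) <=
  window_bound M x.
Proof.
move=> M0; have M2 : 0 < 1 + (M * x) ^+ 2 by rewrite ltr_pwDl// sqr_ge0.
have [u1|u1] := lerP (M * `|x|) 1.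
  (* For M |x| <= 1 the length 2 M of the support is enough, since 1 + (M x)^2 <= 2 there. *)
  rewrite -lee_fin; apply: le_trans (normc_cintegral (cintegrable_window x M0)) _.
  apply: (@le_trans _ _ (2 * M)%:E); last first.
    rewrite lee_fin /window_bound ler_pdivlMr//.
    have : (M * x) ^+ 2 <= 1.
      rewrite -real_normK ?num_real// normrM (gtr0_norm M0) exprn_ile1//.
      by rewrite mulr_ge0// ltW.
    by nra.
  rewrite (@eq_integral_lebesgue R _ (fun t => (window M t)%:E)); last first.
    by move=> t; rewrite normcM normc_expi mulr1 normc_real// window_ge0.
  apply: (@le_trans _ _ (\int[lebesgue_measure]_t (\1_(`[- M, M]%classic : set R) t : R)%:E)%E).
    apply: ge0_le_integral => //.
    - by move=> t _; rewrite lee_fin window_ge0.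
    - by apply/measurable_EFinP; exact: measurable_window.
    - by apply/measurable_EFinP; exact: measurable_indic.
    - move=> t _; rewrite lee_fin windowE patchE indicE; case: ifP => // _.
      by rewrite gerBl sqr_ge0.
  by rewrite integral_indic_itv ?lee_fin; lra.
have x0 : x != 0 by apply/eqP => x0; move: u1; rewrite x0 normr0 mulr0 ltr10.
rewrite (_ : cintegral _ _ = (\int[lebesgue_measure]_t (window M t * cos (t * x)))%:C%C); last first.
  apply/eqP; rewrite eq_complex /=; apply/andP; split; apply/eqP.
    by apply: eq_Rintegral => t _; rewrite mul0r subr0.
  rewrite -[RHS](@Rintegral_odd R (fun t => window M t * sin (t * x))).
  - by apply: eq_Rintegral => t _; rewrite mul0r addr0.
  - apply: measurable_funM; first exact: measurable_window.
    by apply: (cmeas_expi (T := measurableTypeR R) _).2; exact: measurable_funM.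
  - by move=> t; rewrite mulNr sinN mulrN /window normrN mulNr sqrrN.
rewrite Rintegral_window_cos// /normc /= expr0n addr0 sqrtr_sqr.
have M2' : 0 < M ^+ 2 by rewrite exprn_gt0.
have xn : 0 < `|x| by rewrite normr_gt0.
apply: le_trans (ler_normB _ _) _.
have e1 : `|4 / (M ^+ 2 * x ^+ 3)| = 4 / (M ^+ 2 * `|x| ^+ 3).
  by rewrite normf_div (normrM (M ^+ 2)) (normrX 3) normr_nat (ger0_norm (ltW M2')).
have e2 : `|4 / (M * x ^+ 2)| = 4 / (M * `|x| ^+ 2).
  by rewrite normf_div (normrM M) (normrX 2) normr_nat (ger0_norm (ltW M0)).
rewrite normrM e1 [X in _ + X <= _]normrM e2.
apply: (@le_trans _ _ (4 / (M ^+ 2 * `|x| ^+ 3) + 4 / (M * `|x| ^+ 2))).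
  apply: lerD; apply: ler_piMr.
  - by rewrite divr_ge0// mulr_ge0// exprn_ge0// ltW.
  - by rewrite ler_norml sin_geN1 sin_le1.
  - by rewrite divr_ge0// mulr_ge0 ?exprn_ge0// ltW.
  - by rewrite ler_norml cos_geN1 cos_le1.
rewrite /window_bound exprMn -[x ^+ 2]real_normK ?num_real//.
move: M2 => _; set y := `|x| in xn u1 *.
have D : 0 < 1 + M ^+ 2 * y ^+ 2 by rewrite ltr_pwDl// mulr_ge0// exprn_ge0// ltW.
rewrite (_ : 4 / _ + 4 / _ = (4 + 4 * (M * y)) / (M ^+ 2 * y ^+ 3)); last first.
  by field; rewrite !gt_eqF.
rewrite ler_pdivrMr ?mulr_gt0 ?exprn_gt0// mulrAC ler_pdivlMr//.
rewrite (_ : 16 * M * (M ^+ 2 * y ^+ 3) = 16 * (M * y) ^+ 3); last by ring.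
rewrite (_ : 1 + M ^+ 2 * y ^+ 2 = 1 + (M * y) ^+ 2); last by ring.
(* What remains is (4 + 4 u)(1 + u^2) <= 16 u^3 for u >= 1. Equality at u = 1 is where the constant
   16 comes from, and u - 1 factors out of the difference. *)
set u := M * y in u1 *.
have : 0 <= (u - 1) by rewrite subr_ge0 ltW.
move=> v0; rewrite -subr_ge0.
rewrite (_ : _ - _ = (u - 1) * (12 * u ^+ 2 + 8 * u + 4)); last by ring.
rewrite mulr_ge0// !addr_ge0// mulr_ge0// ?exprn_ge0//; lra.
Qed.

Lemma integral_oneDsqr_le R :
  exists2 A : R, 0 <= A & (\int[lebesgue_measure]_t (16 / (1 + t ^+ 2))%:E <= A%:E)%E.
Proof.
pose f (t : R) : \bar R := (16 / (1 + t ^+ 2))%:E.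
have f0 t : (0 <= f t)%E by rewrite lee_fin divr_ge0// addr_ge0// sqr_ge0.
have mf : measurable_fun [set: R] f.
  apply/measurable_EFinP; apply: measurable_funM => //.
  apply: (measurableT_comp (@measurable_invr R)).
  by apply: measurable_funD => //; exact: measurable_funX.
have fN t : f (- t) = f t by rewrite /f sqrrN.
have half : (\int[lebesgue_measure]_(t in `[0%R, +oo[) f t = (16 * (pi / 2))%:E)%E.
  rewrite EFinM -(integral0y_oneDsqr R) -ge0_integralZl//.
  apply/measurable_EFinP; apply: measurable_funTS.
  by apply: continuous_measurable_fun; exact: continuous_oneDsqrV.
exists (16 * pi); first by rewrite mulr_ge0// pi_ge0.
have mC : measurable (~` (`[0, +oo[%classic : set R)) by exact: measurableC.
rewrite -(setvU `[(0:R), +oo[%classic) ge0_integral_setU//=; last 3 first.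
- by rewrite setvU.
- by move=> x _; exact: f0.
- by apply/disj_setPS => x [nx xx]; exact: nx xx.
rewrite half setCitvr.
have -> : 16 * pi = 16 * (pi / 2) + 16 * (pi / 2) :> R by field.
rewrite EFinD; apply: leeD => //.
rewrite -half ge0_integration_by_substitution0//.
under [leRHS]eq_integral do rewrite fN.
apply: ge0_subset_integral => //; first exact: measurable_funTS.
  by move=> x _; exact: f0.
by move=> x /=; rewrite !in_itv/= => /ltW.
Qed.

(** A single L serves for all M and c: dilation and translation do not change the L^1 norm of M f(M
    x). This uniformity lets the windows grow. *)
Lemma weights_window_bound R :
  exists2 L : R, 0 <= L & forall M c : R, 0 < M ->
    weights_le L (fun x => window_bound M (x + c)).
Proof.
have [A A0 hA] := integral_oneDsqr_le R.
have D (t : R) : 0 < 1 + t ^+ 2 by rewrite ltr_pwDl// sqr_ge0.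
have m0 : measurable_fun [set: R] (fun t : R => 16 / (1 + t ^+ 2)).
  apply: measurable_funM => //; apply: (measurableT_comp (@measurable_invr R)).
  by apply: measurable_funD => //; exact: measurable_funX.
exists A => // M c M0.
have : weights_le (M^-1 * A) (fun t => 16 / (1 + (M * t) ^+ 2)).
  apply: (weights_le_scale M0 (k := fun t => 16 / (1 + t ^+ 2))); split=> // x.
  by rewrite divr_ge0// ltW.
move=> /(weights_le_translation c) [mk k0 kL]; split.
- rewrite (_ : (fun x => _) = (fun t => M * (16 / (1 + (M * (t + c)) ^+ 2)))).
    exact: measurable_funM.
  by apply/funext => t; rewrite /window_bound; ring.
- by move=> x; rewrite /window_bound divr_ge0 ?mulr_ge0// ltW.
- rewrite (@eq_integral_lebesgue R _ (fun t => M%:E * (16 / (1 + (M * (t + c)) ^+ 2))%:E)%E).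
    have mkE : measurable_fun [set: R] (fun t => (16 / (1 + (M * (t + c)) ^+ 2))%:E).
      exact/measurable_EFinP.
    rewrite ge0_integralZl//; last 2 first.
    - by move=> x _; rewrite lee_fin.
    - by rewrite lee_fin ltW.
    rewrite -(@lee_pmul2l _ M^-1%:E) ?lte_fin ?invr_gt0// muleA -!EFinM mulVf ?gt_eqF// mul1e.
    exact: kL.
  by move=> t; rewrite -EFinM /window_bound; congr EFin; ring.
Qed.

(** * A Plancherel inequality *)

Definition prod_sigma_finite R d1 d2 (T1 : measurableType d1) (T2 : measurableType d2)
    (m1 : {sigma_finite_measure set T1 -> \bar R}) (m2 : {sigma_finite_measure set T2 -> \bar R}) :
    {sigma_finite_measure set (T1 * T2)%type -> \bar R} :=
  HB.pack (m1 \x m2)%E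
    (Measure_isSigmaFinite.Build _ _ _ (m1 \x m2)%E (product_sigma_finite m1 m2)).

Definition window_rV R (M : R) N (y : 'rV[R]_N) : R :=
  \prod_(i < N) window M (y ord0 i).

Definition pairing R N (y : 'rV[R]_N) (x : 'I_N -> R) : R :=
  \sum_(i < N) y ord0 i * x i.

Lemma measurable_pairing R N d (T : measurableType d) (y : T -> 'rV[R]_N) (x : T -> 'I_N -> R) :
  measurable_fun [set: T] y -> (forall i, measurable_fun [set: T] (fun t => x t i)) ->
  measurable_fun [set: T] (fun t => pairing (y t) (x t)).
Proof.
move=> /measurable_fun_rVP my mx; apply: measurable_sum => i.
exact: measurable_funM.
Qed.

Lemma window_rV_ge0 R (M : R) N (y : 'rV[R]_N) :
  0 < M -> 0 <= window_rV M y.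
Proof. by move=> M0; apply: prodr_ge0 => i _; exact: window_ge0. Qed.

Lemma measurable_window_rV R (M : R) N :
  measurable_fun [set: 'rV[R]_N] (@window_rV R M N).
Proof.
apply: measurable_prod => i _.
exact: (measurableT_comp (measurable_window M) (measurable_rV_coord i)).
Qed.

Lemma window_fourier_rV R (M : R) N (x : 'I_N -> R) : 0 < M ->
  cintegrable (@lebesgue_rV R N) (fun y => (window_rV M y)%:C%C * expi (pairing y x)) /\
  normc (cintegral (lebesgue_rV N) (fun y => (window_rV M y)%:C%C * expi (pairing y x))) <=
  \prod_(i < N) window_bound M (x i).
Proof.
move=> M0; elim: N x => [|N IHN] x.
  have E : (fun y : 'rV[R]_0 => (window_rV M y)%:C%C * expi (pairing y x)) = (fun=> 1%:C%C).
    apply/funext => y; rewrite /window_rV /pairing !big_ord0 /expi cos0 sin0.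
    by rewrite mulr1.
  have I1 : cintegrable (@lebesgue_rV R 0) (fun=> 1%:C%C).
    apply: (@cintegrable_le _ _ _ _ _ (fun=> 1)).
    - by split; exact: measurable_cst.
    - apply/integrableP; split; first exact: measurable_cst.
      rewrite (eq_integral (cst 1%E)); last by move=> y _ /=; rewrite normr1.
      by rewrite integral_cst//= diracT mule1 ltry.
    - by move=> y; rewrite normc_real.
  rewrite E; split=> //; rewrite big_ord0 -lee_fin.
  apply: le_trans (normc_cintegral I1) _.
  rewrite (eq_integral (cst 1%E)); last by move=> y _; rewrite normc_real.
  by rewrite integral_cst//= diracT mule1.
set F := fun y => _.
have [I1 B1] := IHN (fun i => x (lift ord0 i)).
have I0 := cintegrable_window (x ord0) M0.
have [Ip Ep] := cintegral_prodM I0 I1.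
have FE : F \o @cons_rV R N = (fun p => ((window M p.1)%:C%C * expi (p.1 * x ord0)) *
    ((window_rV M p.2)%:C%C * expi (pairing p.2 (fun i => x (lift ord0 i))))).
  apply/funext => p; rewrite /F /= /window_rV /pairing !big_ord_recl cons_rV0 expiD.
  rewrite mulrACA -(rmorphM (real_complex R)) /=.
  under eq_bigr do rewrite cons_rVS.
  by under [X in expi _ * expi X]eq_bigr do rewrite cons_rVS.
have mF : cmeas F.
  apply: cmeasM; first by apply: cmeas_real; exact: measurable_window_rV.
  by apply: cmeas_expi; apply: measurable_pairing.
have IF : cintegrable (lebesgue_rV N.+1) F.
  by apply: (preserves_cintegrable (preserves_cons R N)) => //; rewrite FE.
split=> //.
rewrite -(preserves_cintegral (preserves_cons R N) IF).
rewrite -[X in cintegral _ X]/(F \o @cons_rV R N) FE Ep normcM big_ord_recl.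
by apply: ler_pM; rewrite ?normc_ge0//; exact: normc_window_fourier.
Qed.

Lemma integrable_window_rV R (M : R) N : 0 < M ->
  (@lebesgue_rV R N).-integrable setT (EFin \o @window_rV R M N).
Proof.
move=> M0; have [[_ I] _] := @window_fourier_rV R M N (fun=> 0) M0.
rewrite (_ : EFin \o _ = (fun y => (normc ((window_rV M y)%:C%C * expi (pairing y (fun=> 0))))%:E))//.
apply/funext => y; rewrite normcM normc_expi mulr1 normc_real//.
exact: window_rV_ge0.
Qed.

Lemma conjcM (R : rcfType) (z w : R[i]) : conjc (z * w) = conjc z * conjc w.
Proof. exact: (rmorphM (@conjc R)). Qed.

Lemma mulc_conjc (R : rcfType) (z : R[i]) : z * conjc z = (normc z ^+ 2)%:C%C.
Proof.
case: z => a b; rewrite sqr_normcE /=; apply/eqP; rewrite eq_complex /=.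
by apply/andP; split; apply/eqP; ring.
Qed.

(** The Fourier transform of g dmu carried to R^N by [Phi]. The measure space is arbitrary because
    three cases are used: the graph of S, the tensor power on matrices, and the ordinary Fourier
    transform of f. *)
Definition extension d (T : measurableType d) R
    (mu : {measure set T -> \bar R}) N (Phi : T -> 'I_N -> R) (g : T -> R[i])
    (y : 'rV[R]_N) : R[i] :=
  cintegral mu (fun x => g x * expi (pairing y (Phi x))).

Lemma cintegrable_wave d (T : measurableType d) R
    (mu : {measure set T -> \bar R}) N (Phi : T -> 'I_N -> R) (g : T -> R[i]) (y : 'rV[R]_N) :
  (forall i, measurable_fun [set: T] (fun x => Phi x i)) -> cintegrable mu g ->
  cintegrable mu (fun x => g x * expi (pairing y (Phi x))).
Proof.
move=> mPhi [mg ig]; apply: (cintegrable_le _ ig).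
  apply: cmeasM => //; apply: cmeas_expi; apply: measurable_pairing => //.
by move=> x; rewrite normcM normc_expi mulr1.
Qed.

(** The square becomes a double integral whose phase is linear in y, ready for the y-integral of the
    window. *)
Lemma sqr_extension d (T : measurableType d) R
    (mu : {sigma_finite_measure set T -> \bar R}) N (Phi : T -> 'I_N -> R) (g : T -> R[i])
    (y : 'rV[R]_N) :
  (forall i, measurable_fun [set: T] (fun x => Phi x i)) -> cintegrable mu g ->
  (normc (extension mu Phi g y) ^+ 2)%:C%C =
  cintegral (mu \x mu)%E (fun p => g p.1 * conjc (g p.2) *
    expi (pairing y (fun i => Phi p.1 i - Phi p.2 i))).
Proof.
move=> mPhi Ig; have Iw := cintegrable_wave y mPhi Ig.
have Ic : cintegrable mu (fun x => conjc (g x * expi (pairing y (Phi x)))).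
  case: Iw => mw iw; split; first exact: cmeas_conjc.
  by under eq_fun do rewrite normc_conjc.
have [_ E] := cintegral_prodM Iw Ic.
rewrite -mulc_conjc {2}/extension -cintegral_conjc// -E.
apply: eq_cintegral => p.
rewrite conjcM conjc_expi mulrACA -expiD; congr (_ * expi _).
by rewrite /pairing -sumrN -big_split; apply: eq_bigr => i _; rewrite mulrBr.
Qed.

Lemma window_boundN R (M x : R) : window_bound M (- x) = window_bound M x.
Proof. by rewrite /window_bound mulrN sqrrN. Qed.

(* Integrating the window first leaves a kernel with bounded marginals: Schur's test. *)
Theorem windowed_plancherel_le d (T : measurableType d) R
    (mu : {sigma_finite_measure set T -> \bar R}) N (Phi : T -> 'I_N -> R) (g : T -> R[i])
    (L C M : R) :
  (forall M c : R, 0 < M -> weights_le L (fun x => window_bound M (x + c))) ->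
  (forall k : 'I_N -> R -> R, (forall i, weights_le L (k i)) ->
    (\int[mu]_x (\prod_(i < N) k i (Phi x i))%:E <= C%:E)%E) ->
  (forall i, measurable_fun [set: T] (fun x => Phi x i)) -> cintegrable mu g -> 0 < M ->
  (\int[lebesgue_rV N]_y (window_rV M y * normc (extension mu Phi g y) ^+ 2)%:E <=
   C%:E * \int[mu]_x (normc (g x) ^+ 2)%:E)%E.
Proof.
move=> hL hC mPhi Ig M0; have [mg ig] := Ig.
pose Psi (p : T * T) (i : 'I_N) := Phi p.1 i - Phi p.2 i.
pose G (p : T * T) := g p.1 * conjc (g p.2).
pose K (q : 'rV[R]_N * (T * T)) : R[i] :=
  (window_rV M q.1)%:C%C * (G q.2 * expi (pairing q.1 (Psi q.2))).
have mPsi i : measurable_fun [set: T * T] (fun p => Psi p i).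
  apply: measurable_funB.
    exact: (measurableT_comp (mPhi i) measurable_fst).
  exact: (measurableT_comp (mPhi i) measurable_snd).
have mG : cmeas G.
  apply: cmeasM; first exact: (cmeas_comp mg measurable_fst).
  by apply: cmeas_conjc; exact: (cmeas_comp mg measurable_snd).
have mK : cmeas K.
  apply: cmeasM.
    apply: cmeas_real; exact: (measurableT_comp (@measurable_window_rV R M N) measurable_fst).
  apply: cmeasM; first exact: (cmeas_comp mG measurable_snd).
  apply: cmeas_expi; apply: measurable_pairing; first exact: measurable_fst.
  by move=> i; exact: (measurableT_comp (mPsi i) measurable_snd).
have iW := @integrable_window_rV R M N M0.
have nG p : normc (G p) = normc (g p.1) * normc (g p.2).
  by rewrite normcM normc_conjc.
have iG : (mu \x mu)%E.-integrable setT (EFin \o (fun p : T * T => normc (G p))).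
  rewrite (_ : (fun p => _) = (fun p : T * T => normc (g p.1) * normc (g p.2))).
    exact: (integrable_prodM (a := fun x => normc (g x)) (b := fun x => normc (g x)) ig ig).
  by apply/funext => p; rewrite nG.
have bK q : normc (K q) <= window_rV M q.1 * normc (G q.2).
  by rewrite !normcM normc_expi mulr1 normc_real// window_rV_ge0.
pose mu2 := prod_sigma_finite mu mu.
have [I1 I2 E12] := @cfubini R _ _ _ _ (lebesgue_rV N) mu2 K _ _ mK iW iG bK.
have IGw y : cintegrable (mu \x mu)%E (fun p => G p * expi (pairing y (Psi p))).
  by apply: (@cintegrable_wave _ _ _ _ _ Psi G) => //; split.
have {}I1 : cintegrable (lebesgue_rV N) (fun y => cintegral (mu \x mu)%E (fun p => K (y, p))) := I1.
have {}I2 : cintegrable (mu \x mu)%E (fun p => cintegral (lebesgue_rV N) (fun y => K (y, p))) := I2.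
have {}E12 : cintegral (lebesgue_rV N) (fun y => cintegral (mu \x mu)%E (fun p => K (y, p))) =
  cintegral (mu \x mu)%E (fun p => cintegral (lebesgue_rV N) (fun y => K (y, p))) := E12.
(* One order of integration: over pairs first, giving back the windowed square of the extension. *)
have E1 : (fun y => cintegral (mu \x mu)%E (fun p => K (y, p))) =
    (fun y => (window_rV M y * normc (extension mu Phi g y) ^+ 2)%:C%C).
  apply/funext => y; rewrite rmorphM/= sqr_extension//.
  by rewrite -cintegralZ.
rewrite E1 in I1 E12.
have IR := cintegrable_Re I1.
have nn y : 0 <= window_rV M y * normc (extension mu Phi g y) ^+ 2.
  by rewrite mulr_ge0 ?window_rV_ge0// sqr_ge0.
(* The other order: integrating over y first leaves a product of window transforms at the phase
   difference, dominated by [KK]. *)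
pose KK (p : T * T) := \prod_(i < N) window_bound M (Psi p i).
have wb0 x : 0 <= window_bound M x.
  by have [_ h _] := hL M 0 M0; have := h x; rewrite addr0.
have KK0 p : 0 <= KK p by exact: prodr_ge0.
have mKK : measurable_fun [set: T * T] KK.
  apply: measurable_prod => i _; have [mw _ _] := hL M 0 M0.
  have := measurableT_comp mw (mPsi i); under [X in measurable_fun _ X -> _]eq_fun do rewrite /= addr0.
  by [].
pose n (x : T) := normc (g x).
have n0 x : 0 <= n x by exact: normc_ge0.
have mn : measurable_fun [set: T] n by exact: measurable_normc.
have C0 : 0 <= C.
  rewrite -lee_fin; apply: le_trans (hC (fun _ => fun x => window_bound M (x + 0)) _).
    by apply: integral_ge0 => x _; rewrite lee_fin prodr_ge0.
  by move=> i; exact: hL.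
have mK1 : measurable_fun [set: T * T] (fun p => (n p.1 ^+ 2 * KK p)%:E).
  apply/measurable_EFinP; apply: measurable_funM => //; apply: measurable_funX.
  exact: (measurableT_comp mn measurable_fst).
have mK2 : measurable_fun [set: T * T] (fun p => (n p.2 ^+ 2 * KK p)%:E).
  apply/measurable_EFinP; apply: measurable_funM => //; apply: measurable_funX.
  exact: (measurableT_comp mn measurable_snd).
have mn2 : measurable_fun [set: T] (fun x => (n x ^+ 2)%:E).
  by apply/measurable_EFinP; exact: measurable_funX.
set S := (\int[mu]_x (n x ^+ 2)%:E)%E.
have A1 : (\int[(mu \x mu)%E]_p (n p.1 ^+ 2 * KK p)%:E <= C%:E * S)%E.
  rewrite (@fubini_tonelli1 _ _ _ _ R mu mu (fun p => (n p.1 ^+ 2 * KK p)%:E))//; last first.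
    by move=> p; rewrite lee_fin mulr_ge0// sqr_ge0.
  rewrite /S -ge0_integralZl//; last by move=> x _; rewrite lee_fin sqr_ge0.
  apply: ge0_le_integral => //.
  - by move=> x _; apply: integral_ge0 => y _; rewrite lee_fin mulr_ge0// sqr_ge0.
  - apply: measurable_fun_fubini_tonelli_F => // p.
    by rewrite lee_fin mulr_ge0// sqr_ge0.
  - exact: emeasurable_funM.
  - move=> x _; rewrite /fubini_F /=.
    under eq_integral do rewrite EFinM.
    rewrite ge0_integralZl//; last 3 first.
    + by apply/measurable_EFinP; exact: (measurableT_comp mKK (measurable_pair1 x)).
    + by move=> y _; rewrite lee_fin.
    + by rewrite lee_fin sqr_ge0.
    rewrite muleC; apply: lee_wpmul2r; first by rewrite lee_fin sqr_ge0.
    (* For fixed x the marginal of [KK] is the hypothesis [hC] for window bounds translated by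
       Phi(x); evenness of [window_bound] reverses the difference. *)
    apply: le_trans (hC (fun i t => window_bound M (t + - Phi x i)) (fun i => hL M _ M0)).
    apply: eqW; apply: eq_integral => y _.
    by congr EFin; apply: eq_bigr => i _; rewrite /Psi /= -window_boundN opprB.
have A2 : (\int[(mu \x mu)%E]_p (n p.2 ^+ 2 * KK p)%:E <= C%:E * S)%E.
  rewrite (@fubini_tonelli2 _ _ _ _ R mu mu (fun p => (n p.2 ^+ 2 * KK p)%:E))//; last first.
    by move=> p; rewrite lee_fin mulr_ge0// sqr_ge0.
  rewrite /S -ge0_integralZl//; last by move=> x _; rewrite lee_fin sqr_ge0.
  apply: ge0_le_integral => //.
  - by move=> x _; apply: integral_ge0 => y _; rewrite lee_fin mulr_ge0// sqr_ge0.
  - apply: measurable_fun_fubini_tonelli_G => // p.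
    by rewrite lee_fin mulr_ge0// sqr_ge0.
  - exact: emeasurable_funM.
  - move=> x _; rewrite /fubini_G /=.
    under eq_integral do rewrite EFinM.
    rewrite ge0_integralZl//; last 3 first.
    + by apply/measurable_EFinP; exact: (measurableT_comp mKK (measurable_pair2 x)).
    + by move=> y _; rewrite lee_fin.
    + by rewrite lee_fin sqr_ge0.
    rewrite muleC; apply: lee_wpmul2r; first by rewrite lee_fin sqr_ge0.
    apply: le_trans (hC (fun i t => window_bound M (t + - Phi x i)) (fun i => hL M _ M0)).
    by [].
rewrite -(@fineK _ (\int[lebesgue_rV N]_y _)%E); last exact: (integrable_fin_num measurableT IR).
have E2 : \int[lebesgue_rV N]_y (window_rV M y * normc (extension mu Phi g y) ^+ 2) <=
    normc (cintegral (mu \x mu)%E (fun p => cintegral (lebesgue_rV N) (fun y => K (y, p)))).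
  rewrite -E12; apply: le_trans (normc_ge_absRe _).
  by apply: le_trans (ler_norm _).
apply: (@le_trans _ _ (normc (cintegral (mu \x mu)%E (fun p => cintegral (lebesgue_rV N) (fun y => K (y, p)))))%:E).
  by rewrite lee_fin.
apply: le_trans (normc_cintegral I2) _.
(* The product of two norms is at most half the sum of their squares, so each half meets one of the
   two marginals. *)
apply: (@le_trans _ _ (\int[(mu \x mu)%E]_p (2^-1%:E * (n p.1 ^+ 2 * KK p)%:E + 2^-1%:E * (n p.2 ^+ 2 * KK p)%:E))%E).
  apply: ge0_le_integral => //.
  - by move=> p _; rewrite lee_fin normc_ge0.
  - by apply/measurable_EFinP; apply: measurable_normc; case: I2.
  - by apply: emeasurable_funD; apply: emeasurable_funM.
  - move=> p _; rewrite -!EFinM -EFinD lee_fin.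
    apply: (@le_trans _ _ (n p.1 * n p.2 * KK p)).
      have [Iw Bw] := window_fourier_rV (Psi p) M0.
      have -> : cintegral (lebesgue_rV N) (fun y => K (y, p)) = cintegral (lebesgue_rV N)
          (fun y => G p * ((window_rV M y)%:C%C * expi (pairing y (Psi p)))).
        by apply: eq_cintegral => y; rewrite /K mulrCA.
      rewrite cintegralZ// normcM nG; apply: ler_wpM2l => //.
      by rewrite mulr_ge0// n0.
    rewrite !mulrA -mulrDl; apply: ler_wpM2r => //.
    have := sqr_ge0 (n p.1 - n p.2); nra.
rewrite ge0_integralD//; last 4 first.
- by move=> p _; rewrite -EFinM lee_fin !mulr_ge0// sqr_ge0.
- exact: emeasurable_funM.
- by move=> p _; rewrite -EFinM lee_fin !mulr_ge0// sqr_ge0.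
- exact: emeasurable_funM.
rewrite !ge0_integralZl//; last 2 first.
- by move=> p _; rewrite lee_fin mulr_ge0// sqr_ge0.
- by move=> p _; rewrite lee_fin mulr_ge0// sqr_ge0.
have -> : (C%:E * S = 2^-1%:E * (C%:E * S) + 2^-1%:E * (C%:E * S))%E.
  have S0 : (0 <= C%:E * S)%E.
    by rewrite mule_ge0// integral_ge0// => x _; rewrite lee_fin sqr_ge0.
  have h : (2^-1 + 2^-1 : R) = 1 by field.
  by rewrite -ge0_muleDl ?lee_fin ?invr_ge0// -EFinD h mul1e.
by apply: leeD; apply: lee_wpmul2l => //; rewrite lee_fin.
Qed.

Lemma window_ge R (M t : R) : 0 < M -> `|t| <= M / 2 -> 3 / 4 <= window M t.
Proof.
move=> M0 tM; rewrite /window ifT; last first.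
  by apply: (le_trans tM); rewrite ler_pdivrMr//; lra.
have h : `|t / M| <= 1 / 2.
  by rewrite normrM normfV (gtr0_norm M0) ler_pdivrMr//; lra.
have := normr_ge0 (t / M); have := real_normK (num_real (t / M)).
move: (`|t / M|) h => u h <- u0; nra.
Qed.

Lemma prodr_ge1 (R : realDomainType) (I : Type) (s : seq I) (P : pred I) (F : I -> R) :
  (forall i, P i -> 1 <= F i) -> 1 <= \prod_(i <- s | P i) F i.
Proof. by move=> h; apply: (big_ind (fun z => 1 <= z)) => // u v; exact: mulr_ege1. Qed.

(** A positive integrable weight of product form, the common majorant for Schwartz functions and
    compactly supported densities. *)
Definition cauchy_weight R N (y : 'rV[R]_N) : R :=
  \prod_(i < N) (1 + y ord0 i ^+ 2)^-1.

Lemma cauchy_weight_gt0 R N (y : 'rV[R]_N) : 0 < cauchy_weight y.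
Proof. by apply: prodr_gt0 => i _; rewrite invr_gt0 ltr_wpDr ?sqr_ge0. Qed.

Lemma measurable_oneDsqrV R : measurable_fun [set: R] (fun t : R => (1 + t ^+ 2)^-1).
Proof.
apply: (measurableT_comp (@measurable_invr R)).
by apply: measurable_funD => //; exact: exprn_measurable.
Qed.

Lemma measurable_cauchy_weight R N :
  measurable_fun [set: 'rV[R]_N] (@cauchy_weight R N).
Proof.
apply: measurable_prod => i _.
exact: (measurableT_comp (@measurable_oneDsqrV R) (measurable_rV_coord i)).
Qed.

Lemma integrable_cauchy_weight R N :
  (@lebesgue_rV R N).-integrable setT (EFin \o @cauchy_weight R N).
Proof.
apply/integrableP; split; first by apply/measurable_EFinP; exact: measurable_cauchy_weight.
rewrite (eq_integral (fun y : 'rV[R]_N => (\prod_(i < N) (1 + y ord0 i ^+ 2)^-1)%:E)); last first.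
  by move=> y _ /=; rewrite gtr0_norm// cauchy_weight_gt0.
rewrite (@ge0_integral_prod_rV R N (fun _ t => (1 + t ^+ 2)^-1)); last 2 first.
- by move=> i; exact: measurable_oneDsqrV.
- by move=> i t; rewrite invr_ge0 addr_ge0// sqr_ge0.
have [A A0 hA] := integral_oneDsqr_le R.
have D (t : R) : 0 <= (1 + t ^+ 2)^-1 by rewrite invr_ge0 addr_ge0// sqr_ge0.
apply: (@le_lt_trans _ _ (\prod_(i < N) A%:E)%E); last by rewrite prodEFin ltry.
apply: lee_prod => i _; apply/andP; split.
  by apply: integral_ge0 => t _; rewrite lee_fin.
apply: le_trans hA; apply: ge0_le_integral => //.
- by move=> t _; rewrite lee_fin.
- by apply/measurable_EFinP; exact: measurable_oneDsqrV.
- apply/measurable_EFinP; apply: measurable_funM => //; exact: measurable_oneDsqrV.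
- by move=> t _; rewrite lee_fin ler_peMl// ler1n.
Qed.

(** The integrand is not integrable in y. Multiplying by [cauchy_weight] makes Fubini applicable,
    which yields measurability of the partial integral, and the positive weight is then divided
    out. *)
Lemma measurable_extension d (T : measurableType d) R
    (mu : {sigma_finite_measure set T -> \bar R}) N (Phi : T -> 'I_N -> R) (g : T -> R[i]) :
  (forall i, measurable_fun [set: T] (fun x => Phi x i)) -> cintegrable mu g ->
  cmeas (extension mu Phi g).
Proof.
move=> mPhi Ig; have [mg ig] := Ig.
pose K (q : 'rV[R]_N * T) : R[i] :=
  (cauchy_weight q.1)%:C%C * (g q.2 * expi (pairing q.1 (Phi q.2))).
have mK : cmeas K.
  apply: cmeasM.
    by apply: cmeas_real; exact: (measurableT_comp (@measurable_cauchy_weight R N) measurable_fst).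
  apply: cmeasM; first exact: (cmeas_comp mg measurable_snd).
  apply: cmeas_expi; apply: measurable_pairing; first exact: measurable_fst.
  by move=> i; exact: (measurableT_comp (mPhi i) measurable_snd).
have bK q : normc (K q) <= cauchy_weight q.1 * normc (g q.2).
  by rewrite !normcM normc_expi mulr1 normc_real// ltW// cauchy_weight_gt0.
have [[mI _] _ _] := @cfubini R _ _ _ _ (lebesgue_rV N) mu K _ _ mK (@integrable_cauchy_weight R N) ig bK.
have E y : extension mu Phi g y =
    ((cauchy_weight y)^-1)%:C%C * cintegral mu (fun x => K (y, x)).
  rewrite -[cintegral mu _]/(cintegral mu (fun x => (cauchy_weight y)%:C%C *
    (g x * expi (pairing y (Phi x))))) cintegralZ; last exact: cintegrable_wave.
  by rewrite mulrA -(rmorphM (real_complex R)) mulVf ?mul1r// gt_eqF// cauchy_weight_gt0.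
have -> := funext E; apply: cmeasM => //; apply: cmeas_real.
exact: (measurableT_comp (@measurable_invr R) (@measurable_cauchy_weight R N)).
Qed.

Definition cube R n (r : R) : set 'rV[R]_n :=
  [set x | forall i, `[- r, r]%classic (x ord0 i)].

Lemma measurable_cube R n (r : R) : measurable (@cube R n r).
Proof. by apply: (measurable_box (A := fun=> `[- r, r]%classic)) => i; exact: measurable_itv. Qed.

(* The windows only cost the factor (4/3)^N: on the boxes |y_i| <= M / 2, which exhaust the space, each of them is at least 3/4. *)
Theorem plancherel_le d (T : measurableType d) R
    (mu : {sigma_finite_measure set T -> \bar R}) N (Phi : T -> 'I_N -> R) (g : T -> R[i])
    (L C : R) :
  (forall M c : R, 0 < M -> weights_le L (fun x => window_bound M (x + c))) ->
  (forall k : 'I_N -> R -> R, (forall i, weights_le L (k i)) ->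
    (\int[mu]_x (\prod_(i < N) k i (Phi x i))%:E <= C%:E)%E) ->
  (forall i, measurable_fun [set: T] (fun x => Phi x i)) -> cintegrable mu g ->
  (\int[lebesgue_rV N]_y (normc (extension mu Phi g y) ^+ 2)%:E <=
   ((4 / 3) ^+ N * C)%:E * \int[mu]_x (normc (g x) ^+ 2)%:E)%E.
Proof.
move=> hL hC mPhi Ig; have mE := measurable_normc (measurable_extension mPhi Ig).
set F := fun y => (normc (extension mu Phi g y) ^+ 2).
have mF : measurable_fun [set: 'rV[R]_N] (EFin \o F).
  by apply/measurable_EFinP; exact: measurable_funX.
pose D (m : nat) := @cube R N m%:R.
have mD m : measurable (D m) by exact: measurable_cube.
have DT : [set: 'rV[R]_N] = \bigcup_m D m.
  apply/seteqP; split=> // y _.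
  have [m hm] := rV_bounded y.
  by exists m => // i; rewrite /= in_itv/= -ler_norml.
have ndD : nondecreasing_seq D.
  move=> m1 m2 m12; apply/subsetPset => y Dy i; move: (Dy i).
  rewrite /= !in_itv/= -!ler_norml => h; apply: (le_trans h).
  by rewrite ler_nat.
have F0 y : 0 <= F y by exact: sqr_ge0.
(* Monotone convergence along the cubes [D m]: it is enough to bound each of them by the same
   constant. *)
have := @ge0_nondecreasing_set_cvg_integral _ _ R D (EFin \o F) (lebesgue_rV N) ndD mD.
rewrite -DT => cv.
refine (cvge_to_le (cv _ _) _) => [i|i x _|].
- exact: measurable_funTS.
- by rewrite lee_fin.
- apply: nearW => m.
  (* Half of M is m + 1, so [D m] lies where the windows are at least 3/4, and M is positive also
     for m = 0. *)
  pose M : R := 2 * m.+1%:R.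
  have M0 : 0 < M by rewrite mulr_gt0// ltr0n.
  have W : (\int[lebesgue_rV N]_y (window_rV M y * F y)%:E <=
      C%:E * \int[mu]_x (normc (g x) ^+ 2)%:E)%E.
    exact: (windowed_plancherel_le hL hC mPhi Ig M0).
  rewrite EFinM -muleA; apply: le_trans (lee_wpmul2l _ W); last first.
    by rewrite lee_fin exprn_ge0// divr_ge0.
  have mWF : measurable_fun [set: 'rV[R]_N] (fun y => (window_rV M y * F y)%:E).
    apply/measurable_EFinP; apply: measurable_funM; first exact: measurable_window_rV.
    exact/measurable_EFinP.
  have WF0 y : 0 <= window_rV M y * F y by rewrite mulr_ge0// window_rV_ge0.
  rewrite -ge0_integralZl//; last by move=> y _; rewrite lee_fin.
  apply: (@le_trans _ _ (\int[lebesgue_rV N]_(y in D m) (((4 / 3) ^+ N)%:E * (window_rV M y * F y)%:E))%E).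
    apply: ge0_le_integral => //.
    + by move=> y _; rewrite lee_fin.
    + exact: measurable_funTS.
    + by apply: measurable_funTS; exact: emeasurable_funM.
    + move=> y Dy; rewrite -EFinM lee_fin mulrA ler_peMl//.
      have -> : (4 / 3 : R) ^+ N = \prod_(i < N) (4 / 3) by rewrite prodr_const card_ord.
      rewrite /window_rV -big_split /=.
      apply: prodr_ge1 => i _.
      have h : 3 / 4 <= window M (y ord0 i).
        apply: window_ge => //; move: (Dy i); rewrite /= in_itv/= -ler_norml => h.
        apply: (le_trans h); rewrite /M mulrAC divff// mul1r ler_nat; exact: leqnSn.
      by move: h; lra.
  apply: ge0_subset_integral => //.
  + by exact: emeasurable_funM.
  + by move=> y _; rewrite -EFinM lee_fin mulr_ge0// exprn_ge0// divr_ge0.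
Qed.

(** * The extension estimate *)

Lemma measurable_row R m n (p : 'I_m) :
  measurable_fun [set: 'rV[R]_(m * n)] (fun z => row p (vec_mx z)).
Proof.
apply/measurable_fun_rVP => j; under eq_fun do rewrite mxE.
exact: measurable_vec_mx.
Qed.

Lemma row_row_split0 (R : Type) m n (p : 'rV[R]_n * 'rV[R]_(m * n)) :
  row ord0 (vec_mx (row_split p)) = p.1.
Proof. by rewrite /row_split mxvecK; apply/rowP => j; rewrite mxE col_mx_ord0. Qed.

Lemma row_row_split_lift (R : Type) m n (p : 'rV[R]_n * 'rV[R]_(m * n)) q :
  row (lift ord0 q) (vec_mx (row_split p)) = row q (vec_mx p.2).
Proof.
rewrite /row_split mxvecK; apply/rowP => j.
by rewrite [LHS]mxE [RHS]mxE col_mx_lift.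
Qed.

Lemma cmeas_prod d (T : measurableType d) R (I : Type) (s : seq I) (f : I -> T -> R[i]) :
  (forall i, cmeas (f i)) -> cmeas (fun x => \prod_(i <- s) f i x).
Proof.
move=> mf; elim: s => [|i s IHs].
  by under eq_fun do rewrite big_nil; apply: (cmeas_real (f := fun=> 1)); exact: measurable_cst.
by under eq_fun do rewrite big_cons; exact: cmeasM.
Qed.

Lemma cintegral_prod_rows R m n (h : 'rV[R]_n -> R[i]) :
  cintegrable (lebesgue_rV n) h ->
  cintegrable (lebesgue_rV (m * n)) (fun z => \prod_(p < m) h (row p (vec_mx z))) /\
  cintegral (lebesgue_rV (m * n)) (fun z => \prod_(p < m) h (row p (vec_mx z))) =
  cintegral (lebesgue_rV n) h ^+ m.
Proof.
move=> Ih; elim: m => [|m [IHi IHe]].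
  have -> : (fun z : 'rV[R]_(0 * n) => \prod_(p < 0) h (row p (vec_mx z))) = (fun=> 1%:C%C).
    by apply/funext => z; rewrite big_ord0.
  split.
    split; first by apply: cmeas_real; exact: measurable_cst.
    apply/integrableP; split; first exact: measurable_cst.
    rewrite (eq_integral (cst 1%E)); last by move=> y _; rewrite normc_real//= normr1.
    by rewrite integral_cst//= diracT mule1 ltry.
  have J (c : R) : (\int[lebesgue_rV (0 * n)]_x c%:E = c%:E)%E.
    by rewrite integral_cst//= diracT mule1.
  by rewrite expr0 /cintegral /Rintegral /= !J.
have mF : cmeas (fun z : 'rV[R]_(m.+1 * n) => \prod_(p < m.+1) h (row p (vec_mx z))).
  apply: cmeas_prod => p; exact: (cmeas_comp (proj1 Ih) (measurable_row p)).
have [Ip Ep] := cintegral_prodM Ih IHi.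
have FE : (fun z : 'rV[R]_(m.+1 * n) => \prod_(p < m.+1) h (row p (vec_mx z))) \o
    @row_split R m n = (fun p => h p.1 * \prod_(q < m) h (row q (vec_mx p.2))).
  apply/funext => p /=; rewrite big_ord_recl row_row_split0; congr (_ * _).
  by apply: eq_bigr => q _; rewrite row_row_split_lift.
have IF : cintegrable (lebesgue_rV (m.+1 * n)) (fun z => \prod_(p < m.+1) h (row p (vec_mx z))).
  by apply: (preserves_cintegrable (@preserves_row_split R m n)) => //; rewrite FE.
split=> //; rewrite -(preserves_cintegral (@preserves_row_split R m n) IF).
by rewrite exprS -IHe -Ep -FE.
Qed.

Lemma expi_sum R (I : Type) (s : seq I) (t : I -> R) :
  expi (\sum_(i <- s) t i) = \prod_(i <- s) expi (t i).
Proof.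
elim: s => [|i s IHs]; last by rewrite !big_cons expiD IHs.
by rewrite !big_nil /expi cos0 sin0.
Qed.

(** The m-th power of an integral is an integral over m independent rows, and the phases of the
    factors add up. *)
Lemma extension_power R m n N (Phi : 'rV[R]_n -> 'I_N -> R)
    (g : 'rV[R]_n -> R[i]) (y : 'rV[R]_N) :
  (forall i, measurable_fun [set: 'rV[R]_n] (fun x => Phi x i)) ->
  cintegrable (lebesgue_rV n) g ->
  extension (lebesgue_rV (m * n)) (fun z i => \sum_(p < m) Phi (row p (vec_mx z)) i)
    (fun z => \prod_(p < m) g (row p (vec_mx z))) y =
  extension (lebesgue_rV n) Phi g y ^+ m.
Proof.
move=> mPhi Ig; have Iw := cintegrable_wave y mPhi Ig.
have [_ <-] := cintegral_prod_rows m Iw.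
apply: eq_cintegral => z; rewrite big_split /= -expi_sum; congr (_ * expi _).
rewrite /pairing exchange_big /=; apply: eq_bigr => i _.
by rewrite mulr_sumr.
Qed.

Lemma normc1 (R : rcfType) : normc (1 : R[i]) = 1.
Proof. exact: (@normc_real R 1). Qed.

Lemma normcX (R : rcfType) (z : R[i]) m : normc (z ^+ m) = normc z ^+ m.
Proof. by elim: m => [|m IHm]; rewrite ?expr0 ?normc1// !exprS normcM IHm. Qed.

Lemma normc_prod (R : rcfType) (I : Type) (s : seq I) (z : I -> R[i]) :
  normc (\prod_(i <- s) z i) = \prod_(i <- s) normc (z i).
Proof.
by elim: s => [|i s IHs]; rewrite ?big_nil ?normc1// !big_cons normcM IHs.
Qed.

(** The exponent of x_i x_j as a sum of two unit vectors; i <= j selects one representative of each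
    unordered pair. *)
Definition pair_index n (p : 'I_n * 'I_n) : {ffun 'I_n -> nat} :=
  [ffun q => (q == p.1) + (q == p.2)]%N.

Lemma pair_index_inj n (p q : 'I_n * 'I_n) : (p.1 <= p.2)%N -> (q.1 <= q.2)%N ->
  pair_index p = pair_index q -> p = q.
Proof.
case: p q => [i i'] [k k'] /= ii kk /ffunP E.
have := E i; have := E i'; have := E k; have := E k'; rewrite !ffunE /= !eqxx.
rewrite -!val_eqE /= => h1 h2 h3 h4.
by congr pair; apply/val_inj => /=; lia.
Qed.

Lemma pair_index_degree n (p : 'I_n * 'I_n) : (\sum_(i < n) pair_index p i = 2)%N.
Proof.
have h k : (\sum_(i < n) (i == k) = 1)%N.
  by rewrite (bigD1 k)//= eqxx big1// => i /negbTE ->.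
by under eq_bigr do rewrite ffunE; rewrite big_split /= !h.
Qed.

(** A positive entry is lowered by one, twice, after which the weight is 0; the two positions, put
    in order, form the pair. *)
Lemma degree2_pair_index n (m : {ffun 'I_n -> nat}) : (\sum_(i < n) m i = 2)%N ->
  exists p : 'I_n * 'I_n, (p.1 <= p.2)%N /\ m = pair_index p.
Proof.
have pos (f : 'I_n -> nat) : (0 < \sum_(i < n) f i)%N -> exists i, (0 < f i)%N.
  move=> f0; apply/existsP; rewrite -[X in is_true X]negbK negb_exists; apply/negP => /forallP h.
  by move: f0; rewrite big1// => i _; apply/eqP; have := h i; rewrite lt0n negbK.
have sub (f : 'I_n -> nat) i : (0 < f i)%N ->
    (\sum_(j < n) f j = (\sum_(j < n) (f j - (j == i))).+1)%N.
  move=> fi; rewrite (bigD1 i)//= [in RHS](bigD1 i)//= eqxx.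
  rewrite (eq_bigr (fun j => f j)); last by [].
  rewrite [in RHS](eq_bigr f); first by lia.
  by move=> j /negbTE ->; rewrite subn0.
move=> m2; have [i mi] : exists i, (0 < m i)%N by apply: pos; rewrite m2.
pose m1 j := (m j - (j == i))%N.
have s1 : (\sum_(j < n) m1 j = 1)%N by have := sub _ _ mi; rewrite m2 => -[].
have [k mk] : exists k, (0 < m1 k)%N by apply: pos; rewrite s1.
have s0 : (\sum_(j < n) (m1 j - (j == k)) = 0)%N by have := sub _ _ mk; rewrite s1 => -[].
have mE j : m j = ((j == i) + (j == k))%N.
  have : (m1 j - (j == k) = 0)%N.
    by apply/eqP; move/eqP: s0; rewrite sum_nat_eq0 => /forallP/(_ j).
  have A : j == i -> (0 < m j)%N by move/eqP ->.
  have B : j == k -> (0 < m j - (j == i))%N by move/eqP ->.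
  rewrite /m1; case: (j == i) A B => A B; case: (j == k) B => B; lia.
have [ik|ki] := leqP i k; [exists (i, k)|exists (k, i)]; split=> //=.
- by apply/ffunP => j; rewrite ffunE mE.
- exact: ltnW.
- by apply/ffunP => j; rewrite ffunE mE addnC.
Qed.

Lemma monomial_pair_index R n (p : 'I_n * 'I_n) (x : 'rV[R]_n) :
  monomial (pair_index p) x = x ord0 p.1 * x ord0 p.2.
Proof.
have h k : \prod_(i < n) x ord0 i ^+ (i == k) = x ord0 k.
  rewrite (bigD1 k)//= eqxx expr1 big1 ?mulr1// => i /negbTE ->.
  by rewrite expr0.
by rewrite /monomial; under eq_bigr do rewrite ffunE exprD; rewrite big_split /= !h.
Qed.

(** The l monomials are matched with the entries on and above the diagonal, the index set of
    [gram_prod]; the order in which [a] lists them disappears here. *)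
Lemma prod_enumerates_degree2 (V : comPzSemiRingType) n l (a : 'I_l -> {ffun 'I_n -> nat})
    (F : {ffun 'I_n -> nat} -> V) : enumerates_degree2 a ->
  \prod_(j < l) F (a j) =
  \prod_(i < n) \prod_(i' < n | (i <= i')%N) F (pair_index (i, i')).
Proof.
move=> [ia ha]; rewrite pair_big_dep /=.
(* [h] picks the ordered pair of each listed monomial; its partial inverse searches for the position
   of a pair in the list. *)
have [h hP] : exists h : 'I_l -> 'I_n * 'I_n,
    forall j, ((h j).1 <= (h j).2)%N /\ a j = pair_index (h j).
  apply: (@fin_all_exists 'I_l (fun=> ('I_n * 'I_n)%type)
    (fun j p => (p.1 <= p.2)%N /\ a j = pair_index p)) => j; apply: degree2_pair_index.
  by apply/ha; exists j.
rewrite (reindex_omap h (fun p => [pick j | a j == pair_index p])) /=; last first.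
  move=> [i i'] /= ii; case: pickP => [j /eqP aj|no] /=.
    by congr Some; apply: pair_index_inj; [case: (hP j)| |rewrite -aj; case: (hP j)].
  have [j aj] := (ha (pair_index (i, i'))).1 (pair_index_degree _).
  by have := no j; rewrite aj eqxx.
apply: eq_big => j; last by move=> _; case: (hP j) => _ ->; case: (h j).
case: (hP j) => -> aj; apply/esym; rewrite /=; case: pickP => [k|/(_ j)]; last by rewrite aj eqxx.
by rewrite -aj => /eqP/ia ->; rewrite eqxx.
Qed.

(** Summed over the n + 2 points, the linear coordinates of the graph are row sums and the quadratic
    ones are Gram entries, so [gram_bound_density] applies. *)
Lemma graph_density R (n l : nat) (a : 'I_l -> {ffun 'I_n -> nat}) (L : R) :
  enumerates_degree2 a -> 0 <= L ->
  exists C : R, forall k : 'I_(n + l) -> R -> R, (forall i, weights_le L (k i)) ->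
  (\int[lebesgue_rV (n.+2 * n)]_z
     (\prod_(i < n + l) k i (\sum_(p < n.+2) graph_map a (row p (vec_mx z)) ord0 i))%:E <=
   C%:E)%E.
Proof.
move=> ea L0; have [C hC] := gram_bound_density n L; exists C => k hk.
have w0 : weights_le L (fun=> 0).
  by split=> //; rewrite integral0.
(* Weights must exist at all natural indices. Where there is no coordinate the zero weight is used,
   admissible because 0 <= L. *)
pose h (i : nat) : R -> R := if insub i is Some i' then k (lshift l i') else fun=> 0.
pose kk (i i' : nat) : R -> R :=
  if [pick j | [exists p : 'I_n * 'I_n,
    [&& (p.1 : nat) == i, (p.2 : nat) == i' & a j == pair_index p]]] is Some j
  then k (rshift n j) else fun=> 0.
have hh i : weights_le L (h i) by rewrite /h; case: insub.
have hkk i i' : weights_le L (kk i i') by rewrite /kk; case: pickP.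
apply: le_trans (hC h kk hh hkk).
pose F (w : 'rV[R]_(n * n.+2)) : R := (\prod_(i < n) h i (\sum_(p < n.+2) vec_mx w i p)) * gram_prod kk w.
have F0 w : 0 <= F w.
  by rewrite mulr_ge0 ?(gram_prod_ge0 (L := L))//; apply: prodr_ge0 => i _; case: (hh i).
have mF : measurable_fun [set: 'rV[R]_(n * n.+2)] F.
  apply: measurable_funM; last exact: measurable_gram_prod hkk.
  apply: measurable_prod => i _; have [mh _ _] := hh i.
  by apply: (measurableT_comp mh); apply: measurable_sum => p; exact: measurable_vec_mx.
(* Transposition turns the n + 2 points of R^n, stored as rows, into n rows of length n + 2. *)
rewrite -[leRHS](@preserves_ge0_integral R _ _ _ _ (lebesgue_rV (n.+2 * n)) (lebesgue_rV (n * n.+2))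
  _ (fun w => (F w)%:E) (@preserves_trmx R n.+2 n)); last 2 first.
- exact/measurable_EFinP.
- by move=> w; rewrite lee_fin.
apply: eqW; apply: eq_integral => z _; congr EFin.
rewrite big_split_ord /F /gram_prod !mxvecK; congr (_ * _).
  apply: eq_bigr => i _; rewrite /h insubT//= => hi; congr (k (lshift l _) _); first exact/val_inj.
  by apply: eq_bigr => p _; rewrite /graph_map row_mxEl !mxE.
(* Each factor is rewritten as a function of the multi-index [a j] alone, the form that
   [prod_enumerates_degree2] can reindex. *)
transitivity (\prod_(j < l) (fun m => if [pick j | a j == m] is Some j then
    k (rshift n j) (\sum_(p < n.+2) monomial m (row p (vec_mx z))) else 0) (a j)).
  apply: eq_bigr => j _; case: pickP => [j' /eqP/(proj1 ea) ->|/(_ j)]; last by rewrite eqxx.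
  by congr (k _ _); apply: eq_bigr => p _; rewrite /graph_map row_mxEr !mxE.
rewrite (prod_enumerates_degree2 (fun m => if [pick j | a j == m] is Some j then
    k (rshift n j) (\sum_(p < n.+2) monomial m (row p (vec_mx z))) else 0))//.
apply: eq_bigr => i _; apply: eq_bigr => i' ii.
rewrite /kk; case: pickP => [j /eqP aj|no].
  case: pickP => [j' /existsP[[q q'] /and3P[/= /eqP/val_inj -> /eqP/val_inj ->]]|/(_ j)].
    move=> /eqP aj'; rewrite (proj1 ea j' j) ?aj' ?aj//; congr (k _ _); rewrite mxE; apply: eq_bigr => p _.
    by rewrite monomial_pair_index !mxE.
  move=> E; have : [exists p : 'I_n * 'I_n, [&& (p.1 : nat) == i, (p.2 : nat) == i' & a j == pair_index p]].
    by apply/existsP; exists (i, i'); rewrite /= !eqxx aj eqxx.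
  by rewrite E.
have [j aj] := ((proj2 ea) (pair_index (i, i'))).1 (pair_index_degree _).
by have := no j; rewrite aj eqxx.
Qed.

Lemma measurable_monomial R n (m : {ffun 'I_n -> nat}) :
  measurable_fun [set: 'rV[R]_n] (monomial m).
Proof.
by apply: measurable_prod => i _; apply: measurable_funX; exact: measurable_rV_coord.
Qed.

Lemma measurable_graph_map R n l (a : 'I_l -> {ffun 'I_n -> nat}) i :
  measurable_fun [set: 'rV[R]_n] (fun x => graph_map a x ord0 i).
Proof.
rewrite /graph_map; case: (split_ordP i) => j -> {i}.
  by under eq_fun do rewrite row_mxEl; exact: measurable_rV_coord.
by under eq_fun do rewrite row_mxEr mxE; exact: measurable_monomial.
Qed.

Theorem extension_estimate R (n l : nat) (a : 'I_l -> {ffun 'I_n -> nat}) :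
  enumerates_degree2 a -> exists C : R, forall g : 'rV[R]_n -> R[i],
  cintegrable (lebesgue_rV n) g ->
  (lebesgue_rV n).-integrable setT (fun x => (normc (g x) ^+ 2)%:E) ->
  (\int[lebesgue_rV (n + l)]_y (normc (extension (lebesgue_rV n)
      (fun x => graph_map a x ord0) g y) ^+ (2 * n.+2)%N)%:E <=
   C%:E * (\int[lebesgue_rV n]_x (normc (g x) ^+ 2)%:E) ^+ n.+2)%E.
Proof.
move=> ea; have [L L0 hL] := weights_window_bound R.
have [C hC] := graph_density ea L0; exists ((4 / 3) ^+ (n + l) * C) => g Ig Ig2.
have mg := measurable_graph_map (R := R) a.
pose gk (z : 'rV[R]_(n.+2 * n)) := \prod_(p < n.+2) g (row p (vec_mx z)).
have [Igk _] := cintegral_prod_rows n.+2 Ig.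
have mP i : measurable_fun [set: 'rV[R]_(n.+2 * n)]
    (fun z => \sum_(p < n.+2) graph_map a (row p (vec_mx z)) ord0 i).
  by apply: measurable_sum => p; exact: (measurableT_comp (mg i) (measurable_row p)).
have := @plancherel_le _ _ R (lebesgue_rV (n.+2 * n)) (n + l)
   (fun z i => \sum_(p < n.+2) graph_map a (row p (vec_mx z)) ord0 i) gk L C hL hC mP Igk.
have -> : (fun y => (normc (extension (lebesgue_rV (n.+2 * n))
     (fun z i => \sum_(p < n.+2) graph_map a (row p (vec_mx z)) ord0 i) gk y) ^+ 2)%:E) =
   (fun y => (normc (extension (lebesgue_rV n)
      (fun x => graph_map a x ord0) g y) ^+ (2 * n.+2)%N)%:E).
  by apply/funext => y; rewrite /gk (extension_power n.+2 _ mg Ig) normcX -exprM mulnC.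
move=> h; apply: (le_trans h); apply: eqW; congr (_ * _)%E.
(* The squared L^2 norm of the tensor power is the (n + 2)-th power of that of g: the product
   formula over rows is reused for |g|^2 viewed as complex-valued. *)
pose s2 x := (normc (g x) ^+ 2)%:C%C.
have Is : cintegrable (lebesgue_rV n) s2.
  split; last by under eq_fun do rewrite normc_real ?sqr_ge0//.
  by apply: cmeas_real; apply/measurable_EFinP; exact: (measurable_int _ Ig2).
have cR N (f : 'rV[R]_N -> R) : cintegral (lebesgue_rV N) (fun x => (f x)%:C%C) =
    (\int[lebesgue_rV N]_x f x)%:C%C.
  by rewrite /cintegral /=; congr Complex; rewrite /Rintegral integral0.
have [Ip] := cintegral_prod_rows n.+2 Is.
have E : (fun z : 'rV[R]_(n.+2 * n) => \prod_(p < n.+2) s2 (row p (vec_mx z))) =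
    (fun z => (normc (gk z) ^+ 2)%:C%C).
  apply/funext => z; rewrite /gk normc_prod -prodrXl rmorph_prod //.
rewrite E in Ip *.
rewrite !cR -rmorphXn => -[] Ee.
have F : (lebesgue_rV (n.+2 * n)).-integrable setT (EFin \o (fun z => normc (gk z) ^+ 2)).
  exact: (cintegrable_Re Ip).
rewrite -(fineK (integrable_fin_num measurableT F)) -[X in X%:E]/(\int[_]_x _) Ee.
by rewrite -(fineK (integrable_fin_num measurableT Ig2)) -EFin_expe.
Qed.

(** * Schwartz functions and densities *)

(** The sigma-algebra is defined by coordinates, not by open sets. A continuous f is the limit of
    its compositions with rounding to the grid of mesh 1 / (m + 1), each of which takes countably
    many values, on boxes. *)
Lemma continuous_rV_measurable R n (f : 'rV[R]_n -> R) :
  continuous f -> measurable_fun [set: 'rV[R]_n] f.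
Proof.
move=> cf.
pose rnd (m : nat) (x : 'rV[R]_n) : 'rV[int]_n := \row_i Num.floor (x ord0 i * m.+1%:R).
pose emb (m : nat) (v : 'rV[int]_n) : 'rV[R]_n := \row_i ((v ord0 i)%:~R / m.+1%:R).
have mr m v : measurable [set x | rnd m x = v].
  rewrite (_ : mkset _ = [set x : 'rV[R]_n | forall i,
      [set t : R | Num.floor (t * m.+1%:R) = v ord0 i] (x ord0 i)]).
    apply: (@measurable_box R n (fun i => [set t : R | Num.floor (t * m.+1%:R) = v ord0 i])) => i.
    rewrite (_ : mkset _ = `[(v ord0 i)%:~R / m.+1%:R, (v ord0 i + 1)%:~R / m.+1%:R[%classic).
      exact: measurable_itv.
    apply/seteqP; split=> t /=; rewrite in_itv/= ler_pdivrMr ?ltr0n// ltr_pdivlMr ?ltr0n//.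
      by move=> <-; rewrite ge_floor lt_succ_floor.
    by move=> h; apply/eqP; rewrite floor_eq.
  apply/seteqP; split=> x /=; first by move=> <- i; rewrite mxE.
  by move=> h; apply/rowP => i; rewrite mxE h.
apply: (@measurable_fun_cvg _ _ _ _ (fun m x => f (emb m (rnd m x)))).
  move=> m _ Y mY; rewrite setTI.
  rewrite (_ : _ @^-1` _ = \bigcup_(k in [set k | if unpickle k is Some v then Y (f (emb m v)) else False])
     (if unpickle k is Some v then [set x | rnd m x = v] else set0)).
    by apply: bigcup_measurable => k _; case: unpickle.
  apply/seteqP; split=> x /=.
    by move=> Yx; exists (pickle (rnd m x)); rewrite /= pickleK.
  by move=> [k /=]; case: unpickle => // v Yv /= ->.
move=> x _; apply: (continuous_cvg _ (cf x)).
apply/cvg_ballP => e e0; near=> m; split=> //= i j; rewrite !ord1 !mxE /ball /=.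
set t := x ord0 j; have m0 : 0 < m.+1%:R :> R by rewrite ltr0n.
have /andP[h1 h2] := floor_itv (t * m.+1%:R).
have -> : t - (Num.floor (t * m.+1%:R))%:~R / m.+1%:R =
    (t * m.+1%:R - (Num.floor (t * m.+1%:R))%:~R) / m.+1%:R.
  by rewrite mulrBl mulfK// gt_eqF.
rewrite ger0_norm; last by rewrite divr_ge0 ?subr_ge0// ltW.
apply: (@lt_trans _ _ (m.+1%:R^-1)); last by near: m; exact: (near_infty_natSinv_lt (PosNum e0)).
rewrite -[ltRHS]mul1r ltr_pM2r ?invr_gt0// ltrBlDl.
by move: h2; rewrite intrD.
Unshelve. all: by end_near.
Qed.

Lemma prod_oneDsqr R n (x : 'rV[R]_n) :
  \prod_(i < n) (1 + x ord0 i ^+ 2) =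
  \sum_(J in {set 'I_n}) monomial [ffun i => if i \in J then 0%N else 2%N] x.
Proof.
rewrite bigA_distr; apply: eq_bigr => J _; apply: eq_bigr => i _.
by rewrite ffunE; case: ifP; rewrite ?expr0.
Qed.

Lemma prod_oneDsqr_ge1 R n (x : 'rV[R]_n) :
  1 <= \prod_(i < n) (1 + x ord0 i ^+ 2).
Proof. by apply: prodr_ge1 => i _; rewrite lerDl sqr_ge0. Qed.

Lemma cauchy_weightE R n (x : 'rV[R]_n) :
  cauchy_weight x = (\prod_(i < n) (1 + x ord0 i ^+ 2))^-1.
Proof. by rewrite /cauchy_weight prodfV. Qed.

Lemma cauchy_weight_le1 R n (x : 'rV[R]_n) : cauchy_weight x <= 1.
Proof.
rewrite /cauchy_weight; apply: prodr_ile1 => i _.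
have h : 1 <= 1 + x ord0 i ^+ 2 by rewrite lerDl sqr_ge0.
by rewrite invr_ge0 (le_trans ler01 h) invf_le1 // (lt_le_trans ltr01 h).
Qed.

(** Multiplying f by the product of the 1 + x_i^2 and expanding gives finitely many monomials with
    exponents 0 and 2, each bounded against f by a seminorm without derivatives. *)
Lemma schwartz_real_le R n (f : 'rV[R]_n -> R) : schwartz_real f ->
  exists B, forall x, `|f x| <= B * cauchy_weight x.
Proof.
move=> [_ h].
have [B hB] : exists B : {set 'I_n} -> R, forall (J : {set 'I_n}) x,
    `|monomial [ffun i => if i \in J then 0%N else 2%N] x * f x| <= B J.
  apply: (@fin_all_exists {set 'I_n} (fun=> R) (fun J B => forall x : 'rV[R]_n,
    `|monomial [ffun i => if i \in J then 0%N else 2%N] x * f x| <= B)) => J.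
  exact: (h _ [::]).
exists (\sum_(J in {set 'I_n}) B J) => x.
have P0 := lt_le_trans ltr01 (prod_oneDsqr_ge1 x).
rewrite cauchy_weightE ler_pdivlMr// -[X in _ * X]gtr0_norm// -normrM prod_oneDsqr mulr_sumr.
apply: le_trans (ler_norm_sum _ _ _) _; apply: ler_sum => J _.
by rewrite mulrC.
Qed.

Lemma schwartz_le R n (f : 'rV[R]_n -> R[i]) : schwartz f ->
  exists B, forall x, normc (f x) <= B * cauchy_weight x.
Proof.
move=> [/schwartz_real_le[B1 h1] /schwartz_real_le[B2 h2]]; exists (B1 + B2) => x.
apply: le_trans (normc_le_add _) _.
by rewrite mulrDl; apply: lerD.
Qed.

Lemma schwartz_cmeas R n (f : 'rV[R]_n -> R[i]) : schwartz f -> cmeas f.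
Proof.
by move=> [[h1 _] [h2 _]]; split; apply: continuous_rV_measurable;
  [case: (h1 [::])|case: (h2 [::])].
Qed.

Lemma integrableZ_cauchy_weight R n (B : R) :
  (@lebesgue_rV R n).-integrable setT (EFin \o (fun x => B * cauchy_weight x)).
Proof.
exact/integrable_scale/integrable_cauchy_weight.
Qed.

Lemma schwartz_cintegrable R n (f : 'rV[R]_n -> R[i]) : schwartz f ->
  cintegrable (lebesgue_rV n) f.
Proof.
move=> sf; have [B hB] := schwartz_le sf.
exact: (cintegrable_le (schwartz_cmeas sf) (integrableZ_cauchy_weight n B)).
Qed.

(** On the compact support psi is bounded and all |x_i| <= M1, so [cauchy_weight] is at least (1 +
    M1^2)^-n there. *)
Lemma smooth_density_le R n (psi : 'rV[R]_n -> R) : smooth_density psi ->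
  exists2 B, 0 < B & forall x, psi x <= B * cauchy_weight x.
Proof.
move=> [sm cs psi0]; set K := closure [set x | psi x != 0].
have {}cs : compact K by [].
have cpsi : continuous psi by case: (sm [::]).
have [M [_ hM]] := compact_bounded cs.
have cK : {within K, continuous psi} by exact: continuous_subspaceT.
have [B [_ hB]] := compact_bounded (continuous_compact cK cs).
pose M1 := `|M| + 1; pose B1 := `|B| + 1.
have KM x : K x -> `|x| <= M1 by move=> Kx; apply: hM => //; rewrite ltr_pwDr// ler_norm.
have KB x : K x -> `|psi x| <= B1.
  by move=> Kx; apply: (hB B1); [rewrite ltr_pwDr// ler_norm|exists x].
have B10 : 0 < B1 by rewrite ltr_pwDr.
exists (B1 * (1 + M1 ^+ 2) ^+ n).
  by rewrite mulr_gt0// exprn_gt0// ltr_wpDr ?sqr_ge0.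
move=> x; have [p0|p0] := eqVneq (psi x) 0.
  rewrite p0 mulr_ge0 ?(ltW (cauchy_weight_gt0 _))// mulr_ge0 ?(ltW B10)//.
  by rewrite exprn_ge0// addr_ge0// sqr_ge0.
have Kx : K x by exact: subset_closure.
rewrite -mulrA; apply: (@le_trans _ _ B1).
  by apply: le_trans (ler_norm _) _; exact: KB.
rewrite ler_pMr// cauchy_weightE ler_pdivlMr ?mul1r; last first.
  exact: lt_le_trans ltr01 (prod_oneDsqr_ge1 x).
have -> : (1 + M1 ^+ 2) ^+ n = \prod_(i < n) (1 + M1 ^+ 2) by rewrite prodr_const card_ord.
apply: ler_prod => i _; rewrite addr_ge0 ?sqr_ge0//= lerD2l.
have h : `|x ord0 i| <= M1.
  apply: le_trans (KM x Kx); rewrite [leRHS]mx_normrE.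
  exact: (le_bigmax _ (fun ij => `|x ij.1 ij.2|) (ord0, i)).
by rewrite -[leLHS]real_normK ?num_real// ler_sqr ?nnegrE// (le_trans _ h).
Qed.

(** * The restriction estimate *)

Lemma pairingN R N (y : 'rV[R]_N) (x : 'I_N -> R) :
  pairing (- y) x = - pairing y x.
Proof. by rewrite /pairing -sumrN; apply: eq_bigr => i _; rewrite mxE mulNr. Qed.

Lemma inner_pairing R N (y x : 'rV[R]_N) : inner y x = pairing y (x ord0).
Proof. by []. Qed.

Lemma inner_sym R N (y x : 'rV[R]_N) : inner y x = inner x y.
Proof. by apply: eq_bigr => i _; rewrite mulrC. Qed.

(** The restriction is an [extension] with the identity as phase, evaluated at minus the point of S,
    so measurability and the sup bound come from results already proved. *)
Lemma restriction_fourier R n l (a : 'I_l -> {ffun 'I_n -> nat}) (f : 'rV[R]_(n + l) -> R[i]) x :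
  restriction f (chart a x) =
  extension (lebesgue_rV (n + l)) (fun y => y ord0) f (- graph_map a x).
Proof.
apply: eq_cintegral => y /=; rewrite mulrC pairingN -inner_pairing; congr (_ * expi (- _)).
exact: inner_sym.
Qed.

Lemma cmeas_restriction R n l (a : 'I_l -> {ffun 'I_n -> nat})
    (f : 'rV[R]_(n + l) -> R[i]) : cintegrable (lebesgue_rV (n + l)) f ->
  cmeas (fun x => restriction f (chart a x)).
Proof.
move=> If; under eq_fun do rewrite restriction_fourier.
have mG : measurable_fun [set: 'rV[R]_n] (fun x => - graph_map a x).
  apply/measurable_fun_rVP => i; under eq_fun do rewrite mxE.
  by apply: measurableT_comp => //; exact: measurable_graph_map.
apply: (cmeas_comp _ mG); apply: (measurable_extension (mu := lebesgue_rV (n + l))) => //.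
by move=> i; exact: measurable_rV_coord.
Qed.

Lemma normc_restriction_le R n l (a : 'I_l -> {ffun 'I_n -> nat})
    (f : 'rV[R]_(n + l) -> R[i]) x : cintegrable (lebesgue_rV (n + l)) f ->
  normc (restriction f (chart a x)) <= \int[lebesgue_rV (n + l)]_y normc (f y).
Proof.
move=> If; have If' : cintegrable (lebesgue_rV (n + l)) (fun y => f y * expi (pairing (- graph_map a x) (y ord0))).
  apply: (@cintegrable_wave _ _ R (lebesgue_rV (n + l)) (n + l) (fun y : 'rV[R]_(n + l) => y ord0)) => // i.
  exact: measurable_rV_coord.
rewrite restriction_fourier -lee_fin; apply: le_trans (normc_cintegral If') _.
rewrite EFin_Rintegral; last by case: If.
apply: eqW; apply: eq_integral => y _.
by rewrite normcM normc_expi mulr1.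
Qed.

(** Closes the duality argument by cancelling the square root of the estimated quantity from both
    sides. *)
Lemma le_powR_half R (x y : R) : 0 <= x -> 0 <= y -> x <= y * x `^ 2^-1 -> x `^ 2^-1 <= y.
Proof.
move=> x0 y0; have [->|xn0] := eqVneq x 0; first by rewrite powR0 ?invr_neq0.
have xp : 0 < x by rewrite lt_neqAle eq_sym xn0.
rewrite powR12_sqrt// -{1}(sqr_sqrtr x0) expr2 ler_pM2r// sqrtr_gt0//.
Qed.

(* Duality: |Rf|^2 integrates to the pairing of f with the extension of psi Rf, to which Hoelder and [extension_estimate] apply. *)
Theorem restriction_estimate_graph R (n l : nat) (a : 'I_l -> {ffun 'I_n -> nat}) :
  enumerates_degree2 a ->
  @restriction_estimate R n l a ((2 * (n + 2))%:R / (2 * n + 3)%:R)%:E.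
Proof.
move=> ea psi dpsi; have [C0 hC0] := extension_estimate R ea.
have [B B0 hB] := smooth_density_le dpsi.
have [sm _ psi0] := dpsi.
pose C := `|C0| + 1; set p := _ / _; pose q : R := (2 * n.+2)%:R.
have Cp : 0 < C by rewrite ltr_wpDl.
have q0 : 0 < q by rewrite ltr0n.
have p0 : 0 < p by rewrite divr_gt0 ?ltr0n ?addn_gt0 ?muln_gt0 ?addn_gt0 ?orbT.
(* 1/p = (2n + 3)/(2n + 4) and 1/q = 1/(2n + 4). *)
have pq : p^-1 + q^-1 = 1.
  rewrite /p /q invf_div -[n.+2]addn2 -[X in _ + X]mul1r -mulrDl natr1.
  by rewrite (_ : (2 * n + 3).+1 = 2 * (n + 2))%N ?divff//; lia.
(* The first factor comes from the extension estimate raised to the power 1/q, the second from psi^2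
   <= B psi. *)
exists (C `^ q^-1 * B `^ 2^-1) => f sf.
have If := schwartz_cintegrable sf; have [mf intf] := If.
pose Rf x := restriction f (chart a x).
have mRf : cmeas Rf by exact: cmeas_restriction.
have mpsi : measurable_fun [set: 'rV[R]_n] psi.
  by apply: continuous_rV_measurable; case: (sm [::]).
pose F1 := \int[lebesgue_rV (n + l)]_y normc (f y).
have RF x : normc (Rf x) <= F1 by exact: normc_restriction_le.
have F10 : 0 <= F1 by apply: Rintegral_ge0 => y _; exact: normc_ge0.
have psiB x : psi x <= B.
  by apply: (le_trans (hB x)); rewrite ger_pMr ?cauchy_weight_le1.
pose g x : R[i] := (psi x)%:C%C * Rf x.
have mg : cmeas g by apply: cmeasM => //; exact: cmeas_real.
have ng x : normc (g x) = psi x * normc (Rf x) by rewrite normcM normc_real.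
have Ig : cintegrable (lebesgue_rV n) g.
  apply: (cintegrable_le mg (integrableZ_cauchy_weight n (B * F1))) => x.
  by rewrite ng mulrAC; apply: ler_pM => //; exact: normc_ge0.
have Ic : (lebesgue_rV n).-integrable setT (fun x => (B * F1 ^+ 2 * cauchy_weight x)%:E).
  exact: integrableZ_cauchy_weight.
pose A x := normc (Rf x) ^+ 2 * psi x.
have A0 x : 0 <= A x by rewrite mulr_ge0 ?sqr_ge0.
have mA : measurable_fun [set: 'rV[R]_n] A.
  by apply: measurable_funM => //; apply: measurable_funX; exact: measurable_normc.
(* The quantity to be estimated is finite; otherwise its square root could not be cancelled in the
   last step. *)
have IA : (lebesgue_rV n).-integrable setT (EFin \o A).
  apply: le_integrable Ic => //; first exact/measurable_EFinP.
  move=> x _ /=; rewrite lee_fin (ger0_norm (A0 x)); apply: le_trans (ler_norm _).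
  rewrite mulrAC mulrC; apply: ler_pM => //; first exact: sqr_ge0.
  by rewrite ler_sqr ?nnegrE ?normc_ge0.
(* psi^2 <= B psi turns the L^2 norm of g = psi Rf, taken against dx, into the norm taken against
   psi dx. *)
have gA x : normc (g x) ^+ 2 <= B * A x.
  rewrite ng (_ : _ ^+ 2 = psi x * A x); last by rewrite /A; ring.
  by apply: ler_wpM2r.
have Ig2 : (lebesgue_rV n).-integrable setT (fun x => (normc (g x) ^+ 2)%:E).
  have IBA : (lebesgue_rV n).-integrable setT (fun x => B%:E * (A x)%:E)%E.
    exact: integrableZl.
  apply: le_integrable IBA => //.
    by apply/measurable_EFinP; apply: measurable_funX; exact: measurable_normc.
  by move=> x _; rewrite -EFinM lee_fin ger0_norm ?sqr_ge0// ger0_norm// mulr_ge0// ltW.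
pose E y := extension (lebesgue_rV n) (fun x => graph_map a x ord0) g y.
have mE : cmeas E by apply: measurable_extension => // i; exact: measurable_graph_map.
have hE := hC0 g Ig Ig2.
pose As := \int[lebesgue_rV n]_x A x.
have AsE : (\int[lebesgue_rV n]_x (A x)%:E = As%:E)%E.
  by rewrite -EFin_Rintegral.
have As0 : 0 <= As by apply: Rintegral_ge0.
have LE : (Lnorm (lebesgue_rV (n + l)) q%:E (fun y => (normc (E y))%:E) <=
    (C `^ q^-1 * (B * As) `^ 2^-1)%:E)%E.
  rewrite Lnorm.unlock.
  have P y : (`|(normc (E y))%:E| `^ q)%E = (normc (E y) ^+ (2 * n.+2))%:E.
    by rewrite gee0_abs ?lee_fin ?normc_ge0// poweR_EFin /q powR_mulrn// normc_ge0.
  under eq_integral do rewrite P.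
  have q1 : 0 <= q^-1 by rewrite invr_ge0 ltW.
  have hI : (\int[lebesgue_rV (n + l)]_y (normc (E y) ^+ (2 * n.+2))%:E <= (C * (B * As) ^+ n.+2)%:E)%E.
    pose G2 := \int[lebesgue_rV n]_x (normc (g x) ^+ 2).
    have G2E : (\int[lebesgue_rV n]_x (normc (g x) ^+ 2)%:E = G2%:E)%E.
      by rewrite -EFin_Rintegral.
    have G20 : 0 <= G2 by apply: Rintegral_ge0 => x _; exact: sqr_ge0.
    have G2le : G2 <= B * As.
      rewrite -lee_fin -G2E EFinM -AsE -ge0_integralZl//; last 3 first.
      - exact/measurable_EFinP.
      - by move=> x _; rewrite lee_fin.
      - by rewrite lee_fin ltW.
      apply: ge0_le_integral => //.
      - by move=> x _; rewrite lee_fin sqr_ge0.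
      - exact: measurable_int Ig2.
      - by apply: emeasurable_funM => //; exact/measurable_EFinP.
      - by move=> x _; rewrite -EFinM lee_fin.
    apply: (le_trans hE); rewrite G2E -EFin_expe -EFinM lee_fin.
    apply: (@le_trans _ _ (C * G2 ^+ n.+2)).
      apply: ler_wpM2r; first exact: exprn_ge0.
      by apply: (le_trans (ler_norm _)); rewrite lerDl.
    by rewrite ler_wpM2l ?(ltW Cp)// lerXn2r ?nnegrE// (le_trans G20).
  have BA0 : 0 <= B * As by rewrite mulr_ge0// ltW.
  apply: (@le_trans _ _ ((C * (B * As) ^+ n.+2)%:E `^ q^-1)%E).
    apply: gt0_ler_poweR => //; rewrite in_itv/= leey andbT.
      by apply: integral_ge0 => y _; rewrite lee_fin exprn_ge0// normc_ge0.
    by rewrite lee_fin mulr_ge0 ?(ltW Cp)// exprn_ge0.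
  rewrite poweR_EFin lee_fin powRM ?(ltW Cp) ?exprn_ge0// -powR_mulrn// -powRrM.
  (* Since q = 2(n + 2), the power n + 2 of the squared norm becomes a square root, which makes the
     estimate linear in the L^2 norm. *)
  rewrite (_ : n.+2%:R * q^-1 = 2^-1)// /q natrM invfM mulrCA divff ?mulr1// pnatr_eq0.
(* Integrated over x this kernel gives f conj(E), integrated over y it gives |Rf|^2 psi; equating
   the two is the duality. *)
pose K (z : 'rV[R]_(n + l) * 'rV[R]_n) := f z.1 * (conjc (g z.2) * expi (- inner z.1 (graph_map a z.2))).
have mK : cmeas K.
  apply: cmeasM; first exact: (cmeas_comp mf measurable_fst).
  apply: cmeasM; first by apply: cmeas_conjc; exact: (cmeas_comp mg measurable_snd).
  apply: cmeas_expi; apply: measurableT_comp => //.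
  apply: measurable_pairing; first exact: measurable_fst.
  by move=> i; exact: (measurableT_comp (measurable_graph_map a i) measurable_snd).
have bK z : normc (K z) <= normc (f z.1) * normc (g z.2).
  by rewrite /K normcM [normc (_ * expi _)]normcM normc_conjc normc_expi mulr1.
have [I1 I2 E12] := @cfubini R _ _ _ _ (lebesgue_rV (n + l)) (lebesgue_rV n) K _ _ mK intf (proj2 Ig) bK.
have E1 : (fun y => cintegral (lebesgue_rV n) (fun x => K (y, x))) = (fun y => f y * conjc (E y)).
  apply/funext => y; rewrite /K.
  have Iw := cintegrable_wave y (measurable_graph_map a) Ig.
  have Ic2 : cintegrable (lebesgue_rV n) (fun x => conjc (g x * expi (pairing y (graph_map a x ord0)))).
    case: Iw => mw iw; split; first exact: cmeas_conjc.
    by under eq_fun do rewrite normc_conjc.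
  rewrite /E /extension -cintegral_conjc// -cintegralZ//.
  by apply: eq_cintegral => x; rewrite (conjcM (g x) (expi _)) conjc_expi.
have E2 : (fun x => cintegral (lebesgue_rV (n + l)) (fun y => K (y, x))) = (fun x => (A x)%:C%C).
  apply/funext => x.
  have Iw : cintegrable (lebesgue_rV (n + l)) (fun y => expi (- inner y (graph_map a x)) * f y).
    apply: (cintegrable_le _ intf); last by move=> y; rewrite normcM normc_expi mul1r.
    apply: cmeasM => //; apply: cmeas_expi; apply: measurableT_comp => //.
    exact: measurable_inner.
  transitivity (conjc (g x) * Rf x); last first.
    rewrite /g conjcM -mulrA [conjc (Rf x) * _]mulrC mulc_conjc.
    rewrite [conjc _](_ : _ = (psi x)%:C%C); last by rewrite /= oppr0.
    by rewrite -(rmorphM (real_complex R)) mulrC.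
  rewrite /Rf -[restriction _ _]/(cintegral _ _) -cintegralZ//.
  by apply: eq_cintegral => y; rewrite /K -[RHS]/(conjc (g x) * (expi (- inner y (graph_map a x)) * f y)) [in RHS](mulrC (expi _)) mulrCA.
rewrite E1 in I1 E12; rewrite E2 in E12.
have AfE : (As%:E <= \int[lebesgue_rV (n + l)]_y (normc (f y) * normc (E y))%:E)%E.
  have Af : normc (cintegral (lebesgue_rV n) (fun x => (A x)%:C%C)) = As.
    by rewrite -(normc_real As0) /cintegral /= {2}/Rintegral integral0.
  rewrite -Af -E12; apply: le_trans (normc_cintegral I1) _.
  apply: eqW; apply: eq_integral => y _.
  by rewrite normcM normc_conjc.
have H := @hoelder _ _ R (lebesgue_rV (n + l)) (fun y => normc (f y)) (fun y => normc (E y)) p q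
  (measurable_normc mf) (measurable_normc mE) p0 q0 pq.
rewrite Lnorm1 in H.
rewrite /surface_L2_norm /Lp_norm.
have -> : (\int[lebesgue_rV n]_x (normc (restriction f (chart a x)) ^+ 2 * psi x)%:E = As%:E)%E by [].
have {}H : (As%:E <= Lnorm (lebesgue_rV (n + l)) p%:E (fun y => (normc (f y))%:E) *
    (C `^ q^-1 * (B * As) `^ 2^-1)%:E)%E.
  apply: (le_trans AfE); apply: (@le_trans _ _ (Lnorm (lebesgue_rV (n + l)) p%:E (fun y => (normc (f y))%:E) *
    Lnorm (lebesgue_rV (n + l)) q%:E (fun y => (normc (E y))%:E))%E).
    apply: le_trans H; apply: eqW; apply: eq_integral => y _ /=.
    by rewrite ger0_norm// mulr_ge0// normc_ge0.
  by apply: lee_wpmul2l => //; exact: Lnorm_ge0.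
have : (0 <= Lnorm (lebesgue_rV (n + l)) p%:E (fun y => (normc (f y))%:E))%E by exact: Lnorm_ge0.
(* For an infinite L^p norm the bound is trivial because the constant is positive, the reason for
   adding 1 to |C0|. *)
move: H; case: (Lnorm _ _ _) => [r|_ _|//]; last first.
  by rewrite gt0_muley ?leey// lte_fin mulr_gt0// powR_gt0.
rewrite -!EFinM poweR_EFin !lee_fin => H r0.
apply: le_powR_half => //; first by rewrite !mulr_ge0 ?powR_ge0.
move: H; rewrite (powRM 2^-1 (ltW B0) As0) => H; apply: (le_trans H).
move: (C `^ _) (B `^ _) (As `^ _) => u v w.
by have -> : u * v * r * w = r * (u * (v * w)) by ring.
Qed.

(** * Gaussians are Schwartz functions *)

(** Directional derivatives become derivatives of functions of one real variable, where the chain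
    rule for [expR] is available. *)
Lemma is_derive_line R (V : normedModType R) (f : V -> R) (x v : V) (l : R) :
  is_derive x v f l <-> is_derive (0 : R) 1 (fun h => f (h *: v + x)) l.
Proof.
have E : (fun h : R => h^-1 *: ((f \o shift x) (h *: v) - f x)) =
    (fun h => h^-1 *: (((fun h => f (h *: v + x)) \o shift 0) (h *: (1 : R)) - f ((0 : R) *: v + x))).
  by apply/funext => h /=; rewrite /shift /= addr0 scale0r add0r [h *: 1]mulr1.
split=> -[dv vl]; split; move: dv vl; rewrite /derivable /derive; rewrite E //.
Qed.

Lemma is_derive_expR_comp R (V : normedModType R) (f : V -> R) (x v : V) (l : R) :
  is_derive x v f l -> is_derive x v (fun y => expR (f y)) (expR (f x) * l).
Proof.
move=> /is_derive_line h; apply/is_derive_line.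
have -> : expR (f x) * l = expR (f ((0 : R) *: v + x)) * l by rewrite scale0r add0r.
exact: (is_derive1_comp (is_derive_expR _) h).
Qed.

(** Polynomials as functions, given by closure rules, so that derivatives and growth bounds are
    obtained by induction without a representation by coefficients. *)
Inductive poly_fun (R : realType) n : ('rV[R]_n -> R) -> Prop :=
| poly_fun_cst c : poly_fun (fun=> c)
| poly_fun_coord i : poly_fun (fun x => x ord0 i)
| poly_funD P Q : poly_fun P -> poly_fun Q -> poly_fun (fun x => P x + Q x)
| poly_funM P Q : poly_fun P -> poly_fun Q -> poly_fun (fun x => P x * Q x).

Lemma poly_fun_sum R n (I : Type) (s : seq I) (P : I -> 'rV[R]_n -> R) :
  (forall i, poly_fun (P i)) -> poly_fun (fun x => \sum_(i <- s) P i x).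
Proof.
move=> hP; elim: s => [|i s IHs].
  by under eq_fun do rewrite big_nil; exact: poly_fun_cst.
by under eq_fun do rewrite big_cons; exact: poly_funD.
Qed.

Lemma poly_fun_prod R n (I : Type) (s : seq I) (P : I -> 'rV[R]_n -> R) :
  (forall i, poly_fun (P i)) -> poly_fun (fun x => \prod_(i <- s) P i x).
Proof.
move=> hP; elim: s => [|i s IHs].
  by under eq_fun do rewrite big_nil; exact: poly_fun_cst.
by under eq_fun do rewrite big_cons; exact: poly_funM.
Qed.

Lemma poly_funX R n (P : 'rV[R]_n -> R) m : poly_fun P -> poly_fun (fun x => P x ^+ m).
Proof.
move=> hP; elim: m => [|m IHm]; first by under eq_fun do rewrite expr0; exact: poly_fun_cst.
by under eq_fun do rewrite exprS; exact: poly_funM.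
Qed.

Lemma poly_fun_monomial R n a : poly_fun (@monomial R n a).
Proof. by apply: poly_fun_prod => i; apply: poly_funX; exact: poly_fun_coord. Qed.

Lemma poly_fun_continuous R n (P : 'rV[R]_n -> R) : poly_fun P -> continuous P.
Proof.
elim=> {P} [c|i|P Q _ cP _ cQ|P Q _ cP _ cQ] x.
- exact: cst_continuous.
- exact: coord_continuous.
- exact: (continuousD (cP x) (cQ x)).
- exact: (continuousM (cP x) (cQ x)).
Qed.

Lemma poly_fun_derive R n (P : 'rV[R]_n -> R) (i : 'I_n) : poly_fun P ->
  exists2 P', poly_fun P' & forall x, is_derive x (delta_mx ord0 i) P (P' x).
Proof.
elim=> {P} [c|j|P Q _ [P' pP' dP] _ [Q' pQ' dQ]|P Q pP [P' pP' dP] pQ [Q' pQ' dQ]].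
- by exists (fun=> 0); [exact: poly_fun_cst|move=> x; exact: is_derive_cst].
- exists (fun=> (j == i)%:R); first exact: poly_fun_cst.
  move=> x; apply/is_derive_line.
  have -> : (fun h : R => (h *: delta_mx ord0 i + x) ord0 j) =
      (fun h : R => h * (j == i)%:R + x ord0 j).
    by apply/funext => h; rewrite !mxE eqxx.
  by apply: is_derive_eq; rewrite addr0 scaler0 add0r [LHS]mulr1.
- exists (fun x => P' x + Q' x); first exact: poly_funD.
  by move=> x; exact: is_deriveD.
- exists (fun x => P x * Q' x + Q x * P' x); first by apply: poly_funD; exact: poly_funM.
  by move=> x; exact: is_deriveM.
Qed.

Definition gaussian R n (d : 'I_n -> R) (x : 'rV[R]_n) : R :=
  expR (- \sum_(i < n) (d i * x ord0 i) ^+ 2).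

Lemma poly_fun_gaussian_exponent R n (d : 'I_n -> R) :
  poly_fun (fun x : 'rV[R]_n => - \sum_(i < n) (d i * x ord0 i) ^+ 2).
Proof.
under eq_fun do rewrite -mulN1r.
apply: poly_funM; first exact: poly_fun_cst.
apply: poly_fun_sum => i; apply: poly_funX; apply: poly_funM; first exact: poly_fun_cst.
exact: poly_fun_coord.
Qed.

Lemma continuous_gaussian R n (d : 'I_n -> R) : continuous (gaussian d).
Proof.
have c := poly_fun_continuous (poly_fun_gaussian_exponent d).
by move=> x; exact: (continuous_comp (c x) (@continuous_expR R _)).
Qed.

Lemma derive_poly_gaussian R n (d : 'I_n -> R) P (i : 'I_n) : poly_fun P ->
  exists2 P', poly_fun P' & forall x,
    is_derive x (delta_mx ord0 i) (fun x => P x * gaussian d x) (P' x * gaussian d x).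
Proof.
move=> pP; have [P' pP' dP] := poly_fun_derive i pP.
have [Q' pQ' dQ] := poly_fun_derive i (poly_fun_gaussian_exponent d).
exists (fun x => P x * Q' x + P' x).
  by apply: poly_funD => //; exact: poly_funM.
move=> x; have dG := is_derive_expR_comp (dQ x).
have := is_deriveM (dP x) dG; rewrite (_ : _ *: _ + _ *: _ = (P x * Q' x + P' x) * gaussian d x)//.
by rewrite /gaussian /GRing.scale /=; ring.
Qed.

(** Polynomials times a fixed Gaussian are stable under partial derivatives because the exponent is
    itself a polynomial. *)
Lemma iter_partial_gaussian R n (d : 'I_n -> R) (s : seq 'I_n) :
  exists2 P, poly_fun P & iter_partial s (gaussian d) = (fun x => P x * gaussian d x).
Proof.
elim: s => [|i s [P pP E]].
  exists (fun=> 1); first exact: poly_fun_cst.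
  by apply/funext => x; rewrite mul1r.
have [P' pP' dP] := derive_poly_gaussian d i pP; exists P' => //.
apply/funext => x; rewrite /= -/(iter_partial s _) E /partial.
exact: derive_val.
Qed.

(** The bound is a power of a product over coordinates, so that against a Gaussian it splits into
    one-variable bounds. *)
Lemma poly_fun_growth R n (P : 'rV[R]_n -> R) : poly_fun P ->
  exists C m, 0 <= C /\ forall x, `|P x| <= C * (\prod_(i < n) (1 + x ord0 i ^+ 2)) ^+ m.
Proof.
have w1 := @prod_oneDsqr_ge1 R n.
elim=> {P} [c|j|P Q _ [C [m [C0 hP]]] _ [D [k [D0 hQ]]]|P Q _ [C [m [C0 hP]]] _ [D [k [D0 hQ]]]].
- by exists `|c|, 0%N; split=> // x; rewrite expr0 mulr1.
- exists 1, 1%N; split=> // x; rewrite mul1r expr1 (bigD1 j)//=.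
  have h : `|x ord0 j| <= 1 + x ord0 j ^+ 2.
    rewrite -[X in _ <= _ + X]real_normK ?num_real//; move: `|_| (normr_ge0 (x ord0 j)) => u u0; nra.
  apply: (le_trans h); rewrite ler_peMr ?addr_ge0 ?sqr_ge0//.
  by apply: prodr_ge1 => i _; rewrite lerDl sqr_ge0.
- exists (C + D), (m + k)%N; split=> [|x]; first exact: addr_ge0.
  apply: le_trans (ler_normD _ _) _; rewrite mulrDl; apply: lerD.
    apply: (le_trans (hP x)); apply: ler_wpM2l => //.
    by apply: ler_weXn2l => //; exact: leq_addr.
  apply: (le_trans (hQ x)); apply: ler_wpM2l => //.
  by apply: ler_weXn2l => //; exact: leq_addl.
- exists (C * D), (m + k)%N; split=> [|x]; first exact: mulr_ge0.
  rewrite normrM exprD mulrACA; apply: ler_pM => //.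
Qed.

(** With K = 1 + m / d^2 one has 1 + t^2 <= K (1 + (d t)^2 / m) <= K exp((d t)^2 / m); the m-th
    power gives the claim. The case m = 0 is apart because of the division by m. *)
Lemma oneDsqr_exp_bound R (d : R) (m : nat) : 0 < d ->
  exists2 K, 0 <= K & forall t : R, (1 + t ^+ 2) ^+ m * expR (- (d * t) ^+ 2) <= K.
Proof.
move=> d0; have [->|m0] := posnP m.
  exists 1 => // t; rewrite expr0 mul1r -expR0 ler_expR oppr_le0 sqr_ge0//.
have m0' : 0 < m%:R :> R by rewrite ltr0n.
pose K : R := 1 + m%:R / d ^+ 2.
have K0 : 0 <= K by rewrite addr_ge0// divr_ge0// ?sqr_ge0// ltW.
exists (K ^+ m); first exact: exprn_ge0.
move=> t; rewrite expRN ler_pdivrMr ?expR_gt0//.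
have -> : expR ((d * t) ^+ 2) = expR ((d * t) ^+ 2 / m%:R) ^+ m.
  by rewrite -expRM_natl -mulr_natl mulrCA divff ?mulr1// gt_eqF.
rewrite -exprMn; apply: lerXn2r; rewrite ?nnegrE.
- by rewrite addr_ge0// sqr_ge0.
- by rewrite mulr_ge0// expR_ge0.
apply: (@le_trans _ _ (K * (1 + (d * t) ^+ 2 / m%:R))); last first.
  by apply: ler_wpM2l => //; exact: expR_ge1Dx.
have E : m%:R / d ^+ 2 * ((d * t) ^+ 2 / m%:R) = t ^+ 2.
  by field; rewrite !gt_eqF.
have := divr_ge0 (ltW m0') (sqr_ge0 d); have := divr_ge0 (sqr_ge0 (d * t)) (ltW m0').
move: E; rewrite /K; move: (m%:R / d ^+ 2) (_ / m%:R) => u v <- v0 u0; nra.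
Qed.

Lemma poly_gaussian_bounded R n (d : 'I_n -> R) (P : 'rV[R]_n -> R) :
  (forall i, 0 < d i) -> poly_fun P -> exists M, forall x, `|P x * gaussian d x| <= M.
Proof.
move=> d0 /poly_fun_growth[C [m [C0 hC]]].
have [K hK] : exists K : 'I_n -> R, forall i, 0 <= K i /\
    forall t : R, (1 + t ^+ 2) ^+ m * expR (- (d i * t) ^+ 2) <= K i.
  apply: (@fin_all_exists 'I_n (fun=> R) (fun i K => 0 <= K /\
    forall t : R, (1 + t ^+ 2) ^+ m * expR (- (d i * t) ^+ 2) <= K)) => i.
  by have [K K0 h] := oneDsqr_exp_bound m (d0 i); exists K.
exists (C * \prod_(i < n) K i) => x.
rewrite normrM [X in _ * X]ger0_norm ?expR_ge0//.
apply: (le_trans (ler_wpM2r (expR_ge0 _) (hC x))).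
rewrite -mulrA; apply: ler_wpM2l => //.
rewrite /gaussian -sumrN expR_sum -prodrXl -big_split /=.
apply: ler_prod => i _; have [K0 h] := hK i; rewrite h andbT.
by rewrite mulr_ge0 ?expR_ge0// exprn_ge0// addr_ge0// sqr_ge0.
Qed.

Lemma schwartz_gaussian R n (d : 'I_n -> R) : (forall i, 0 < d i) ->
  schwartz (fun x : 'rV[R]_n => (gaussian d x)%:C%C).
Proof.
move=> d0; split=> /=.
  split.
    move=> s; have [P pP ->] := iter_partial_gaussian d s; split.
      have cP := poly_fun_continuous pP; have cG := @continuous_gaussian R n d.
      by move=> x; exact: (continuousM (cP x) (cG x)).
    by move=> i x; have [P' _ dP] := derive_poly_gaussian d i pP; case: (dP x).
  move=> a s; have [P pP ->] := iter_partial_gaussian d s.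
  have [M hM] := poly_gaussian_bounded d0 (poly_funM (poly_fun_monomial R a) pP).
  by exists M => x; rewrite mulrA.
have E (s : seq 'I_n) : iter_partial s (fun=> 0 : R) = (fun=> 0 : R).
  elim: s => [//|i s IHs]; rewrite /= -/(iter_partial s _) IHs; apply/funext => x.
  exact: derive_cst.
split.
  move=> s; rewrite E; split; first by move=> x; exact: cst_continuous.
  by move=> i x; exact: derivable_cst.
by move=> a s; exists 0 => x; rewrite E mulr0 normr0.
Qed.

(** * Sharpness *)

Lemma normr_sin_le R (t : R) : `|sin t| <= `|t|.
Proof.
wlog t0 : t / 0 <= t.
  move=> h; have [/h//|/ltW t0] := leP 0 t.
  by have := h (- t); rewrite sinN !normrN oppr_ge0; exact.
have [c _] : exists2 c, c \in `[0, t] & sin t - sin 0 = cos c * (t - 0).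
  apply: MVT_segment => //.
  by apply: continuous_subspaceT => x; exact: continuous_sin.
rewrite sin0 !subr0 => ->; rewrite normrM ler_piMl// ler_norml cos_geN1.
exact: cos_le1.
Qed.

(** Write cos t = 1 - 2 sin^2(t/2) and use |sin| <= |t| at t/2. *)
Lemma cos_ge_parabola R (t : R) : 1 - t ^+ 2 / 2 <= cos t.
Proof.
have {1 2}-> : t = (t / 2) *+ 2 by rewrite -mulr_natr divfK.
rewrite cos_mulr2n; have := cos2Dsin2 (t / 2); have := normr_sin_le (t / 2).
rewrite -ler_sqr ?nnegrE// !real_normK ?num_real//.
move: (cos (t / 2)) (sin (t / 2)) (t / 2) => c s u h1 h2.
have -> : (u *+ 2) ^+ 2 / 2 = 2 * u ^+ 2 by field.
by move: h1 h2; move: (c ^+ 2) (s ^+ 2) (u ^+ 2) => c2 s2 u2; lra.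
Qed.

(** Iterating (u + S)^2 <= 2 u^2 + 2 S^2 gives the crude factor 2^N; only its independence of the
    scale matters. *)
Lemma sqr_sum_le R N (a : 'I_N -> R) :
  (\sum_(i < N) a i) ^+ 2 <= 2 ^+ N * \sum_(i < N) a i ^+ 2.
Proof.
elim: N a => [|N IHN] a; first by rewrite !big_ord0 expr0n mulr0.
rewrite !big_ord_recl; have := IHN (fun i => a (lift ord0 i)).
have h2 : 1 <= 2 ^+ N :> R by rewrite exprn_ege1// ler1n.
move: h2; rewrite [2 ^+ N.+1]exprS; move: (2 ^+ N) => q q1.
move: (\sum_(i < N) a (lift ord0 i)) (\sum_(i < N) a (lift ord0 i) ^+ 2) (a ord0) => S S2 u.
have := sqr_ge0 (u - S); have := sqr_ge0 u => u2 h IH.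
have : 0 <= (q - 1) * u ^+ 2 by rewrite mulr_ge0// subr_ge0.
nra.
Qed.

Lemma ge0_integral_diag R N (d : 'I_N -> R) (F : 'rV[R]_N -> \bar R) :
  (forall i, 0 < d i) -> measurable_fun [set: 'rV[R]_N] F -> (forall x, 0 <= F x)%E ->
  (\int[lebesgue_rV N]_x F (\row_i (d i * x ord0 i))%R =
   ((\prod_(i < N) d i)^-1)%R%:E * \int[lebesgue_rV N]_x F x)%E.
Proof.
move=> d0 mF F0; pose A : 'M[R]_N := diag_mx (\row_i d i).
have P0 : 0 < \prod_(i < N) d i by apply: prodr_gt0.
have hA : linear_change A.
  apply: linear_change_upper => [i|i j ji]; rewrite !mxE ?eqxx ?mulr1n ?gt_eqF//.
have <- := hA F mF F0.
have -> : `|\det A| = \prod_(i < N) d i.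
  by rewrite det_diag; under eq_bigr do rewrite mxE; rewrite gtr0_norm.
rewrite muleA -EFinM mulVf ?gt_eqF// mul1e; apply: eq_integral => x _.
by congr F; apply/rowP => i; rewrite mul_mx_diag !mxE mulrC.
Qed.

Lemma gaussian_ge0 R n (d : 'I_n -> R) x : 0 <= gaussian d x.
Proof. exact: expR_ge0. Qed.

Lemma gaussian_le1 R n (d : 'I_n -> R) x : gaussian d x <= 1.
Proof.
rewrite /gaussian -expR0 ler_expR oppr_le0; apply: sumr_ge0 => i _; exact: sqr_ge0.
Qed.

Lemma measurable_gaussian R n (d : 'I_n -> R) :
  measurable_fun [set: 'rV[R]_n] (gaussian d).
Proof. by apply: continuous_rV_measurable; exact: continuous_gaussian. Qed.

Lemma gaussian_scale R n (d : 'I_n -> R) (x : 'rV[R]_n) :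
  gaussian d x = gaussian (fun=> 1) (\row_i (d i * x ord0 i)).
Proof. by congr (expR (- _)); apply: eq_bigr => i _; rewrite mxE mul1r. Qed.

Lemma integrable_poly_gaussian R n (d : 'I_n -> R) P :
  (forall i, 0 < d i) -> poly_fun P ->
  (lebesgue_rV n).-integrable setT (EFin \o (fun x => P x * gaussian d x)).
Proof.
move=> d0 pP.
have pw : poly_fun (fun x : 'rV[R]_n => \prod_(i < n) (1 + x ord0 i ^+ 2)).
  apply: poly_fun_prod => i; apply: poly_funD; first exact: poly_fun_cst.
  by apply: poly_funX; exact: poly_fun_coord.
have [M hM] := poly_gaussian_bounded d0 (poly_funM pP pw).
apply: le_integrable (integrableZ_cauchy_weight n M) => //.
  apply/measurable_EFinP; apply: measurable_funM; last exact: measurable_gaussian.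
  by apply: continuous_rV_measurable; exact: poly_fun_continuous.
move=> x _ /=; rewrite lee_fin; apply: le_trans (ler_norm _).
have P0 := lt_le_trans ltr01 (prod_oneDsqr_ge1 x).
rewrite cauchy_weightE ler_pdivlMr// -[X in _ * X]gtr0_norm// -normrM mulrAC.
exact: hM.
Qed.

Lemma lebesgue_cube R n (r : R) : 0 < r ->
  lebesgue_rV n (@cube R n r) = ((2 * r) ^+ n)%:E.
Proof.
move=> r0; rewrite -[LHS]/(lebesgue_rV n (box (fun=> `[- r, r]%classic))).
rewrite lebesgue_rV_boxE; last by move=> i; exact: measurable_itv.
rewrite (eq_bigr (fun=> (2 * r)%:E)).
  by rewrite prodEFin prodr_const card_ord.
move=> i _; rewrite -[LHS]/(lebesgue_measure _) lebesgue_measure_itv/= lte_fin.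
by rewrite ifT; [rewrite -EFinB opprK mulr_natl mulr2n|rewrite gtrN].
Qed.

Lemma ge0_integral_ge_cube R n (r c : R) (F : 'rV[R]_n -> \bar R) :
  0 < r -> 0 <= c -> measurable_fun [set: 'rV[R]_n] F -> (forall x, 0 <= F x)%E ->
  (forall x, cube r x -> c%:E <= F x)%E ->
  ((c * (2 * r) ^+ n)%:E <= \int[lebesgue_rV n]_x F x)%E.
Proof.
move=> r0 c0 mF F0 hF.
apply: (@le_trans _ _ (\int[lebesgue_rV n]_(x in cube r) F x)%E); last first.
  by apply: ge0_subset_integral => //; exact: measurable_cube.
rewrite EFinM -lebesgue_cube// -integral_cst; last exact: measurable_cube.
apply: ge0_le_integral => //.
- exact: measurable_cube.
- exact: measurable_funTS.
Qed.

Lemma integrable_gaussian R n (d : 'I_n -> R) : (forall i, 0 < d i) ->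
  (lebesgue_rV n).-integrable setT (EFin \o gaussian d).
Proof.
move=> d0; have := integrable_poly_gaussian d0 (poly_fun_cst n 1).
by under [X in _.-integrable _ (_ \o X) -> _]eq_fun do rewrite mul1r.
Qed.

Lemma gaussian_mass_gt0 R n :
  0 < \int[lebesgue_rV n]_x gaussian (fun=> 1 : R) x.
Proof.
rewrite -lte_fin EFin_Rintegral; last exact: integrable_gaussian.
apply: (@lt_le_trans _ _ (expR (- n%:R) * (2 * 1) ^+ n)%:E).
  by rewrite lte_fin mulr_gt0 ?expR_gt0// exprn_gt0// mulr1.
apply: ge0_integral_ge_cube => //.
- by apply/measurable_EFinP; exact: measurable_gaussian.
- by move=> x; rewrite lee_fin gaussian_ge0.
move=> x hx; rewrite lee_fin ler_expR lerN2.
have -> : n%:R = \sum_(i < n) (1 : R) by rewrite sumr_const card_ord.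
apply: ler_sum => i _; rewrite mul1r -[leLHS]real_normK ?num_real//.
by have := hx i; rewrite /= in_itv/= -ler_norml => h; exact: exprn_ile1.
Qed.

Lemma integral_gaussian R n (d : 'I_n -> R) : (forall i, 0 < d i) ->
  (\int[lebesgue_rV n]_x (gaussian d x)%:E =
   ((\prod_(i < n) d i)^-1 * \int[lebesgue_rV n]_x gaussian (fun=> 1%R) x)%R%:E)%E.
Proof.
move=> d0; under eq_integral do rewrite gaussian_scale.
rewrite (@ge0_integral_diag R n d (fun x => (gaussian (fun=> 1) x)%:E))//; last 2 first.
- by apply/measurable_EFinP; exact: measurable_gaussian.
- by move=> x; rewrite lee_fin gaussian_ge0.
by rewrite EFinM EFin_Rintegral//; exact: integrable_gaussian.
Qed.

(* On the dual box |eta_i| <= c d_i the Fourier transform of the Gaussian is comparable to its mass, because cos t >= 1 - t^2 / 2. *)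
Lemma gaussian_fourier_ge R N :
  exists2 c : R, 0 < c <= 1 & exists2 kappa : R, 0 < kappa &
  forall (d : 'I_N -> R) (eta : 'rV[R]_N), (forall i, 0 < d i) ->
  (forall i, `|eta ord0 i| <= c * d i) ->
  kappa / \prod_(i < N) d i <=
  normc (cintegral (lebesgue_rV N) (fun y => expi (- inner y eta) * (gaussian d y)%:C%C)).
Proof.
(* By [sqr_sum_le], [P] dominates the square of the sum of the coordinates; after scaling by d it
   controls <y, eta>^2 on the dual box. *)
pose P (z : 'rV[R]_N) : R := 2 ^+ N * \sum_(i < N) z ord0 i ^+ 2.
have pP : poly_fun P.
  apply: poly_funM; first exact: poly_fun_cst.
  by apply: poly_fun_sum => i; apply: poly_funX; exact: poly_fun_coord.
have P0 z : 0 <= P z by rewrite mulr_ge0 ?exprn_ge0// sumr_ge0// => i _; exact: sqr_ge0.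
pose G (z : 'rV[R]_N) := gaussian (fun=> 1 : R) z.
have I2 := @integrable_poly_gaussian R N (fun=> 1) P (fun=> ltr01) pP.
set K0 := \int[lebesgue_rV N]_z G z.
set K2 := \int[lebesgue_rV N]_z (P z * G z).
have K00 : 0 < K0 by exact: gaussian_mass_gt0.
have K20 : 0 <= K2 by apply: Rintegral_ge0 => z _; rewrite mulr_ge0 ?gaussian_ge0.
(* Small enough that c^2 K2 <= K0: the quadratic error c^2 K2 / 2 then takes at most half of the
   mass K0, which leaves kappa = K0 / 2. Adding 1 to K2 keeps the denominator positive. *)
pose c := Num.min 1 (K0 / (K2 + 1)).
have c0 : 0 < c by rewrite lt_min ltr01 divr_gt0// ltr_wpDl.
have c1 : c <= 1 by rewrite ge_min lexx.
have cK : c ^+ 2 * K2 <= K0.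
  apply: (@le_trans _ _ (c * K2)).
    by apply: ler_wpM2r => //; rewrite expr2 ger_pMr.
  apply: (@le_trans _ _ (K0 / (K2 + 1) * K2)).
    by apply: ler_wpM2r => //; rewrite ge_min lexx orbT.
  by rewrite mulrAC ler_pdivrMr ?ltr_wpDl// ler_pM2l// lerDl.
exists c; first by rewrite c0.
exists (K0 / 2); first by rewrite divr_gt0.
move=> d eta d0 hd; set Pi := \prod_(i < N) d i.
have Pi0 : 0 < Pi by apply: prodr_gt0.
pose D (y : 'rV[R]_N) : 'rV[R]_N := \row_i (d i * y ord0 i).
pose F (y : 'rV[R]_N) : R[i] := expi (- inner y eta) * (gaussian d y)%:C%C.
have Id := integrable_gaussian d0.
have mF : cmeas F.
  apply: cmeasM; last by apply: cmeas_real; exact: measurable_gaussian.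
  by apply: cmeas_expi; apply: measurableT_comp => //; exact: measurable_inner.
have IF : cintegrable (lebesgue_rV N) F.
  apply: (cintegrable_le mF Id) => y.
  by rewrite normcM normc_expi mul1r normc_real// gaussian_ge0.
have IR := cintegrable_Re IF.
have RE y : complex.Re (F y) = cos (inner y eta) * gaussian d y.
  by rewrite complex_ReM /= cosN mulr0 subr0.
have ID2 : (\int[lebesgue_rV N]_y (P (D y) * gaussian d y)%:E = (Pi^-1 * K2)%:E)%E.
  rewrite (eq_integral (fun y => (P (D y) * G (D y))%:E)); last first.
    by move=> y _; rewrite gaussian_scale.
  rewrite (@ge0_integral_diag R N d (fun x => (P x * G x)%:E))//; last 2 first.
  - exact: measurable_int I2.
  - by move=> x; rewrite lee_fin mulr_ge0 ?gaussian_ge0.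
  by rewrite EFinM EFin_Rintegral.
have mPD : measurable_fun [set: 'rV[R]_N] (fun y => P (D y) * gaussian d y).
  apply: measurable_funM; last exact: measurable_gaussian.
  apply: measurable_funM => //; apply: measurable_sum => i; apply: measurable_funX.
  by under eq_fun do rewrite mxE; apply: measurable_funM => //; exact: measurable_rV_coord.
have PD0 y : 0 <= P (D y) * gaussian d y by rewrite mulr_ge0 ?gaussian_ge0.
have IPD : (lebesgue_rV N).-integrable setT (EFin \o (fun y => P (D y) * gaussian d y)).
  apply/integrableP; split; first exact/measurable_EFinP.
  rewrite (eq_integral (fun y => (P (D y) * gaussian d y)%:E)); last first.
    by move=> y _; rewrite gee0_abs// lee_fin.
  by rewrite ID2 ltry.
have IZ : (lebesgue_rV N).-integrable setT (EFin \o (fun y => c ^+ 2 / 2 * (P (D y) * gaussian d y))).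
  exact: integrable_scale.
(* The lower bound on the cosine is rearranged so that the error stands on the right and only
   linearity of the integral is needed. *)
have pw y : gaussian d y <= complex.Re (F y) + c ^+ 2 / 2 * (P (D y) * gaussian d y).
  rewrite RE mulrA -mulrDl -[leLHS]mul1r; apply: ler_wpM2r; first exact: gaussian_ge0.
  have h1 : inner y eta ^+ 2 <= c ^+ 2 * P (D y).
    rewrite /inner; apply: (le_trans (sqr_sum_le _)).
    rewrite /P mulrCA; apply: ler_wpM2l; first exact: exprn_ge0.
    rewrite mulr_sumr; apply: ler_sum => i _; rewrite mxE !exprMn.
    rewrite [leLHS]mulrC [leRHS]mulrA; apply: ler_wpM2r; first exact: sqr_ge0.
    rewrite -exprMn -[leLHS]real_normK ?num_real//; apply: lerXn2r; rewrite ?nnegrE//.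
    by rewrite mulr_ge0 ?(ltW c0)// ltW.
  have := cos_ge_parabola (inner y eta); move: h1.
  by move: (inner y eta ^+ 2) (cos _) (P _) (c ^+ 2) => u v w c2; lra.
have key : Pi^-1 * K0 <= \int[lebesgue_rV N]_y complex.Re (F y) + c ^+ 2 / 2 * (Pi^-1 * K2).
  have E0 : \int[lebesgue_rV N]_y gaussian d y = Pi^-1 * K0.
    by rewrite /Rintegral integral_gaussian.
  have E2 : \int[lebesgue_rV N]_y (c ^+ 2 / 2 * (P (D y) * gaussian d y)) = c ^+ 2 / 2 * (Pi^-1 * K2).
    by rewrite RintegralZl// /Rintegral ID2.
  rewrite -E0 -E2 -RintegralD//; apply: le_Rintegral => //.
  exact: (integrableD measurableT IR IZ).
apply: (le_trans _ (normc_ge_absRe _)); apply: (le_trans _ (ler_norm _)).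
rewrite -[complex.Re _]/(\int[lebesgue_rV N]_y complex.Re (F y)).
have Pi0' : 0 < Pi^-1 by rewrite invr_gt0.
have h : c ^+ 2 * K2 * Pi^-1 <= K0 * Pi^-1 by rewrite ler_pM2r.
move: key h; move: (\int[_]_y _) (Pi^-1) => X q.
have -> : c ^+ 2 / 2 * (q * K2) = (c ^+ 2 * K2 * q) / 2 by field.
move: (c ^+ 2 * K2 * q) => u; lra.
Qed.

(** The Gaussian is at most 1, so its r-th power is at most itself for r >= 1, and one mass constant
    serves for all exponents. *)
Lemma Lp_norm_gaussian_le R n (d : 'I_n -> R) (r : R) : (forall i, 0 < d i) -> 1 <= r ->
  (Lp_norm r%:E (fun y : 'rV[R]_n => (gaussian d y)%:C%C) <=
   (((\prod_(i < n) d i)^-1 * \int[lebesgue_rV n]_x gaussian (fun=> 1%R) x) `^ r^-1)%:E)%E.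
Proof.
move=> d0 r1; have r0 : 0 < r by apply: lt_le_trans r1.
rewrite /Lp_norm Lnorm.unlock -poweR_EFin.
have ge (x : 'rV[R]_n) : (0 <= `|(normc (gaussian d x)%:C%C)%:E| `^ r)%E by exact: poweR_ge0.
have gE x : (`|(normc (gaussian d x)%:C%C)%:E| `^ r = (gaussian d x `^ r)%:E)%E.
  by rewrite normc_real ?gaussian_ge0// gee0_abs ?lee_fin ?gaussian_ge0.
apply: gt0_ler_poweR.
- by rewrite invr_ge0 ltW.
- by rewrite in_itv/= leey andbT integral_ge0.
- rewrite in_itv/= leey andbT -integral_gaussian// integral_ge0// => x _.
  by rewrite lee_fin gaussian_ge0.
rewrite -integral_gaussian//; apply: ge0_le_integral => //.
- under eq_fun do rewrite gE; apply/measurable_EFinP.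
  exact: (measurableT_comp (measurable_powR r) (measurable_gaussian d)).
- by apply/measurable_EFinP; exact: measurable_gaussian.
- move=> x _; rewrite gE lee_fin -[leRHS]powRr1 ?gaussian_ge0//.
  by apply: ger_powR => //; rewrite expR_gt0 gaussian_le1.
Qed.

Lemma Linfty_norm_gaussian_le R n (d : 'I_n -> R) :
  (Lp_norm +oo (fun y : 'rV[R]_n => (gaussian d y)%:C%C) <= 1)%E.
Proof.
rewrite /Lp_norm Lnorm.unlock; case: ifP => // _.
apply/ess_sup_inf.ess_supP; apply: nearW => x /=.
by rewrite expr0n addr0 sqrtr_sqr normr_id ger0_norm ?gaussian_ge0// lee_fin gaussian_le1.
Qed.

Lemma nbhs0_cube R n (P : 'rV[R]_n -> Prop) :
  (\forall x \near (0 : 'rV[R]_n), P x) -> exists2 e : R, 0 < e & forall x, cube e x -> P x.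
Proof.
move=> /nbhs_ballP[e /= e0 he]; exists (e / 2); first by rewrite divr_gt0.
move=> x hx; apply: he; split=> // i j; rewrite !ord1 mxE /ball /= sub0r normrN.
have := hx j; rewrite /= in_itv/= -ler_norml => h; apply: (le_lt_trans h).
by rewrite ltr_pdivrMr// ltr_pMr// ltr1n.
Qed.

Lemma enumerates_degree2_coord R n l (a : 'I_l -> {ffun 'I_n -> nat}) j :
  enumerates_degree2 a -> exists p : 'I_n * 'I_n,
  forall x : 'rV[R]_n, monomial (a j) x = x ord0 p.1 * x ord0 p.2.
Proof.
move=> [_ ha]; have /degree2_pair_index[p [_ ap]] : (\sum_(i < n) a j i = 2)%N.
  by apply/ha; exists j.
by exists p => x; rewrite ap monomial_pair_index.
Qed.

(* Knapp-type example: Gaussians adapted to a delta x delta^2 cap of S at the origin. *)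
Lemma gaussian_test R (n l : nat) (a : 'I_l -> {ffun 'I_n -> nat})
    (psi : 'rV[R]_n -> R) (p : \bar R) (s K : R) :
  enumerates_degree2 a -> l = ((n * (n + 1)) %/ 2)%N -> smooth_density psi ->
  (\forall x \near (0 : 'rV[R]_n), 0 < psi x) -> restriction_bound a psi p -> 0 <= s -> 0 < K ->
  (forall d : 'I_(n + l) -> R, (forall i, 0 < d i) ->
    (Lp_norm p (fun y : 'rV[R]_(n + l) => (gaussian d y)%:C%C) <=
     (((\prod_(i < n + l) d i)^-1 * K) `^ s)%:E)%E) ->
  (0 < n)%N -> (2 * n + 3)%:R / (2 * (n + 2))%:R <= s.
Proof.
move=> ea hl [sm _ psi0] psip [C hC] s0 K0 hLp n0.
have cpsi : continuous psi by case: (sm [::]).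
pose m := psi 0 / 2.
have m0 : 0 < m by rewrite divr_gt0//; exact: nbhs_singleton psip.
have [e e0 he] : exists2 e : R, 0 < e & forall x, cube e x -> m <= psi x.
  apply: nbhs0_cube; apply: (cvgr_ge (f := psi) _ (cpsi 0)).
  by rewrite /m ltr_pdivrMr// ltr_pMr ?ltr1n//; exact: nbhs_singleton psip.
have [c /andP[c0 c1] [kappa kappa0 hk]] := gaussian_fourier_ge R (n + l).
(* Parameter t in the n tangential coordinates and t^2 in the quadratic ones: the transform of this
   Gaussian is large on a t x t^2 cap. *)
pose d (t : R) (i : 'I_(n + l)) : R := if (i < n)%N then t else t ^+ 2.
have dl t i : d t (lshift l i) = t by rewrite /d /= ltn_ord.
have dr t j : d t (rshift n j) = t ^+ 2 by rewrite /d /= ltnNge leq_addr.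
have dp t : 0 < t -> forall i, 0 < d t i by move=> t0 i; rewrite /d; case: ifP => _ //; exact: exprn_gt0.
(* The product of all parameters is t^(n + 2l), and 2l = n(n + 1) gives n(n + 2). *)
pose D := (n * (n + 2))%N.
have dprod t : \prod_(i < n + l) d t i = t ^+ D.
  rewrite big_split_ord /= (eq_bigr (fun=> t)); last by move=> i _; exact: dl.
  rewrite [X in _ * X](eq_bigr (fun=> t ^+ 2)); last by move=> i _; exact: dr.
  rewrite !prodr_const !card_ord -exprM -exprD; congr (_ ^+ _).
  rewrite hl /D; have h : (2 %| n * (n + 1))%N by rewrite dvdn2 oddM oddD; case: odd.
  by have := divnK h; rewrite mulnC => ->; lia.
have key t : 0 < t -> c * t <= e -> t <= 1 ->
    (kappa / t ^+ D) ^+ 2 * m * (2 * (c * t)) ^+ n <= (`|C| * ((t ^+ D)^-1 * K) `^ s) ^+ 2.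
  move=> t0 te t1; have ct0 : 0 < c * t by rewrite mulr_gt0.
  have a0 : 0 <= (kappa / t ^+ D) ^+ 2 * m * (2 * (c * t)) ^+ n.
    apply: mulr_ge0; first by rewrite mulr_ge0 ?sqr_ge0// ltW.
    by rewrite exprn_ge0// mulr_ge0// ltW.
  pose f (y : 'rV[R]_(n + l)) : R[i] := (gaussian (d t) y)%:C%C.
  have sf : schwartz f by apply: schwartz_gaussian; exact: dp.
  have If := schwartz_cintegrable sf.
  pose F x := normc (restriction f (chart a x)) ^+ 2 * psi x.
  have F0 x : 0 <= F x by rewrite mulr_ge0 ?sqr_ge0.
  have mF : measurable_fun [set: 'rV[R]_n] F.
    apply: measurable_funM; last exact: continuous_rV_measurable.
    by apply: measurable_funX; apply: measurable_normc; exact: cmeas_restriction.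
  have Fge : (((kappa / t ^+ D) ^+ 2 * m * (2 * (c * t)) ^+ n)%:E <= \int[lebesgue_rV n]_x (F x)%:E)%E.
    apply: ge0_integral_ge_cube => //.
    - by rewrite mulr_ge0 ?sqr_ge0// ltW.
    - exact/measurable_EFinP.
    move=> x hx; rewrite lee_fin; have xi i : `|x ord0 i| <= c * t.
      by have := hx i; rewrite /= in_itv/= -ler_norml.
    apply: ler_pM; rewrite ?sqr_ge0 ?(ltW m0)//; last first.
      by apply: he => i; rewrite /= in_itv/= -ler_norml; exact: le_trans (xi i) te.
    rewrite ler_sqr ?nnegrE ?normc_ge0 ?divr_ge0 ?(ltW kappa0) ?exprn_ge0 ?(ltW t0)//.
    rewrite -dprod; apply: (hk (d t) (graph_map a x) (dp t t0)) => i.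
    case: (split_ordP i) => j ->; rewrite /graph_map.
      by rewrite row_mxEl dl.
    have [[q q'] hq] := enumerates_degree2_coord R j ea.
    rewrite row_mxEr mxE hq dr normrM expr2 mulrA.
    (* |x_q x_q'| <= (c t)(c t) <= c t^2, because c <= 1. *)
    apply: ler_pM => //; apply: (le_trans (xi _)); by rewrite ger_pMl.
  have := hC f sf; rewrite /surface_L2_norm => h.
  have {}h : ((((kappa / t ^+ D) ^+ 2 * m * (2 * (c * t)) ^+ n)%:E `^ 2^-1) <=
      (`|C| * ((t ^+ D)^-1 * K) `^ s)%:E)%E.
    apply: (@le_trans _ _ ((\int[lebesgue_rV n]_x (F x)%:E) `^ 2^-1)%E).
      apply: gt0_ler_poweR => //; rewrite in_itv/= leey andbT.
        by rewrite lee_fin.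
      by apply: integral_ge0 => x _; rewrite lee_fin.
    apply: (le_trans h); apply: (@le_trans _ _ (`|C|%:E * Lp_norm p f)%E).
      by apply: lee_wpmul2r; [exact: Lnorm_ge0|rewrite lee_fin ler_norm].
    rewrite [leRHS]EFinM; apply: lee_wpmul2l; first by rewrite lee_fin.
    by rewrite -dprod; apply: hLp; exact: dp.
  rewrite poweR_EFin lee_fin powR12_sqrt// in h.
  rewrite -[leLHS]sqr_sqrtr// ler_sqr ?nnegrE ?sqrtr_ge0// mulr_ge0// powR_ge0//.
rewrite leNgt; apply/negP => sp.
(* In [key] the left side scales like t^(n - 2D) and the right like t^(-2Ds), with quotient t^-E. E
   > 0 means s < (2D - n)/(2D) = (2n + 3)/(2(n + 2)). *)
pose E : R := 2 * D%:R - n%:R - 2 * (D%:R * s).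
have nR : 0 < n%:R :> R by rewrite ltr0n.
have E0 : 0 < E.
  have E1 : (2 * n + 3)%:R = 2 * n%:R + 3 :> R by rewrite natrD natrM.
  have E2 : (2 * (n + 2))%:R = 2 * (n%:R + 2) :> R by rewrite natrM natrD.
  have E3 : D%:R = n%:R * (n%:R + 2) :> R by rewrite natrM natrD.
  rewrite /E E3.
  have {}sp : s * (2 * (n%:R + 2)) < 2 * n%:R + 3.
    by rewrite -ltr_pdivlMr ?mulr_gt0 ?addr_gt0// -E1 -E2.
  have : 0 < n%:R * (2 * n%:R + 3 - s * (2 * (n%:R + 2))) by rewrite mulr_gt0// subr_gt0.
  by move: (n%:R) => u; lra.
pose a1 := kappa ^+ 2 * m * (2 * c) ^+ n.
pose B1 := (`|C| * K `^ s) ^+ 2.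
have a10 : 0 < a1.
  by apply: mulr_gt0; [apply: mulr_gt0 => //|]; apply: exprn_gt0 => //; exact: mulr_gt0.
have B10 : 0 <= B1 by exact: sqr_ge0.
have key2 t : 0 < t -> c * t <= e -> t <= 1 -> a1 <= B1 * t `^ E.
  move=> t0 te t1; have := key t t0 te t1.
  have tD : 0 < t ^+ D by exact: exprn_gt0.
  have tn : 0 < t ^+ n by exact: exprn_gt0.
  have -> : (kappa / t ^+ D) ^+ 2 * m * (2 * (c * t)) ^+ n = a1 * t ^+ n / (t ^+ D) ^+ 2.
    by rewrite /a1 mulrA [(_ * t) ^+ n]exprMn; field; rewrite gt_eqF.
  rewrite powRM ?invr_ge0 ?(ltW tD) ?(ltW K0)//.
  rewrite [(t ^+ D)^-1 `^ s](_ : _ = t `^ (- (D%:R * s))); last first.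
    by rewrite -powR_invn ?ltW// -powRrM mulNr.
  rewrite ler_pdivrMr ?exprn_gt0// => h.
  have e1 : (t `^ (- (D%:R * s))) ^+ 2 * (t ^+ D) ^+ 2 = t ^+ n * t `^ E.
    rewrite -exprMn -!powR_mulrn ?powR_ge0 ?mulr_ge0 ?powR_ge0 ?ltW//.
    have tne : t != 0 by rewrite gt_eqF.
    rewrite -!powRD ?tne ?implybT// -powRrM; congr (_ `^ _).
    by rewrite /E; ring.
  have : a1 * t ^+ n <= (B1 * t `^ E) * t ^+ n.
    apply: (le_trans h); rewrite /B1 -[leRHS]mulrA [t `^ E * _]mulrC -e1.
    by apply: eqW; ring.
  by rewrite ler_pM2r.
(* Chosen so that B1 q < a1; a t with t^E <= q then contradicts [key2]. Adding 1 keeps q defined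
   when B1 = 0. *)
pose q := a1 / (2 * (B1 + 1)).
have q0 : 0 < q by rewrite divr_gt0// mulr_gt0// ltr_wpDl.
pose t := Num.min (Num.min 1 (e / c)) (q `^ E^-1).
have t0 : 0 < t by rewrite !lt_min ltr01 divr_gt0// powR_gt0.
have t1 : t <= 1 by rewrite !ge_min lexx.
have te : c * t <= e by rewrite mulrC -ler_pdivlMr// !ge_min lexx orbT.
have tq : t `^ E <= q.
  apply: (@le_trans _ _ ((q `^ E^-1) `^ E)).
    by apply: ge0_ler_powR; rewrite ?nnegrE ?powR_ge0 ?(ltW t0) ?(ltW E0)// ge_min lexx orbT.
  by rewrite -powRrM mulVf ?gt_eqF// powRr1 ?(ltW q0).
have := key2 t t0 te t1; apply/negP; rewrite -ltNge.
apply: (@le_lt_trans _ _ (B1 * q)); first exact: ler_wpM2l.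
rewrite /q mulrA ltr_pdivrMr ?mulr_gt0 ?ltr_wpDl// mulrC ltr_pM2l//; lra.
Qed.

(** [gaussian_test] is applied with s = 1/p for finite p and with s = 0 for p = +oo, where it would
    force 1/p0 <= 0. *)
Theorem sharp_exponent_graph R (n l : nat) (a : 'I_l -> {ffun 'I_n -> nat}) :
  (0 < n)%N -> l = ((n * (n + 1)) %/ 2)%N -> enumerates_degree2 a ->
  @sharp_exponent R n l a ((2 * (n + 2))%:R / (2 * n + 3)%:R)%:E.
Proof.
move=> n0 hl ea psi dpsi psip p p1 hp.
have T := gaussian_test ea hl dpsi psip hp _ (gaussian_mass_gt0 R (n + l)).
have pos : 0 < (2 * n + 3)%:R / (2 * (n + 2))%:R :> R.
  by rewrite divr_gt0// ltr0n; lia.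
case: p p1 hp T => [r| |]; last by [].
- rewrite lee_fin => r1 hp T; have r0 : 0 < r by apply: lt_le_trans r1.
  rewrite lee_fin -invf_div -[leLHS]invrK lef_pV2 ?posrE ?invr_gt0//.
  by apply: T => // [|d d0]; [rewrite invr_ge0 ltW|exact: Lp_norm_gaussian_le].
- move=> _ hp T; have := T 0 (lexx 0) => /(_ _ n0) h.
  exfalso; have : (2 * n + 3)%:R / (2 * (n + 2))%:R <= 0 :> R.
    by apply: h => d d0; rewrite powRr0; exact: Linfty_norm_gaussian_le.
  by rewrite leNgt pos.
Qed.

Theorem mainTheorem2 (R : realType) (n l : nat) (hn : (1 <= n)%N)
    (hl : l = ((n * (n + 1)) %/ 2)%N)
    (a : 'I_l -> {ffun 'I_n -> nat}) (ha : enumerates_degree2 a) :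
  let p0 : \bar R := ((2 * (n + 2))%:R / (2 * n + 3)%:R)%:E in
  restriction_estimate a p0 /\ sharp_exponent a p0.
Proof.
by split; [exact: restriction_estimate_graph|exact: sharp_exponent_graph].
Qed.
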